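(* Let $R$ be an artin algebra, $\mathcal{A}=\mathrm{mod}(R)$, and let $\mathcal{C}\subseteq\mathcal{A}$ be a full additive, strictly full, Karoubi closed subcategory which is functorially finite. Then $\mathbb{S}_{\mathcal{C}}:\mathrm{Proj}(\mathcal{H}_{\mathcal{C}})\to\mathrm{Inj}(\mathcal{H}_{\mathcal{C}})$ is an equivalence of categories. Moreover, if in addition $\mathcal{A}$ has finite $\mathcal{C}$-dimension, then the extension $\mathbb{S}_{\mathcal{C}}:\mathcal{T}_{\mathcal{C}}\to\mathcal{T}_{\mathcal{C}}$ restricts to an auto-equivalence $\mathbb{S}_{\mathcal{C}}:\mathcal{T}^b_{\mathcal{C}}\to\mathcal{T}^b_{\mathcal{C}}$ of triangulated categories.
   Context: $R$ is finite over its center $k$, a commutative artinian ring; $\mathrm{mod}(R)$ is the category of finitely generated left $R$-modules; $\mathbb{D}=\mathrm{Hom}_k(-,E)$ with $E$ the injective hull of $k/\mathrm{rad}(k)$ as $k$-module. Strictly full means closed under isomorphisms; Karoubi closed means closed under direct summands in $\mathcal{A}$. $\mathcal{T}_{\mathcal{C}}=K^-(\mathcal{C})$ (bounded above cochain complexes modulo homotopy) is a full triangulated subcategory of $\mathcal{T}_{\mathcal{A}}=K^-(\mathcal{A})$, and $\mathcal{T}^b_{\mathcal{C}}=K^b(\mathcal{C})$ is its subcategory of bounded complexes. A $\mathcal{C}$-approximation of $X\in\mathcal{T}_{\mathcal{A}}$ is a quasi-isomorphism $X_{\mathcal{C}}\to X$ with $X_{\mathcal{C}}\in\mathcal{T}_{\mathcal{C}}$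 inducing an isomorphism $\mathrm{Hom}_{\mathcal{T}_{\mathcal{C}}}(-,X_{\mathcal{C}})\to\mathrm{Hom}_{\mathcal{T}_{\mathcal{A}}}(-,X)|_{\mathcal{T}_{\mathcal{C}}}$. $\mathcal{C}$ is $\mathcal{A}$-approximating if every $X\in\mathcal{T}_{\mathcal{A}}$ has a $\mathcal{C}$-approximation; then $\pi_{\mathcal{C}}X=X_{\mathcal{C}}$ defines a functor $\pi_{\mathcal{C}}:\mathcal{T}_{\mathcal{A}}\to\mathcal{T}_{\mathcal{C}}$ right adjoint to the inclusion. $\mathcal{C}$ is functorially finite if $\mathcal{C}$ is $\mathcal{A}$-approximating and $\mathcal{C}^{op}$ is $\mathcal{A}^{op}$-approximating. A $\mathcal{C}$-resolution of $M\in\mathcal{A}$ is an exact sequence $\cdots\to C^{-1}\to C^0\to M\to 0$ with $C^i\in\mathcal{C}$ which stays exact after applying $\mathrm{Hom}_{\mathcal{A}}(C,-)$ for all $C\in\mathcal{C}$. The $\mathcal{C}$-dimension of $M$ is the smallest $n\in\mathbb{N}\cup\{\infty\}$ such that $M$ has a $\mathcal{C}$-resolution $0\to C^{-n}\to\cdots\to C^0\to M\to 0$; the $\mathcal{C}$-dimension of $\mathcal{A}$ is the supremum over its objects. $\mathcal{H}_{\mathcal{A}}$ is the abelian category of complexes $[X^{-2}\to X^{-1}\to X^0]$ in $\mathcal{A}$ with no cohomology in negative degrees, morphisms modulo homotopy. $\mathcal{T}^{\leq 0}_{\mathcal{C}}$ is the strictly full subcategory of $\mathcal{T}_{\mathcal{C}}$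 generated by complexes with $X^i=0$ for $i>0$; it is the $\leq 0$ part of a $t$-structure with $\mathcal{T}^{\geq 0}_{\mathcal{C}}=\{X\mid\mathrm{Hom}_{\mathcal{T}_{\mathcal{C}}}(\mathcal{T}^{\leq 0}_{\mathcal{C}}[1],X)=0\}$, and $\mathcal{H}_{\mathcal{C}}$ is its heart, an abelian category; $\pi_{\mathcal{C}}(\mathcal{H}_{\mathcal{A}})=\mathcal{H}_{\mathcal{C}}$. $\mathsf{P}_M$ is the complex with $M$ in degree $0$; $M\mapsto\mathsf{P}_M$ gives equivalences $\mathcal{A}\cong\mathrm{Proj}(\mathcal{H}_{\mathcal{A}})$ and $\mathcal{C}\cong\mathrm{Proj}(\mathcal{H}_{\mathcal{C}})$, and $\mathcal{T}_{\mathcal{C}}\cong K^-(\mathrm{Proj}(\mathcal{H}_{\mathcal{C}}))\cong D^-(\mathcal{H}_{\mathcal{C}})$. For $M\in\mathcal{A}$, $\mathbb{S}_{\mathcal{A}}\mathsf{P}_M$ is the unique injective object of $\mathcal{H}_{\mathcal{A}}$ with $\mathbb{D}\,\mathrm{Hom}_{\mathcal{H}_{\mathcal{A}}}(\mathsf{P}_M,-)\cong\mathrm{Hom}_{\mathcal{H}_{\mathcal{A}}}(-,\mathbb{S}_{\mathcal{A}}\mathsf{P}_M)$; this gives an equivalence $\mathbb{S}_{\mathcal{A}}:\mathrm{Proj}(\mathcal{H}_{\mathcal{A}})\to\mathrm{Inj}(\mathcal{H}_{\mathcal{A}})$. $\mathbb{S}_{\mathcal{C}}:=\pi_{\mathcal{C}}\circ\mathbb{S}_{\mathcal{A}}|_{\mathrm{Proj}(\mathcal{H}_{\mathcal{C}})}$,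 which takes values in $\mathrm{Inj}(\mathcal{H}_{\mathcal{C}})$. Its extension to $\mathcal{T}_{\mathcal{C}}$ is the composition $\mathcal{T}_{\mathcal{C}}\cong K^-(\mathrm{Proj}(\mathcal{H}_{\mathcal{C}}))\xrightarrow{\mathbb{S}_{\mathcal{C}}}K^-(\mathrm{Inj}(\mathcal{H}_{\mathcal{C}}))\to K^-(\mathcal{H}_{\mathcal{C}})\to D^-(\mathcal{H}_{\mathcal{C}})\cong K^-(\mathrm{Proj}(\mathcal{H}_{\mathcal{C}}))\cong\mathcal{T}_{\mathcal{C}}$. *)

(* Defs.v *)
From HB Require Import structures.
From mathcomp Require Import all_boot all_order all_algebra.
From mathcomp Require Import boolp.

Set Implicit Arguments.
Unset Strict Implicit.
Unset Printing Implicit Defensive.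

Import Order.TTheory GRing.Theory Num.Theory.
Local Open Scope ring_scope.
Local Open Scope quotient_scope.

Record cat := Cat {
  ob :> Type;
  hom : ob -> ob -> Type;
  idm : forall X, hom X X;
  comp : forall X Y Z, hom Y Z -> hom X Y -> hom X Z;
  comp1m : forall X Y (f : hom X Y), comp (idm Y) f = f;
  compm1 : forall X Y (f : hom X Y), comp f (idm X) = f;
  compA : forall X Y Z T (h : hom Z T) (g : hom Y Z) (f : hom X Y),
    comp h (comp g f) = comp (comp h g) f }.
Arguments hom {c} _ _.
Arguments idm {c} X.
Arguments comp {c X Y Z} g f.

Definition is_iso (A : cat) (X Y : A) (f : hom X Y) : Prop :=
  exists g : hom Y X, comp g f = idm X /\ comp f g = idm Y.

Definition isomorphic (A : cat) (X Y : A) : Prop :=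
  exists f : hom X Y, is_iso f.

Record functor (A B : cat) := Functor {
  fob :> A -> B;
  fmap : forall X Y, hom X Y -> hom (fob X) (fob Y);
  fmap1 : forall X, fmap (idm X) = idm (fob X);
  fmapM : forall X Y Z (g : hom Y Z) (f : hom X Y),
    fmap (comp g f) = comp (fmap g) (fmap f) }.
Arguments fmap {A B} F {X Y} f : rename.

Definition fid (A : cat) : functor A A :=
  @Functor A A id (fun _ _ f => f) (fun _ => erefl) (fun _ _ _ _ _ => erefl).

Section FunctorComposition.
Variables (A B D : cat) (G : functor B D) (F : functor A B).

Fact fcomp1 X : fmap G (fmap F (idm X)) = idm (G (F X)).
Proof. by rewrite !fmap1. Qed.

Fact fcompM X Y Z (g : hom Y Z) (f : hom X Y) :
  fmap G (fmap F (comp g f)) = comp (fmap G (fmap F g)) (fmap G (fmap F f)).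
Proof. by rewrite !fmapM. Qed.

Definition fcomp : functor A D :=
  @Functor A D (fun X => G (F X)) (fun X Y f => fmap G (fmap F f))
    fcomp1 fcompM.
End FunctorComposition.

Record natiso (A B : cat) (F G : functor A B) := NatIso {
  nt :> forall X, hom (F X) (G X);
  nt_nat : forall X Y (f : hom X Y),
    comp (nt Y) (fmap F f) = comp (fmap G f) (nt X);
  nt_iso : forall X, is_iso (nt X) }.

Definition quasi_inverse (A B : cat) (F : functor A B) (G : functor B A) :
    Prop :=
  inhabited (natiso (fcomp G F) (fid A)) /\
  inhabited (natiso (fcomp F G) (fid B)).

Definition is_equivalence (A B : cat) (F : functor A B) : Prop :=
  exists G : functor B A, quasi_inverse F G.

(* The Gabriel-Zisman localization of [A] at [W]. *)
Section Localization.
Variables (A : cat) (W : forall X Y : A, hom X Y -> Prop).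

Inductive zigzag : A -> A -> Type :=
| zz_map X Y of hom X Y : zigzag X Y
| zz_inv X Y (w : hom X Y) of W w : zigzag Y X
| zz_comp X Y Z of zigzag Y Z & zigzag X Y : zigzag X Z.

Inductive zzeq : forall X Y, zigzag X Y -> zigzag X Y -> Prop :=
| zz_refl X Y (a : zigzag X Y) : zzeq a a
| zz_sym X Y (a b : zigzag X Y) : zzeq a b -> zzeq b a
| zz_trans X Y (a b c : zigzag X Y) : zzeq a b -> zzeq b c -> zzeq a c
| zz_congr X Y Z (a a' : zigzag Y Z) (b b' : zigzag X Y) :
    zzeq a a' -> zzeq b b' -> zzeq (zz_comp a b) (zz_comp a' b')
| zz_assoc X Y Z T (c : zigzag Z T) (b : zigzag Y Z) (a : zigzag X Y) :
    zzeq (zz_comp c (zz_comp b a)) (zz_comp (zz_comp c b) a)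
| zz_1l X Y (a : zigzag X Y) : zzeq (zz_comp (zz_map (idm Y)) a) a
| zz_1r X Y (a : zigzag X Y) : zzeq (zz_comp a (zz_map (idm X))) a
| zz_mapM X Y Z (g : hom Y Z) (f : hom X Y) :
    zzeq (zz_map (comp g f)) (zz_comp (zz_map g) (zz_map f))
| zz_invl X Y (w : hom X Y) (hw : W w) :
    zzeq (zz_comp (zz_inv hw) (zz_map w)) (zz_map (idm X))
| zz_invr X Y (w : hom X Y) (hw : W w) :
    zzeq (zz_comp (zz_map w) (zz_inv hw)) (zz_map (idm Y)).

(* A morphism of the localization is an equivalence class of zigzags.  The
   quotient is not taken with [{eq_quot _}] because zigzags contain objects of
   [A], so that they would have to be a [choiceType] in the universe of
   objects. *)
Definition lochom (X Y : A) := {c : zigzag X Y -> Prop | exists a, c = zzeq a}.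

Definition loc_class X Y (a : zigzag X Y) : lochom X Y :=
  exist _ (zzeq a) (ex_intro _ a erefl).

Definition loc_repr X Y (c : lochom X Y) : zigzag X Y :=
  projT1 (cid (proj2_sig c)).

Lemma loc_reprK X Y (c : lochom X Y) : loc_class (loc_repr c) = c.
Proof.
rewrite /loc_class /loc_repr; case: c => c hc /=; case: cid => a /= ha.
by apply: eq_exist; rewrite ha.
Qed.

Lemma loc_classP X Y (a b : zigzag X Y) :
  loc_class a = loc_class b <-> zzeq a b.
Proof.
split=> [/(congr1 (@proj1_sig _ _)) /= ->|ab]; first exact: zz_refl.
apply: eq_exist; apply/funext => c; apply/propext; split => h.
  exact: zz_trans (zz_sym ab) h.
exact: zz_trans ab h.
Qed.

Lemma loc_repr_class X Y (a : zigzag X Y) : zzeq (loc_repr (loc_class a)) a.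
Proof. by apply/loc_classP; rewrite loc_reprK. Qed.

Definition loc_comp X Y Z (g : lochom Y Z) (f : lochom X Y) : lochom X Z :=
  loc_class (zz_comp (loc_repr g) (loc_repr f)).

Definition loc_id X : lochom X X := loc_class (zz_map (idm X)).

Fact loc_comp1m X Y (f : lochom X Y) : loc_comp (loc_id Y) f = f.
Proof.
rewrite -[RHS]loc_reprK; apply/loc_classP.
exact: zz_trans (zz_congr (loc_repr_class _) (zz_refl _)) (zz_1l _).
Qed.

Fact loc_compm1 X Y (f : lochom X Y) : loc_comp f (loc_id X) = f.
Proof.
rewrite -[RHS]loc_reprK; apply/loc_classP.
exact: zz_trans (zz_congr (zz_refl _) (loc_repr_class _)) (zz_1r _).
Qed.

Fact loc_compA X Y Z T (h : lochom Z T) (g : lochom Y Z) (f : lochom X Y) :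
  loc_comp h (loc_comp g f) = loc_comp (loc_comp h g) f.
Proof.
apply/loc_classP; apply: zz_trans (zz_congr (zz_refl _) (loc_repr_class _)) _.
apply: zz_trans (zz_assoc _ _ _) _.
exact: zz_sym (zz_congr (loc_repr_class _) (zz_refl _)).
Qed.

Definition localization : cat := Cat loc_comp1m loc_compm1 loc_compA.

Fact loc_funM X Y Z (g : hom Y Z) (f : hom X Y) :
  loc_class (zz_map (comp g f)) =
  loc_comp (loc_class (zz_map g)) (loc_class (zz_map f)).
Proof.
apply/loc_classP; apply: zz_trans (zz_mapM _ _) _.
exact: zz_sym (zz_congr (loc_repr_class _) (loc_repr_class _)).
Qed.

Definition loc_functor : functor A localization :=
  @Functor A localization id (fun X Y f => loc_class (zz_map f))
    (fun _ => erefl) loc_funM.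
End Localization.

Record submod (k : pzRingType) (V : lmodType k) := Submod {
  insub_mod :> V -> Prop;
  submod0 : insub_mod 0;
  submod_lin : forall a x y,
    insub_mod x -> insub_mod y -> insub_mod (a *: x + y) }.

Section QuotientModule.
Variables (k : pzRingType) (V : lmodType k) (N : submod V).

Definition qrel : rel V := fun x y => `[< N (x - y) >].

Fact submodD x y : N x -> N y -> N (x + y).
Proof. by move=> hx hy; rewrite -[x]scale1r; apply: submod_lin. Qed.

Fact submodZ a x : N x -> N (a *: x).
Proof. by move=> hx; rewrite -[_ *: _]addr0; apply: submod_lin (submod0 N). Qed.

Fact submodN x : N x -> N (- x).
Proof. by move=> hx; rewrite -scaleN1r; apply: submodZ. Qed.

Fact qrel_refl : reflexive qrel.
Proof. by move=> x; apply/asboolP; rewrite subrr; apply: submod0. Qed.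

Fact qrel_sym : symmetric qrel.
Proof.
by move=> x y; apply/asboolP/asboolP => /submodN; rewrite opprB.
Qed.

Fact qrel_trans : transitive qrel.
Proof.
move=> y x z /asboolP hxy /asboolP hyz; apply/asboolP.
by rewrite -(subrK y x) -addrA; apply: submodD.
Qed.

Canonical qrel_equiv := EquivRel qrel qrel_refl qrel_sym qrel_trans.

Definition quotmod : Type := {eq_quot qrel}.
HB.instance Definition _ := Choice.on quotmod.

Definition qpi (x : V) : quotmod := \pi_{eq_quot qrel} x.
Definition qrepr (x : quotmod) : V := repr (x : {eq_quot qrel}).

Lemma qpi_repr (x : quotmod) : qpi (qrepr x) = x.
Proof. exact: reprK. Qed.

Lemma qpiP x y : qpi x = qpi y <-> N (x - y).
Proof.
split=> [/eqmodP|h]; first by move/asboolP.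
by apply/eqmodP; apply/asboolP.
Qed.

Lemma qrepr_pi x : N (qrepr (qpi x) - x).
Proof. by apply/qpiP; rewrite qpi_repr. Qed.

Definition qzero : quotmod := qpi 0.
Definition qadd (x y : quotmod) : quotmod := qpi (qrepr x + qrepr y).
Definition qopp (x : quotmod) : quotmod := qpi (- qrepr x).
Definition qscale a (x : quotmod) : quotmod := qpi (a *: qrepr x).

Lemma qaddE x y : qadd (qpi x) (qpi y) = qpi (x + y).
Proof.
by apply/qpiP; rewrite opprD addrACA; apply: submodD; apply: qrepr_pi.
Qed.

Lemma qoppE x : qopp (qpi x) = qpi (- x).
Proof. by apply/qpiP; rewrite -opprD; apply: submodN; apply: qrepr_pi. Qed.

Lemma qscaleE a x : qscale a (qpi x) = qpi (a *: x).
Proof. by apply/qpiP; rewrite -scalerBr; apply: submodZ; apply: qrepr_pi. Qed.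

Fact qaddA : associative qadd.
Proof.
move=> x y z; rewrite -(qpi_repr x) -(qpi_repr y) -(qpi_repr z).
by rewrite !qaddE addrA.
Qed.

Fact qaddC : commutative qadd.
Proof.
by move=> x y; rewrite -(qpi_repr x) -(qpi_repr y) !qaddE addrC.
Qed.

Fact qadd0 : left_id qzero qadd.
Proof. by move=> x; rewrite -(qpi_repr x) qaddE add0r. Qed.

Fact qaddN : left_inverse qzero qopp qadd.
Proof. by move=> x; rewrite -(qpi_repr x) qoppE qaddE addNr. Qed.

HB.instance Definition _ :=
  GRing.isZmodule.Build quotmod qaddA qaddC qadd0 qaddN.

Fact qscaleA a b x : qscale a (qscale b x) = qscale (a * b) x.
Proof. by rewrite -(qpi_repr x) !qscaleE scalerA. Qed.

Fact qscale1 : left_id 1 qscale.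
Proof. by move=> x; rewrite -(qpi_repr x) qscaleE scale1r. Qed.

Fact qscaleDr : right_distributive qscale +%R.
Proof.
move=> a x y; rewrite -(qpi_repr x) -(qpi_repr y).
rewrite -[LHS]/(qscale a (qadd _ _)) -[RHS]/(qadd (qscale a _) (qscale a _)).
by rewrite qaddE !qscaleE qaddE scalerDr.
Qed.

Fact qscaleDl x : {morph qscale^~ x : a b / a + b}.
Proof.
move=> a b; rewrite -(qpi_repr x).
rewrite -[RHS]/(qadd (qscale a _) (qscale b _)).
by rewrite !qscaleE !qaddE scalerDl.
Qed.

HB.instance Definition _ := GRing.Zmodule_isLmodule.Build k quotmod
  qscaleA qscale1 qscaleDr qscaleDl.

Fact qpi_linear : linear qpi.
Proof.
by move=> a x y; rewrite -[RHS]/(qadd (qscale _ _) _) qscaleE qaddE.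
Qed.

HB.instance Definition _ := GRing.isLinear.Build k V quotmod _ qpi qpi_linear.
End QuotientModule.

Section QuotientMap.
Variables (k : pzRingType) (V W : lmodType k) (N : submod V) (N' : submod W).
Variables (f : V -> W) (f_lin : linear f) (fN : forall v, N v -> N' (f v)).

Definition qmap (x : quotmod N) : quotmod N' := qpi N' (f (qrepr x)).

Lemma qmapE v : qmap (qpi N v) = qpi N' (f v).
Proof.
apply/qpiP; suff -> : forall x y, f x - f y = f (x - y).
  by apply: fN; apply/qpiP; rewrite qpi_repr.
by move=> x y; rewrite addrC -scaleN1r -f_lin scaleN1r addrC.
Qed.

Fact qmap_linear : linear qmap.
Proof.
move=> a x y; rewrite -(qpi_repr x) -(qpi_repr y) -linearP !qmapE f_lin.
by rewrite linearP.
Qed.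
End QuotientMap.

Record lincat (k : comPzRingType) := LinCat {
  lob :> Type;
  lhom : lob -> lob -> lmodType k;
  lid : forall X, lhom X X;
  lcomp : forall X Y Z, lhom Y Z -> lhom X Y -> lhom X Z;
  lcomp1m : forall X Y (f : lhom X Y), lcomp (lid Y) f = f;
  lcompm1 : forall X Y (f : lhom X Y), lcomp f (lid X) = f;
  lcompA : forall X Y Z T (h : lhom Z T) (g : lhom Y Z) (f : lhom X Y),
    lcomp h (lcomp g f) = lcomp (lcomp h g) f;
  lcompPl : forall X Y Z (f : lhom X Y) a (g g' : lhom Y Z),
    lcomp (a *: g + g') f = a *: lcomp g f + lcomp g' f;
  lcompPr : forall X Y Z (g : lhom Y Z) a (f f' : lhom X Y),
    lcomp g (a *: f + f') = a *: lcomp g f + lcomp g f' }.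
Arguments lhom {k l} _ _.
Arguments lid {k l} X.
Arguments lcomp {k l X Y Z} g f.

Notation "g \oL f" := (lcomp g f)
  (at level 40, left associativity) : ring_scope.

Coercion cat_of (k : comPzRingType) (A : lincat k) : cat :=
  Cat (@lcomp1m k A) (@lcompm1 k A) (@lcompA k A).
Canonical cat_of.

Section LinCatTheory.
Variables (k : comPzRingType) (A : lincat k).
Implicit Types X Y Z : A.

Lemma lcompDl X Y Z (f : lhom X Y) (g g' : lhom Y Z) :
  (g + g') \oL f = g \oL f + g' \oL f.
Proof. by rewrite -[g]scale1r lcompPl !scale1r. Qed.

Lemma lcompDr X Y Z (g : lhom Y Z) (f f' : lhom X Y) :
  g \oL (f + f') = g \oL f + g \oL f'.
Proof. by rewrite -[f]scale1r lcompPr !scale1r. Qed.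

Lemma lcomp0m X Y Z (f : lhom X Y) : (0 : lhom Y Z) \oL f = 0.
Proof. by apply: (addrI (0 \oL f)); rewrite -lcompDl !addr0. Qed.

Lemma lcompm0 X Y Z (g : lhom Y Z) : g \oL (0 : lhom X Y) = 0.
Proof. by apply: (addrI (g \oL 0)); rewrite -lcompDr !addr0. Qed.

Lemma lcompZl X Y Z (f : lhom X Y) a (g : lhom Y Z) :
  (a *: g) \oL f = a *: (g \oL f).
Proof. by rewrite -[a *: g]addr0 lcompPl lcomp0m addr0. Qed.

Lemma lcompZr X Y Z (g : lhom Y Z) a (f : lhom X Y) :
  g \oL (a *: f) = a *: (g \oL f).
Proof. by rewrite -[a *: f]addr0 lcompPr lcompm0 addr0. Qed.

Lemma lcompNl X Y Z (f : lhom X Y) (g : lhom Y Z) : (- g) \oL f = - (g \oL f).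
Proof. by rewrite -scaleN1r lcompZl scaleN1r. Qed.

Lemma lcompNr X Y Z (g : lhom Y Z) (f : lhom X Y) : g \oL (- f) = - (g \oL f).
Proof. by rewrite -scaleN1r lcompZr scaleN1r. Qed.
End LinCatTheory.

Section Op.
Variables (k : comPzRingType) (A : lincat k).

Definition op : lincat k := @LinCat k A (fun X Y => @lhom k A Y X)
  (fun X => lid X) (fun X Y Z g f => f \oL g)
  (fun X Y f => lcompm1 f) (fun X Y f => lcomp1m f)
  (fun X Y Z T h g f => esym (lcompA f g h))
  (fun X Y Z f a g g' => lcompPr f a g g')
  (fun X Y Z g a f f' => lcompPl g a f f').
End Op.

Section LinCatNotions.
Variables (k : comPzRingType) (A : lincat k).
Implicit Types X Y Z K : A.

Definition is_zero X : Prop := lid X = 0.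

Definition epi X Y (f : lhom X Y) : Prop :=
  forall Z (g h : lhom Y Z), g \oL f = h \oL f -> g = h.

Definition mono X Y (f : lhom X Y) : Prop :=
  forall Z (g h : lhom Z X), f \oL g = f \oL h -> g = h.

Definition is_kernel K X Y (i : lhom K X) (f : lhom X Y) : Prop :=
  f \oL i = 0 /\
  forall T (t : lhom T X), f \oL t = 0 -> exists! u : lhom T K, i \oL u = t.

Definition is_cokernel X Y Q (q : lhom Y Q) (f : lhom X Y) : Prop :=
  q \oL f = 0 /\
  forall T (t : lhom Y T), t \oL f = 0 -> exists! u : lhom Q T, u \oL q = t.

(* In an abelian category: [f] corestricts to an epimorphism onto [ker g]. *)
Definition exact_at X Y Z (f : lhom X Y) (g : lhom Y Z) : Prop :=
  g \oL f = 0 /\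
  exists K (i : lhom K Y) (p : lhom X K),
    [/\ is_kernel i g, i \oL p = f & epi p].

Record is_biprod Z X Y (iX : lhom X Z) (iY : lhom Y Z)
    (pX : lhom Z X) (pY : lhom Z Y) : Prop := IsBiprod {
  biprodXX : pX \oL iX = lid X;
  biprodYY : pY \oL iY = lid Y;
  biprodXY : pX \oL iY = 0;
  biprodYX : pY \oL iX = 0;
  biprod1 : iX \oL pX + iY \oL pY = lid Z }.

Definition projective P : Prop :=
  forall X Y (e : lhom X Y) (f : lhom P Y), epi e ->
    exists g : lhom P X, e \oL g = f.

Definition injective_ob I : Prop :=
  forall X Y (m : lhom X Y) (f : lhom X I), mono m ->
    exists g : lhom Y I, g \oL m = f.

Section Subcategory.
Variable C : A -> Prop.

Definition strictly_full : Prop := forall X Y, isomorphic X Y -> C X -> C Y.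

Definition additive_sub : Prop :=
  (exists Z, is_zero Z /\ C Z) /\
  forall X Y, C X -> C Y ->
    exists Z iX iY pX pY, @is_biprod Z X Y iX iY pX pY /\ C Z.

Definition karoubi_closed : Prop :=
  forall Z X Y iX iY pX pY, @is_biprod Z X Y iX iY pX pY -> C Z -> C X.

Record is_resolution (M : A) (F : nat -> A)
    (d : forall n, lhom (F n.+1) (F n)) (e : lhom (F 0%N) M) : Prop := {
  res_in : forall n, C (F n);
  res_epi : epi e;
  res_exact0 : exact_at (d 0%N) e;
  res_exactS : forall n, exact_at (d n.+1) (d n);
  res_hom_epi : forall X, C X -> forall u : lhom X M,
    exists v, e \oL v = u;
  res_hom_exact0 : forall X, C X -> forall u : lhom X (F 0%N),
    e \oL u = 0 -> exists v, d 0%N \oL v = u;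
  res_hom_exactS : forall X, C X -> forall n (u : lhom X (F n.+1)),
    d n \oL u = 0 -> exists v, d n.+1 \oL v = u }.

Definition has_resolution (M : A) (n : nat) : Prop :=
  exists F d e, @is_resolution M F d e /\
    forall m, (n < m)%N -> is_zero (F m).

Definition has_dim (M : A) (n : nat) : Prop :=
  has_resolution M n /\ forall m, has_resolution M m -> (n <= m)%N.

Definition finite_dim : Prop :=
  exists N, forall M, exists n, has_dim M n /\ (n <= N)%N.
End Subcategory.
End LinCatNotions.

Section FullSub.
Variables (k : comPzRingType) (A : lincat k) (P : A -> Prop).

Definition fullsub : lincat k :=
  @LinCat k {X : A | P X} (fun X Y => lhom (proj1_sig X) (proj1_sig Y))
    (fun X => lid (proj1_sig X)) (fun X Y Z g f => g \oL f)
    (fun X Y f => lcomp1m f) (fun X Y f => lcompm1 f)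
    (fun X Y Z T h g f => lcompA h g f)
    (fun X Y Z f a g g' => lcompPl f a g g')
    (fun X Y Z g a f f' => lcompPr g a f f').

Definition Proj : A -> Prop :=
  fun X => exists h : P X, projective (exist _ X h : fullsub).

Definition Inj : A -> Prop :=
  fun X => exists h : P X, injective_ob (exist _ X h : fullsub).
End FullSub.

Record linfunctor (k : comPzRingType) (A B : lincat k) := LinFunctor {
  lfun :> functor A B;
  lfunP : forall (X Y : A) a (f g : lhom X Y),
    fmap lfun (a *: f + g : lhom X Y) =
    a *: (fmap lfun f : lhom (lfun X) (lfun Y)) + fmap lfun g
      :> lhom (lfun X) (lfun Y) }.

Section LinFunctors.
Variables (k : comPzRingType).

Definition lmap (A B : lincat k) (F : linfunctor A B) (X Y : A)
  (f : lhom X Y) : lhom (F X) (F Y) := fmap F f.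

Lemma lmap_linear (A B : lincat k) (F : linfunctor A B) (X Y : A) :
  linear (@lmap A B F X Y).
Proof. exact: lfunP. Qed.

Lemma lmap0 (A B : lincat k) (F : linfunctor A B) (X Y : A) :
  lmap F (0 : lhom X Y) = 0.
Proof.
rewrite -[0 in LHS](scaler0 _ (- 1)) -[- 1 *: 0]addr0 lmap_linear.
by rewrite scaleN1r addNr.
Qed.

Lemma lmapD (A B : lincat k) (F : linfunctor A B) (X Y : A)
  (f g : lhom X Y) : lmap F (f + g) = lmap F f + lmap F g.
Proof. by rewrite -[f]scale1r lmap_linear !scale1r. Qed.

Lemma lmapM (A B : lincat k) (F : linfunctor A B) (X Y Z : A)
  (g : lhom Y Z) (f : lhom X Y) : lmap F (g \oL f) = lmap F g \oL lmap F f.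
Proof. exact: (fmapM F). Qed.

Lemma lmap1 (A B : lincat k) (F : linfunctor A B) (X : A) :
  lmap F (lid X) = lid (F X).
Proof. exact: (fmap1 F). Qed.

Lemma lmap_zero (A B : lincat k) (F : linfunctor A B) (X : A) :
  is_zero X -> is_zero (F X).
Proof. by rewrite /is_zero -lmap1 => ->; rewrite lmap0. Qed.

Section Comp.
Variables (A B D : lincat k) (G : linfunctor B D) (F : linfunctor A B).

Fact lfcompP (X Y : A) a (f g : lhom X Y) :
  fmap (fcomp G F) (a *: f + g : lhom X Y) =
    a *: (fmap (fcomp G F) f : lhom (G (F X)) (G (F Y)))
    + fmap (fcomp G F) g :> lhom (G (F X)) (G (F Y)).
Proof. by rewrite /= lfunP lfunP. Qed.

Definition lfcomp : linfunctor A D :=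
  @LinFunctor k A D (fcomp G F) lfcompP.
End Comp.

Section Incl.
Variables (A : lincat k) (P : A -> Prop).

Definition fincl : linfunctor (fullsub P) A :=
  @LinFunctor k (fullsub P) A
    (@Functor (fullsub P) A (@proj1_sig _ _) (fun _ _ f => f)
       (fun _ => erefl) (fun _ _ _ _ _ => erefl))
    (fun _ _ _ _ _ => erefl).

Variables (D : lincat k) (F : linfunctor D A) (hF : forall X, P (F X)).

Definition corestr : linfunctor D (fullsub P) :=
  @LinFunctor k D (fullsub P)
    (@Functor D (fullsub P) (fun X => exist _ (F X) (hF X))
       (fun X Y f => fmap F f) (fmap1 F) (fmapM F))
    (@lfunP _ _ _ F).
End Incl.

Definition subincl (A : lincat k) (P Q : A -> Prop)
    (h : forall X, P X -> Q X) : linfunctor (fullsub P) (fullsub Q) :=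
  @corestr A Q (fullsub P) (fincl P) (fun X => h _ (proj2_sig X)).
End LinFunctors.

Section Complexes.
Variables (k : comPzRingType) (A : lincat k).

Record cplx := Cplx {
  cob :> int -> A;
  cd : forall i, lhom (cob i) (cob (i + 1));
  cdd : forall i, cd (i + 1) \oL cd i = 0;
  cbd : exists n : int, forall i, n < i -> is_zero (cob i) }.

Record cmap (X Y : cplx) := Cmap {
  cfun :> forall i, lhom (X i) (Y i);
  cfunP : forall i, cd Y i \oL cfun i = cfun (i + 1) \oL cd X i }.

Lemma cmap_ext (X Y : cplx) (f g : cmap X Y) : (forall i, f i = g i) -> f = g.
Proof.
case: f g => [f hf] [g hg] /= fg; have {}fg : f = g.
  by apply: functional_extensionality_dep.
by subst g; congr Cmap; apply: Prop_irrelevance.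
Qed.

Section CmapLmod.
Variables X Y : cplx.
Implicit Types f g : cmap X Y.

Fact cmap0P i :
  cd Y i \oL (0 : lhom (X i) (Y i)) = (0 : lhom (X _) (Y _)) \oL cd X i.
Proof. by rewrite lcompm0 lcomp0m. Qed.
Definition cmap0 : cmap X Y := Cmap cmap0P.

Fact cmapDP f g i : cd Y i \oL (f i + g i) = (f _ + g _) \oL cd X i.
Proof. by rewrite lcompDr lcompDl !cfunP. Qed.
Definition cmapD f g : cmap X Y := Cmap (cmapDP f g).

Fact cmapNP f i : cd Y i \oL (- f i) = (- f _) \oL cd X i.
Proof. by rewrite lcompNr lcompNl !cfunP. Qed.
Definition cmapN f : cmap X Y := Cmap (cmapNP f).

Fact cmapZP a f i : cd Y i \oL (a *: f i) = (a *: f _) \oL cd X i.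
Proof. by rewrite lcompZr lcompZl !cfunP. Qed.
Definition cmapZ a f : cmap X Y := Cmap (cmapZP a f).

HB.instance Definition _ := gen_eqMixin (cmap X Y).
HB.instance Definition _ := gen_choiceMixin (cmap X Y).

Fact cmapDA : associative cmapD.
Proof. by move=> f g h; apply: cmap_ext => i /=; rewrite addrA. Qed.
Fact cmapDC : commutative cmapD.
Proof. by move=> f g; apply: cmap_ext => i /=; rewrite addrC. Qed.
Fact cmapD0 : left_id cmap0 cmapD.
Proof. by move=> f; apply: cmap_ext => i /=; rewrite add0r. Qed.
Fact cmapDN : left_inverse cmap0 cmapN cmapD.
Proof. by move=> f; apply: cmap_ext => i /=; rewrite addNr. Qed.

HB.instance Definition _ :=
  GRing.isZmodule.Build (cmap X Y) cmapDA cmapDC cmapD0 cmapDN.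

Fact cmapZA a b f : cmapZ a (cmapZ b f) = cmapZ (a * b) f.
Proof. by apply: cmap_ext => i /=; rewrite scalerA. Qed.
Fact cmapZ1 : left_id 1 cmapZ.
Proof. by move=> f; apply: cmap_ext => i /=; rewrite scale1r. Qed.
Fact cmapZDr : right_distributive cmapZ +%R.
Proof. by move=> a f g; apply: cmap_ext => i /=; rewrite scalerDr. Qed.
Fact cmapZDl f : {morph cmapZ^~ f : a b / a + b}.
Proof. by move=> a b; apply: cmap_ext => i /=; rewrite scalerDl. Qed.

HB.instance Definition _ := GRing.Zmodule_isLmodule.Build k (cmap X Y)
  cmapZA cmapZ1 cmapZDr cmapZDl.

(* Every integer has the form [i + 1], so that the homotopy equation below is
   imposed in all degrees. *)
Definition is_nullhtpy f : Prop :=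
  exists h : forall i, lhom (X (i + 1)) (Y i),
    forall i, f (i + 1) = cd Y i \oL h i + h (i + 1) \oL cd X (i + 1).

Fact nullhtpy0 : is_nullhtpy 0.
Proof.
by exists (fun i => 0) => i /=; rewrite lcompm0 lcomp0m addr0.
Qed.

Fact nullhtpy_lin a f g :
  is_nullhtpy f -> is_nullhtpy g -> is_nullhtpy (a *: f + g).
Proof.
move=> [h hf] [h' hg]; exists (fun i => a *: h i + h' i) => i /=.
by rewrite hf hg lcompPr lcompPl scalerDr addrACA.
Qed.

Definition nullhtpy : submod (cmap X Y) := Submod nullhtpy0 nullhtpy_lin.
End CmapLmod.

Fact cmap1P (X : cplx) i : cd X i \oL lid (X i) = lid _ \oL cd X i.
Proof. by rewrite lcompm1 lcomp1m. Qed.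
Definition cmap1 (X : cplx) : cmap X X := Cmap (@cmap1P X).

Fact cmapMP (X Y Z : cplx) (g : cmap Y Z) (f : cmap X Y) i :
  cd Z i \oL (g i \oL f i) = (g _ \oL f _) \oL cd X i.
Proof. by rewrite lcompA cfunP -lcompA cfunP lcompA. Qed.
Definition cmapM (X Y Z : cplx) (g : cmap Y Z) (f : cmap X Y) : cmap X Z :=
  Cmap (cmapMP g f).

Lemma nullhtpyMl (X Y Z : cplx) (g : cmap Y Z) (f : cmap X Y) :
  is_nullhtpy f -> is_nullhtpy (cmapM g f).
Proof.
case=> h hf; exists (fun i => g i \oL h i) => i /=.
by rewrite hf lcompDr !lcompA cfunP.
Qed.

Lemma nullhtpyMr (X Y Z : cplx) (g : cmap Y Z) (f : cmap X Y) :
  is_nullhtpy g -> is_nullhtpy (cmapM g f).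
Proof.
case=> h hg; exists (fun i => h i \oL f (i + 1)) => i /=.
by rewrite hg lcompDl -!lcompA cfunP.
Qed.

Definition khom (X Y : cplx) : lmodType k := quotmod (nullhtpy X Y).
Definition kclass (X Y : cplx) (f : cmap X Y) : khom X Y := qpi _ f.

Lemma kclassP (X Y : cplx) (f g : cmap X Y) :
  kclass f = kclass g <-> is_nullhtpy (f - g).
Proof. exact: qpiP. Qed.

Definition krepr (X Y : cplx) (f : khom X Y) : cmap X Y := qrepr f.

Lemma kreprK (X Y : cplx) (f : khom X Y) : kclass (krepr f) = f.
Proof. exact: qpi_repr. Qed.

Lemma kclass_linear (X Y : cplx) : linear (@kclass X Y).
Proof. exact: qpi_linear. Qed.

Definition kcomp (X Y Z : cplx) (g : khom Y Z) (f : khom X Y) : khom X Z :=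
  kclass (cmapM (krepr g) (krepr f)).

Lemma kcompE (X Y Z : cplx) (g : cmap Y Z) (f : cmap X Y) :
  kcomp (kclass g) (kclass f) = kclass (cmapM g f).
Proof.
apply/kclassP; set g' := krepr _; set f' := krepr _.
have hg : is_nullhtpy (g' - g) by apply/kclassP; rewrite kreprK.
have hf : is_nullhtpy (f' - f) by apply/kclassP; rewrite kreprK.
have -> : cmapM g' f' - cmapM g f = cmapM (g' - g) f' + cmapM g (f' - f).
  apply: cmap_ext => i /=.
  by rewrite lcompDl lcompNl lcompDr lcompNr addrA subrK.
apply: (@submodD _ _ (nullhtpy X Z)); first exact: nullhtpyMr.
exact: nullhtpyMl.
Qed.

Fact kcomp1m (X Y : cplx) (f : khom X Y) : kcomp (kclass (cmap1 Y)) f = f.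
Proof.
rewrite -[f]kreprK kcompE; congr kclass.
by apply: cmap_ext => i /=; rewrite lcomp1m.
Qed.

Fact kcompm1 (X Y : cplx) (f : khom X Y) : kcomp f (kclass (cmap1 X)) = f.
Proof.
rewrite -[f]kreprK kcompE; congr kclass.
by apply: cmap_ext => i /=; rewrite lcompm1.
Qed.

Fact kcompA (X Y Z T : cplx) (h : khom Z T) (g : khom Y Z) (f : khom X Y) :
  kcomp h (kcomp g f) = kcomp (kcomp h g) f.
Proof.
rewrite -[f]kreprK -[g]kreprK -[h]kreprK !kcompE; congr kclass.
by apply: cmap_ext => i /=; rewrite lcompA.
Qed.

Fact kcompPl (X Y Z : cplx) (f : khom X Y) a (g g' : khom Y Z) :
  kcomp (a *: g + g') f = a *: kcomp g f + kcomp g' f.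
Proof.
rewrite -[f]kreprK -[g]kreprK -[g']kreprK -kclass_linear !kcompE.
rewrite -kclass_linear; congr kclass.
by apply: cmap_ext => i /=; rewrite lcompPl.
Qed.

Fact kcompPr (X Y Z : cplx) (g : khom Y Z) a (f f' : khom X Y) :
  kcomp g (a *: f + f') = a *: kcomp g f + kcomp g f'.
Proof.
rewrite -[g]kreprK -[f]kreprK -[f']kreprK -kclass_linear !kcompE.
rewrite -kclass_linear; congr kclass.
by apply: cmap_ext => i /=; rewrite lcompPr.
Qed.

Definition Kminus : lincat k := @LinCat k cplx khom
  (fun X => kclass (cmap1 X)) kcomp kcomp1m kcompm1 kcompA kcompPl kcompPr.

(* [H] is the cohomology of [X] in degree [i + 1]. *)
Definition is_cohomology (X : cplx) (i : int) (Z H : A)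
    (z : lhom Z (X (i + 1))) (q : lhom Z H) : Prop :=
  is_kernel z (cd X (i + 1)) /\
  exists b : lhom (X i) Z, z \oL b = cd X i /\ is_cokernel q b.

Definition qis_cmap (X Y : cplx) (f : cmap X Y) : Prop :=
  forall i, exists (Z H Z' H' : A)
    (z : lhom Z (X (i + 1))) (q : lhom Z H)
    (z' : lhom Z' (Y (i + 1))) (q' : lhom Z' H')
    (u : lhom Z Z') (v : @hom A H H'),
    [/\ is_cohomology z q, is_cohomology z' q',
        f (i + 1) \oL z = z' \oL u, v \oL q = q' \oL u & is_iso v].

Definition qis (X Y : Kminus) (f : @hom Kminus X Y) : Prop :=
  exists2 g : cmap X Y, f = kclass g & qis_cmap g.

Definition Dminus : cat := localization qis.
Definition Dfun : functor Kminus Dminus := loc_functor qis.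

Fact cshift_dd (X : cplx) i : (- cd X (i + 1 + 1)) \oL (- cd X (i + 1)) = 0.
Proof. by rewrite lcompNl lcompNr opprK cdd. Qed.

Fact cshift_bd (X : cplx) :
  exists n : int, forall i, n < i -> is_zero (X (i + 1)).
Proof.
have [n hn] := cbd X; exists n => i ni; apply: hn.
by apply: lt_trans ni _; rewrite ltrDl.
Qed.

Definition cshift (X : cplx) : cplx :=
  @Cplx (fun i => X (i + 1)) (fun i => - cd X (i + 1))
    (cshift_dd X) (cshift_bd X).

Fact cmap_shiftP (X Y : cplx) (f : cmap X Y) i :
  cd (cshift Y) i \oL f (i + 1) = f (i + 1 + 1) \oL cd (cshift X) i.
Proof. by rewrite /= lcompNl lcompNr cfunP. Qed.

Definition cmap_shift (X Y : cplx) (f : cmap X Y) :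
  cmap (cshift X) (cshift Y) :=
  @Cmap (cshift X) (cshift Y) (fun i => f (i + 1)) (cmap_shiftP f).

Fact cmap_shift_linear (X Y : cplx) : linear (@cmap_shift X Y).
Proof. by move=> a f g; apply: cmap_ext. Qed.

Fact cmap_shift_null (X Y : cplx) (f : cmap X Y) :
  is_nullhtpy f -> is_nullhtpy (cmap_shift f).
Proof.
case=> h hf; exists (fun i => - h (i + 1)) => i /=.
by rewrite hf !lcompNl !lcompNr !opprK.
Qed.

Definition kshift (X Y : cplx) : khom X Y -> khom (cshift X) (cshift Y) :=
  qmap (nullhtpy _ _) (@cmap_shift X Y).

Lemma kshiftE (X Y : cplx) (f : cmap X Y) :
  kshift (kclass f) = kclass (cmap_shift f).
Proof.
apply: (@qmapE _ _ _ (nullhtpy X Y) (nullhtpy (cshift X) (cshift Y))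
  (@cmap_shift X Y)); [exact: cmap_shift_linear|exact: cmap_shift_null].
Qed.

Fact kshift1 (X : cplx) :
  kshift (kclass (cmap1 X)) = kclass (cmap1 (cshift X)).
Proof. by rewrite kshiftE; congr kclass; apply: cmap_ext. Qed.

Fact kshiftM (X Y Z : cplx) (g : khom Y Z) (f : khom X Y) :
  kshift (kcomp g f) = kcomp (kshift g) (kshift f).
Proof.
rewrite -[f]kreprK -[g]kreprK kcompE !kshiftE kcompE.
by congr kclass; apply: cmap_ext.
Qed.

Fact kshift_linear (X Y : cplx) : linear (@kshift X Y).
Proof.
apply: (@qmap_linear _ _ _ (nullhtpy X Y) (nullhtpy (cshift X) (cshift Y))
  (@cmap_shift X Y)); [exact: cmap_shift_linear|exact: cmap_shift_null].
Qed.

Definition shift : linfunctor Kminus Kminus :=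
  @LinFunctor k Kminus Kminus
    (@Functor Kminus Kminus cshift kshift kshift1 kshiftM) kshift_linear.

(* [Z] is the mapping cone of [f], i.e. [Z^i = X^(i+1) (+) Y^i] with
   differential [(x, y) |-> (- d x, f x + d y)], for any choice of the
   biproducts; [v] and [w] are the canonical maps [Y -> Z] and [Z -> X[1]]. *)
Definition is_cone (X Y Z : cplx) (f : cmap X Y)
    (v : cmap Y Z) (w : cmap Z (cshift X)) : Prop :=
  exists (iX : forall i, lhom (X (i + 1)) (Z i))
         (pY : forall i, lhom (Z i) (Y i)),
    (forall i, is_biprod (iX i) (v i) (w i) (pY i)) /\
    forall i, cd Z i =
      - (iX (i + 1) \oL cd X (i + 1) \oL w i)
      + v (i + 1) \oL (f (i + 1) \oL w i + cd Y i \oL pY i).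

Definition distinguished (X Y Z : Kminus) (u : lhom X Y) (v : lhom Y Z)
    (w : lhom Z (shift X)) : Prop :=
  exists (X' Y' Z' : Kminus) (f : cmap X' Y') (g : cmap Y' Z')
    (h : cmap Z' (cshift X'))
    (a : @hom Kminus X X') (b : @hom Kminus Y Y') (c : @hom Kminus Z Z'),
    is_cone f g h /\ [/\ is_iso a, is_iso b & is_iso c] /\
    [/\ b \oL u = (kclass f : lhom X' Y') \oL a,
        c \oL v = (kclass g : lhom Y' Z') \oL b &
        lmap shift a \oL w = (kclass h : lhom Z' (shift X')) \oL c].

(* The complexes [P_M]; [O] is a chosen zero object. *)
Section Stalk.
Variables (O : A) (hO : is_zero O).

Definition stalk_ob (M : A) (i : int) : A :=
  if i is Posz 0%N then M else O.

Fact stalk_bd M : exists n : int, forall i, n < i -> is_zero (stalk_ob M i).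
Proof. by exists 0; case=> [[|n]|n]. Qed.

Definition stalk_cplx (M : A) : cplx :=
  @Cplx (stalk_ob M) (fun i => 0) (fun i => lcompm0 _ _) (stalk_bd M).

Definition stalk_fun (M N : A) (f : lhom M N) (i : int) :
    lhom (stalk_ob M i) (stalk_ob N i) :=
  match i with Posz 0%N => f | _ => 0 end.

Fact stalk_funP M N (f : lhom M N) i :
  cd (stalk_cplx N) i \oL stalk_fun f i =
  stalk_fun f (i + 1) \oL cd (stalk_cplx M) i.
Proof. by rewrite /= lcomp0m lcompm0. Qed.

Definition stalk_cmap M N (f : lhom M N) :
  cmap (stalk_cplx M) (stalk_cplx N) :=
  @Cmap (stalk_cplx M) (stalk_cplx N) (stalk_fun f) (stalk_funP f).

Definition stalk_map M N (f : lhom M N) :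
  khom (stalk_cplx M) (stalk_cplx N) := kclass (stalk_cmap f).

Fact stalk_map1 M : stalk_map (lid M) = kclass (cmap1 (stalk_cplx M)).
Proof. by congr kclass; apply: cmap_ext => -[[|n]|n]. Qed.

Fact stalk_mapM M N L (g : lhom N L) (f : lhom M N) :
  stalk_map (g \oL f) = kcomp (stalk_map g) (stalk_map f).
Proof.
rewrite /stalk_map kcompE; congr kclass.
by apply: cmap_ext => -[[|n]|n] //=; rewrite lcomp0m.
Qed.

Fact stalk_map_linear M N : linear (@stalk_map M N).
Proof.
move=> a f g; rewrite /stalk_map -kclass_linear; congr kclass.
by apply: cmap_ext => -[[|n]|n] //=; rewrite scaler0 addr0.
Qed.

Definition stalk : linfunctor A Kminus :=
  @LinFunctor k A Kminus
    (@Functor A Kminus stalk_cplx stalk_map stalk_map1 stalk_mapM)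
    stalk_map_linear.
End Stalk.
End Complexes.

Section Kmap.
Variables (k : comPzRingType) (A B : lincat k) (F : linfunctor A B).

Fact Kmap_dd (X : cplx A) i : lmap F (cd X (i + 1)) \oL lmap F (cd X i) = 0.
Proof. by rewrite -lmapM cdd lmap0. Qed.

Fact Kmap_bd (X : cplx A) :
  exists n : int, forall i, n < i -> is_zero (F (X i)).
Proof.
by have [n hn] := cbd X; exists n => i ni; apply: lmap_zero; apply: hn.
Qed.

Definition Kmap_ob (X : cplx A) : cplx B :=
  @Cplx k B (fun i => F (X i)) (fun i => lmap F (cd X i))
    (Kmap_dd X) (Kmap_bd X).

Fact Kmap_cmapP (X Y : cplx A) (f : cmap X Y) i :
  cd (Kmap_ob Y) i \oL lmap F (f i) = lmap F (f (i + 1)) \oL cd (Kmap_ob X) i.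
Proof. by rewrite /= -!lmapM cfunP. Qed.

Definition Kmap_cmap (X Y : cplx A) (f : cmap X Y) :
  cmap (Kmap_ob X) (Kmap_ob Y) :=
  @Cmap k B (Kmap_ob X) (Kmap_ob Y) (fun i => lmap F (f i)) (Kmap_cmapP f).

Fact Kmap_cmap_linear (X Y : cplx A) : linear (@Kmap_cmap X Y).
Proof. by move=> a f g; apply: cmap_ext => i /=; rewrite lmap_linear. Qed.

Fact Kmap_cmap_null (X Y : cplx A) (f : cmap X Y) :
  is_nullhtpy f -> is_nullhtpy (Kmap_cmap f).
Proof.
case=> h hf; exists (fun i => lmap F (h i)) => i /=.
by rewrite hf lmapD !lmapM.
Qed.

Definition Kmap_map (X Y : cplx A) :
    khom X Y -> khom (Kmap_ob X) (Kmap_ob Y) :=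
  qmap (nullhtpy _ _) (@Kmap_cmap X Y).

Lemma Kmap_mapE (X Y : cplx A) (f : cmap X Y) :
  Kmap_map (kclass f) = kclass (Kmap_cmap f).
Proof.
apply: (@qmapE _ _ _ (nullhtpy X Y) (nullhtpy (Kmap_ob X) (Kmap_ob Y))
  (@Kmap_cmap X Y)); [exact: Kmap_cmap_linear|exact: Kmap_cmap_null].
Qed.

Fact Kmap_map1 (X : cplx A) :
  Kmap_map (kclass (cmap1 X)) = kclass (cmap1 (Kmap_ob X)).
Proof.
by rewrite Kmap_mapE; congr kclass; apply: cmap_ext => i /=; rewrite lmap1.
Qed.

Fact Kmap_mapM (X Y Z : cplx A) (g : khom Y Z) (f : khom X Y) :
  Kmap_map (kcomp g f) = kcomp (Kmap_map g) (Kmap_map f).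
Proof.
rewrite -[f]kreprK -[g]kreprK kcompE !Kmap_mapE kcompE.
by congr kclass; apply: cmap_ext => i /=; rewrite lmapM.
Qed.

Fact Kmap_map_linear (X Y : cplx A) : linear (@Kmap_map X Y).
Proof.
apply: (@qmap_linear _ _ _ (nullhtpy X Y) (nullhtpy (Kmap_ob X) (Kmap_ob Y))
  (@Kmap_cmap X Y)); [exact: Kmap_cmap_linear|exact: Kmap_cmap_null].
Qed.

Definition Kmap : linfunctor (Kminus A) (Kminus B) :=
  @LinFunctor k (Kminus A) (Kminus B)
    (@Functor (Kminus A) (Kminus B) Kmap_ob Kmap_map Kmap_map1 Kmap_mapM)
    Kmap_map_linear.
End Kmap.

Section Approximation.
Variables (k : comPzRingType) (A : lincat k) (C : A -> Prop).

(* [T_C = K^-(C)] and [T^b_C = K^b(C)] are regarded as full subcategories of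
   [T_A = K^-(A)]. *)
Definition inT (X : Kminus A) : Prop := forall i, C (cob X i).

Definition inTb (X : Kminus A) : Prop :=
  inT X /\ exists n : int, forall i, i < n -> is_zero (cob X i).

Definition Tcat : lincat k := fullsub inT.
Definition Tbcat : lincat k := fullsub inTb.

Fact inTbT X : inTb X -> inT X.
Proof. by case. Qed.

Fact inTb_shift X : inTb X -> inTb (shift A X).
Proof.
case=> hC [n hn]; split=> [i|]; first exact: hC.
by exists (n - 1) => i hi; apply: hn; rewrite -ltrBrDr.
Qed.

Record is_approximation (Y X : Kminus A) (f : lhom Y X) : Prop := {
  approx_in : inT Y;
  approx_qis : qis f;
  approx_hom : forall Z, inT Z -> forall g : lhom Z X,
    exists! h : lhom Z Y, f \oL h = g }.

Definition approximating : Prop :=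
  forall X : Kminus A, exists Y (f : lhom Y X), is_approximation f.

(* [p] is [pi_C] for some choice of approximations. *)
Definition is_approximation_functor (p : linfunctor (Kminus A) Tcat) : Prop :=
  exists e : forall X, lhom (proj1_sig (p X)) X,
    (forall X, is_approximation (e X)) /\
    forall X Y (f : lhom X Y),
      f \oL e X = e Y \oL (lmap p f : lhom (proj1_sig (p X)) (proj1_sig (p Y))).

Definition le0 (X : Kminus A) : Prop :=
  inT X /\ exists Y : Kminus A,
    [/\ inT Y, forall i, 0 < i -> is_zero (cob Y i) & isomorphic X Y].

Definition ge0 (X : Kminus A) : Prop :=
  inT X /\ forall Y, le0 Y -> forall f : lhom (shift A Y) X, f = 0.

Definition heart (X : Kminus A) : Prop := le0 X /\ ge0 X.

(* Identifies [T_C], a full subcategory of [K^-(A)], with the homotopy category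
   built from the category [C]. *)
Definition toK_ob (X : Tcat) : cplx (fullsub C) :=
  @Cplx k (fullsub C) (fun i => exist _ (cob (proj1_sig X) i) (proj2_sig X i))
    (cd (proj1_sig X)) (cdd (proj1_sig X)) (cbd (proj1_sig X)).

Definition toK_cmap (X Y : Tcat) (f : cmap (proj1_sig X) (proj1_sig Y)) :
    cmap (toK_ob X) (toK_ob Y) :=
  @Cmap k (fullsub C) (toK_ob X) (toK_ob Y) f (cfunP f).

Fact toK_cmap_linear (X Y : Tcat) : linear (@toK_cmap X Y).
Proof. by move=> a f g; apply: cmap_ext. Qed.

Fact toK_cmap_null (X Y : Tcat) (f : cmap (proj1_sig X) (proj1_sig Y)) :
  is_nullhtpy f -> is_nullhtpy (toK_cmap f).
Proof. by case=> h hf; exists h. Qed.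

Definition toK_map (X Y : Tcat) :
    khom (proj1_sig X) (proj1_sig Y) -> khom (toK_ob X) (toK_ob Y) :=
  qmap (nullhtpy _ _) (@toK_cmap X Y).

Lemma toK_mapE (X Y : Tcat) (f : cmap (proj1_sig X) (proj1_sig Y)) :
  toK_map (kclass f) = kclass (toK_cmap f).
Proof.
apply: (@qmapE _ _ _ (nullhtpy _ _) (nullhtpy (toK_ob X) (toK_ob Y))
  (@toK_cmap X Y)); [exact: toK_cmap_linear|exact: toK_cmap_null].
Qed.

Fact toK_map1 (X : Tcat) :
  toK_map (kclass (cmap1 (proj1_sig X))) = kclass (cmap1 (toK_ob X)).
Proof. by rewrite toK_mapE; congr kclass; apply: cmap_ext. Qed.

Fact toK_mapM (X Y Z : Tcat) (g : khom (proj1_sig Y) (proj1_sig Z))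
    (f : khom (proj1_sig X) (proj1_sig Y)) :
  @toK_map X Z (kcomp g f) = kcomp (@toK_map Y Z g) (@toK_map X Y f).
Proof.
rewrite -[f]kreprK -[g]kreprK kcompE !toK_mapE kcompE.
by congr kclass; apply: cmap_ext.
Qed.

Fact toK_map_linear (X Y : Tcat) : linear (@toK_map X Y).
Proof.
apply: (@qmap_linear _ _ _ (nullhtpy _ _) (nullhtpy (toK_ob X) (toK_ob Y))
  (@toK_cmap X Y)); [exact: toK_cmap_linear|exact: toK_cmap_null].
Qed.

Definition toK : linfunctor Tcat (Kminus (fullsub C)) :=
  @LinFunctor k Tcat (Kminus (fullsub C))
    (@Functor Tcat (Kminus (fullsub C)) toK_ob toK_map toK_map1 toK_mapM)
    toK_map_linear.

Definition Tb_shift : linfunctor Tbcat Tbcat :=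
  @corestr k (Kminus A) inTb Tbcat (lfcomp (shift A) (fincl inTb))
    (fun X => inTb_shift (proj2_sig X)).

Definition is_triangulated (F : functor Tbcat Tbcat) : Prop :=
  (forall (X Y : Tbcat) (f g : lhom X Y),
     fmap F (f + g : lhom X Y) =
     (fmap F f : lhom (F X) (F Y)) + fmap F g :> lhom (F X) (F Y)) /\
  exists theta : natiso (fcomp F Tb_shift) (fcomp Tb_shift F),
    forall (X Y Z : Tbcat) (u : lhom X Y) (v : lhom Y Z)
      (w : lhom Z (Tb_shift X)),
    @distinguished k A (proj1_sig X) (proj1_sig Y) (proj1_sig Z) u v w ->
    @distinguished k A (proj1_sig (F X)) (proj1_sig (F Y)) (proj1_sig (F Z))
      (fmap F u) (fmap F v) (comp (theta X) (fmap F w)).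
End Approximation.

Definition functorially_finite (k : comPzRingType) (A : lincat k)
    (C : A -> Prop) : Prop :=
  approximating C /\ @approximating k (op A) C.

(* [H_A] is taken closed under isomorphisms in [T_A]: otherwise objects of
   [Proj(H_C)], which need not be concentrated in degrees [-2..0], would only be
   isomorphic to objects of [Proj(H_A)]. *)
Definition heartA (k : comPzRingType) (A : lincat k) (X : Kminus A) : Prop :=
  exists Y : Kminus A,
    [/\ forall i : int, (i < - 2%:Z) || (0 < i) -> is_zero (cob Y i),
        forall i : int, i + 1 < 0 -> exact_at (cd Y i) (cd Y (i + 1)) &
        isomorphic X Y].

Section Serre.
Variables (k : comPzRingType) (E : lmodType k) (A : lincat k).

(* [D Hom(P, -) = Hom(-, S P)] as functors to [k]-modules, naturally in [P],
   where [D = Hom_k(-, E)]. *)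
Definition is_serre (S : linfunctor (fullsub (Proj (@heartA k A)))
    (fullsub (Inj (@heartA k A)))) : Prop :=
  exists phi : forall (P : fullsub (Proj (@heartA k A)))
      (X : fullsub (@heartA k A)),
      lhom (proj1_sig X) (proj1_sig (S P)) ->
      {linear lhom (proj1_sig P) (proj1_sig X) -> E},
  [/\ forall P X a g g' u,
        phi P X (a *: g + g') u = a *: phi P X g u + phi P X g' u,
      forall P X (l : {linear lhom (proj1_sig P) (proj1_sig X) -> E}),
        exists! g, forall u, phi P X g u = l u,
      forall P (X X' : fullsub (@heartA k A))
          (f : lhom (proj1_sig X) (proj1_sig X'))
          (g : lhom (proj1_sig X') (proj1_sig (S P)))
          (u : lhom (proj1_sig P) (proj1_sig X)),
        phi P X (g \oL f) u = phi P X' g (f \oL u) &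
      forall (P P' : fullsub (Proj (@heartA k A))) X
          (f : lhom (proj1_sig P) (proj1_sig P'))
          (g : lhom (proj1_sig X) (proj1_sig (S P)))
          (u : lhom (proj1_sig P') (proj1_sig X))
          (Sf := @lmap k _ _ S P P' f
               : lhom (proj1_sig (S P)) (proj1_sig (S P'))),
        phi P' X (Sf \oL g) u = phi P X g (u \oL f)].

Variables (C : A -> Prop) (piC : linfunctor (Kminus A) (Tcat C)).
Variable SA : linfunctor (fullsub (Proj (@heartA k A)))
                         (fullsub (Inj (@heartA k A))).

Definition heart_proj_sub : Prop :=
  forall X, Proj (heart C) X -> Proj (@heartA k A) X.

Definition preSC (hsub : heart_proj_sub) :
    linfunctor (fullsub (Proj (heart C))) (Tcat C) :=
  lfcomp piC (lfcomp (fincl (Inj (@heartA k A))) (lfcomp SA (subincl hsub))).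

(* [S_C : Proj(H_C) -> Inj(H_C)], once [pi_C \o S_A] is known to be defined on
   [Proj(H_C)] and to take injective values. *)
Definition SC (hsub : heart_proj_sub)
    (hinj : forall P, Inj (heart C) (proj1_sig (preSC hsub P))) :
    linfunctor (fullsub (Proj (heart C))) (fullsub (Inj (heart C))) :=
  @corestr k (Kminus A) (Inj (heart C)) (fullsub (Proj (heart C)))
    (lfcomp (fincl (inT C)) (preSC hsub)) hinj.
End Serre.

Fact Proj_sub (k : comPzRingType) (A : lincat k) (P : A -> Prop) X :
  Proj P X -> P X.
Proof. by case. Qed.

Fact Inj_sub (k : comPzRingType) (A : lincat k) (P : A -> Prop) X :
  Inj P X -> P X.
Proof. by case. Qed.

Section Extension.
Variables (k : comPzRingType) (A : lincat k) (O : A) (hO : is_zero O).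
Variable C : A -> Prop.
Hypothesis hstalk :
  forall M : fullsub C, Proj (heart C) (stalk hO (proj1_sig M)).

Definition stalkC : linfunctor (fullsub C) (fullsub (Proj (heart C))) :=
  @corestr k (Kminus A) (Proj (heart C)) (fullsub C)
    (lfcomp (stalk hO) (fincl C)) hstalk.

Definition T_to_KProj : linfunctor (Tcat C) (Kminus (fullsub (Proj (heart C)))) :=
  lfcomp (Kmap stalkC) (toK C).

Definition KProj_to_D :
    functor (Kminus (fullsub (Proj (heart C)))) (Dminus (fullsub (heart C))) :=
  fcomp (Dfun (fullsub (heart C))) (Kmap (subincl (@Proj_sub k _ (heart C)))).

Definition KInj_to_D :
    functor (Kminus (fullsub (Inj (heart C)))) (Dminus (fullsub (heart C))) :=
  fcomp (Dfun (fullsub (heart C))) (Kmap (subincl (@Inj_sub k _ (heart C)))).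

Variable S : linfunctor (fullsub (Proj (heart C))) (fullsub (Inj (heart C))).
Variable G1 :
  functor (Dminus (fullsub (heart C))) (Kminus (fullsub (Proj (heart C)))).
Variable G2 : functor (Kminus (fullsub (Proj (heart C)))) (Tcat C).

(* To be used with quasi-inverses [G1] of [KProj_to_D] and [G2] of
   [T_to_KProj]. *)
Definition extension : functor (Tcat C) (Tcat C) :=
  fcomp G2 (fcomp G1 (fcomp KInj_to_D (fcomp (Kmap S) T_to_KProj))).

(* The restriction to [T^b_C] is only determined up to isomorphism, since
   [T^b_C] is not closed under isomorphisms in [T_C]. *)
Definition restricts_to (F : functor (Tcat C) (Tcat C)) (Fb : functor (Tbcat C) (Tbcat C)) :
    Prop :=
  inhabited (natiso (fcomp (subincl (@inTbT k A C)) Fb)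
                    (fcomp F (subincl (@inTbT k A C)))).
End Extension.

Lemma linear_ext (R : pzRingType) (M N : lmodType R) (f g : {linear M -> N}) :
  f =1 g -> f = g.
Proof.
case: f => [f [[hf1] [hf2]]]; case: g => [g [[hg1] [hg2]]] /= fg.
have {}fg : f = g by apply/funext.
subst g; congr (GRing.Linear.Pack (GRing.Linear.Class _ _));
congr (_ _); apply: Prop_irrelevance.
Qed.

Section Modules.
Variable k : comPzRingType.

Definition ideal := submod (k^o : lmodType k).

Definition maximal_ideal (M : ideal) : Prop :=
  ~ M 1 /\ forall I : ideal, ~ I 1 -> (forall x, M x -> I x) ->
    forall x, I x -> M x.

Definition in_jacobson (x : k^o) : Prop := forall M : ideal, maximal_ideal M -> M x.

Fact jacobson0 : in_jacobson 0.
Proof. by move=> M _; apply: submod0. Qed.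

Fact jacobson_lin a x y : in_jacobson x -> in_jacobson y -> in_jacobson (a *: x + y).
Proof. by move=> hx hy M hM; apply: submod_lin; [apply: hx|apply: hy]. Qed.

Definition jacobson : ideal := Submod jacobson0 jacobson_lin.

Definition artinian : Prop :=
  forall I : nat -> ideal, (forall n x, I n.+1 x -> I n x) ->
    exists n, forall m, (n <= m)%N -> forall x, I n x -> I m x.

Definition injective_module (E : lmodType k) : Prop :=
  forall (M N : lmodType k) (m : {linear M -> N}) (f : {linear M -> E}),
    injective m -> exists g : {linear N -> E}, forall x, g (m x) = f x.

Definition injective_hull (V E : lmodType k) : Prop :=
  injective_module E /\
  exists j : {linear V -> E}, injective j /\
    forall N : submod E, (forall v, N (j v) -> v = 0) -> forall x, N x -> x = 0.
End Modules.

Definition finitely_generated (R : pzRingType) (M : lmodType R) : Prop :=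
  exists n (v : 'I_n -> M), forall x, exists a : 'I_n -> R,
    x = \sum_(i < n) a i *: v i.

(* [iota] identifies [k] with the center of [R]. *)
Record is_artin_algebra (k : comPzRingType) (R : pzRingType)
    (iota : {rmorphism k -> R}) : Prop := IsArtinAlgebra {
  center_inj : injective iota;
  centerP : forall z, (forall r, z * r = r * z) <-> exists a, z = iota a;
  center_artinian : artinian k;
  finite_over_center : exists n (v : 'I_n -> R), forall x,
    exists a : 'I_n -> k, x = \sum_(i < n) iota (a i) * v i }.

Section ModR.
Variables (k : comPzRingType) (R : pzRingType) (iota : {rmorphism k -> R}).
Hypothesis hR : is_artin_algebra iota.

Fact iotaC a r : iota a * r = r * iota a.
Proof. by move: r; apply/(centerP hR); exists a. Qed.

Definition modhom (M N : lmodType R) of is_artin_algebra iota : Type :=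
  {linear M -> N}.

Section Hom.
Variables M N : lmodType R.
Local Notation modhom := (modhom M N hR).
Implicit Types f g : {linear M -> N}.

HB.instance Definition _ := gen_eqMixin modhom.
HB.instance Definition _ := gen_choiceMixin modhom.

Definition mh0_fun (_ : M) : N := 0.
Fact mh0_linear : linear mh0_fun.
Proof. by move=> a x y; rewrite /mh0_fun scaler0 addr0. Qed.
HB.instance Definition _ := GRing.isLinear.Build R M N _ mh0_fun mh0_linear.
Definition mh0 : modhom := mh0_fun.

Definition mhD_fun f g (x : M) : N := f x + g x.
Fact mhD_linear f g : linear (mhD_fun f g).
Proof. by move=> a x y; rewrite /mhD_fun !linearP scalerDr addrACA. Qed.
HB.instance Definition _ f g :=
  GRing.isLinear.Build R M N _ (mhD_fun f g) (mhD_linear f g).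
Definition mhD (f g : modhom) : modhom := mhD_fun f g.

Definition mhN_fun f (x : M) : N := - f x.
Fact mhN_linear f : linear (mhN_fun f).
Proof. by move=> a x y; rewrite /mhN_fun linearP opprD scalerN. Qed.
HB.instance Definition _ f :=
  GRing.isLinear.Build R M N _ (mhN_fun f) (mhN_linear f).
Definition mhN (f : modhom) : modhom := mhN_fun f.

Definition mhZ_fun (_ : is_artin_algebra iota) (b : k) f (x : M) : N :=
  iota b *: f x.
Fact mhZ_linear b f : linear (mhZ_fun hR b f).
Proof.
by move=> a x y; rewrite /mhZ_fun linearP scalerDr !scalerA iotaC.
Qed.
HB.instance Definition _ b f :=
  GRing.isLinear.Build R M N _ (mhZ_fun hR b f) (mhZ_linear b f).
Definition mhZ b (f : modhom) : modhom := mhZ_fun hR b f.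

Fact mhDA : associative mhD.
Proof. by move=> f g h; apply: linear_ext => x; apply: addrA. Qed.
Fact mhDC : commutative mhD.
Proof. by move=> f g; apply: linear_ext => x; apply: addrC. Qed.
Fact mhD0 : left_id mh0 mhD.
Proof. by move=> f; apply: linear_ext => x; apply: add0r. Qed.
Fact mhDN : left_inverse mh0 mhN mhD.
Proof. by move=> f; apply: linear_ext => x; apply: addNr. Qed.

HB.instance Definition _ := GRing.isZmodule.Build modhom mhDA mhDC mhD0 mhDN.

Fact mhZA a b f : mhZ a (mhZ b f) = mhZ (a * b) f.
Proof.
by apply: linear_ext => x; rewrite /= /mhZ_fun /= /mhZ_fun scalerA rmorphM.
Qed.
Fact mhZ1 : left_id 1 mhZ.
Proof.
by move=> f; apply: linear_ext => x; rewrite /= /mhZ_fun rmorph1 scale1r.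
Qed.
Fact mhZDr : right_distributive mhZ +%R.
Proof. by move=> a f g; apply: linear_ext => x; apply: scalerDr. Qed.
Fact mhZDl f : {morph mhZ^~ f : a b / a + b}.
Proof.
by move=> a b; apply: linear_ext => x; rewrite /= /mhZ_fun rmorphD scalerDl.
Qed.

HB.instance Definition _ :=
  GRing.Zmodule_isLmodule.Build k modhom mhZA mhZ1 mhZDr mhZDl.
End Hom.

Definition mh1 (M : lmodType R) : modhom M M hR := idfun.
Definition mhM (M N L : lmodType R) (g : {linear N -> L}) (f : {linear M -> N})
  : modhom M L hR := g \o f.

Definition modR_ob := {M : lmodType R | finitely_generated M}.
Definition modR_hom (M N : modR_ob) : lmodType k :=
  modhom (proj1_sig M) (proj1_sig N) hR.

Fact mh1m (M N : modR_ob) (f : modR_hom M N) : mhM (mh1 _) f = f.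
Proof. exact: linear_ext. Qed.
Fact mhm1 (M N : modR_ob) (f : modR_hom M N) : mhM f (mh1 _) = f.
Proof. exact: linear_ext. Qed.
Fact mhMA (M N L Q : modR_ob) (h : modR_hom L Q) (g : modR_hom N L)
  (f : modR_hom M N) : mhM h (mhM g f) = mhM (mhM h g) f.
Proof. exact: linear_ext. Qed.
Fact mhMPl (M N L : modR_ob) (f : modR_hom M N) a (g g' : modR_hom N L) :
  mhM (a *: g + g') f = a *: (mhM g f : modR_hom M L) + mhM g' f.
Proof. exact: linear_ext. Qed.
Fact mhMPr (M N L : modR_ob) (g : modR_hom N L) a (f f' : modR_hom M N) :
  mhM g (a *: f + f') = a *: (mhM g f : modR_hom M L) + mhM g f'.
Proof. by apply: linear_ext => x; apply: linearP. Qed.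

Definition modR : lincat k := @LinCat k modR_ob modR_hom
  (fun M => mh1 (proj1_sig M)) (fun M N L g f => mhM g f)
  mh1m mhm1 mhMA mhMPl mhMPr.

Fact mod0_fg : finitely_generated ('rV[R]_0 : lmodType R).
Proof.
by exists 0%N, (fun _ => 0) => x; exists (fun _ => 0); rewrite big_ord0 thinmx0.
Qed.

Definition mod0 : modR := exist _ ('rV[R]_0 : lmodType R) mod0_fg.

Fact mod0_zero : is_zero mod0.
Proof. by apply: linear_ext => x; rewrite [LHS]thinmx0 [RHS]thinmx0. Qed.
End ModR.

(* Main.v *)
Require Import Defs.
From HB Require Import structures.
From mathcomp Require Import all_boot all_order all_algebra ssrAC.
From mathcomp Require Import boolp zify.
Import Defs.

Set Implicit Arguments.
Unset Strict Implicit.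
Unset Printing Implicit Defensive.

Import Order.TTheory GRing.Theory Num.Theory.
Local Open Scope ring_scope.

(* Let D = Hom_k(-, E) and let H be the heart of T_C: its objects are the
   complexes with terms in C on which Hom(N, -), for N in C, is exact outside
   degree 0.  Serre duality on the heart of T_A is carried by linear forms
   Hom(P, S_A P) -> E, and composing with the approximation S_C P -> S_A P gives
   linear forms eta_P on Hom(P, S_C P) such that (g, u) |-> eta_P (g u) identifies
   Hom(X, S_C P) with D Hom(P, X) for all X in T_C^{<= 0}.  (One first replaces X
   by the complex [ker d -> X^{-1} -> X^0], which lies in the heart of T_A.)  All
   properties of S_C follow from these pairings: S_C P is injective because
   Hom(P, -) is exact, S_C is fully faithful because the k-modules Hom(P, P') have
   finite length and hence are reflexive, and every X in H embeds in some S_C P_M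
   by Auslander-Reiten duality in mod(R) followed by a left C-approximation.  So
   every injective of H is a direct summand of some S_C P_M.

   For X in T_C write TK X and KS X for the complexes in H obtained by applying
   P_(-) and S_C P_(-) to the terms of X.  The extension of S_C sends X to the Y
   with a quasi-isomorphism TK Y -> KS X; when A has finite C-dimension and X is
   bounded, so is Y up to isomorphism.  Bounded complexes KS X are K-injective
   in H, which gives full faithfulness.  The Y so obtained from bounded X form a
   triangulated subcategory; it contains P_M for M in C, because the coresolution
   of P_M by objects S_C P_N stops, by the vanishing of Ext^d(-, P_M) for large d,
   and hence contains T^b_C. *)

(** The heart of [T_C] is never given the structure of an abelian category. What such a structure
    would supply comes from two sources: exactness of the complexes [Hom(N, X)] for [N] in [C]
    ([qex]), and the perfect pairings, which turn extension problems for maps into extension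
    problems for linear forms with values in the injective module [E]. Quasi-isomorphisms of
    complexes over the heart are used in the form [bijH projK]: complexes of projectives see them as
    bijections. Finite length enters as the descending chain condition, through the induction
    [dcc_ind] on submodules.

    Two conventions come from the indexing by [int]. Homotopies and exactness are stated in degree
    [i + 1], so that for [qex] degree [0] is the index [-1]. And [i - 1 + 1] is equal to [i] only
    propositionally, so the shift is inverted up to isomorphism and not by a functor. *)

Lemma pair_choice (T U : Type) (P : T -> Prop) (R : T -> U -> Prop) (u0 : T -> U) :
  (forall t, P t -> exists u, R t u) -> exists f : T -> U, forall t, P t -> R t (f t).
Proof.
move=> h; exists (fun t => if pselect (P t) is left p then projT1 (cid (h t p)) else u0 t).
by move=> t pt; case: pselect => [p|//]; case: cid.
Qed.

(** * Recursion over the integers *)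

Section IntRecursion.
Variables (T : int -> Type) (n : int) (t0 : forall i, T i).
Variable Q : forall i, T i -> Prop.

(** The value at [i < n] results from [n - i] steps starting at the given values; [Q] is the
    invariant under which the next step can be taken. *)
Lemma int_descend (R : forall i, T (i + 1) -> T i -> Prop) :
  (forall i : int, n <= i -> Q (t0 i) /\ R i (t0 (i + 1)) (t0 i)) ->
  (forall i : int, i < n -> forall t', Q t' -> exists2 t, Q t & R i t' t) ->
  exists2 t, (forall i : int, n <= i -> t i = t0 i) &
             forall i, Q (t i) /\ R i (t (i + 1)) (t i).
Proof.
move=> hge hlt.
have [nxt nxtP] : exists nxt : forall i, T (i + 1) -> T i,
    forall i (t' : T (i + 1)), i < n -> Q t' -> Q (nxt i t') /\ R i t' (nxt i t').
  have h i : exists f : T (i + 1) -> T i,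
      forall t', i < n /\ Q t' -> Q (f t') /\ R i t' (f t').
    apply: (@pair_choice _ _ (fun t' => i < n /\ Q t')
      (fun t' t => Q t /\ R i t' t) (fun=> t0 i)) => t' [lin qt'].
    by have [t qt rt] := hlt i lin t' qt'; exists t.
  exists (fun i => projT1 (cid (h i))) => i t' lin qt'.
  by case: (cid (h i)) => f /= hf; apply: hf.
(* [m] is fuel, and the value at [i] uses [|n - i|]. The test [n <= i] covers the integers above
   [n], where this number is positive too. *)
pose g := fix g (m : nat) : forall i, T i :=
  if m is m'.+1 then fun i => if n <= i then t0 i else nxt i (g m' (i + 1)) else t0.
pose t i := g `|(n - i)%R|%N i.
have tge i : n <= i -> t i = t0 i.
  by move=> le_ni; rewrite /t; case: `|_|%N => //= m; rewrite le_ni.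
have tlt i : i < n -> t i = nxt i (t (i + 1)).
  move=> lt_in; rewrite /t.
  have -> : `|(n - i)%R|%N = `|(n - (i + 1))%R|%N.+1 by lia.
  by rewrite /= leNgt lt_in.
have tQ m i : (n - i <= m%:Z)%R -> Q (t i).
  elim: m i => [|m IHm] i him.
    have lni : n <= i by lia.
    by rewrite (tge _ lni); case: (hge i lni).
  case: (leP n i) => [lni|lin]; first by rewrite (tge _ lni); case: (hge i lni).
  rewrite (tlt _ lin); apply: (proj1 (nxtP _ _ lin _)); apply: IHm; lia.
have {}tQ i : Q (t i) by apply: (tQ `|(n - i)%R|%N); lia.
exists t => // i; split=> //.
case: (leP n i) => [lni|lin]; last by rewrite (tlt _ lin); apply: (proj2 (nxtP _ _ lin _)).
by rewrite (tge _ lni) tge; [case: (hge i lni)|lia].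
Qed.

Lemma int_ascend (R : forall i, T i -> T (i + 1) -> Prop) :
  (forall i : int, i <= n -> Q (t0 i)) ->
  (forall i : int, i < n -> R i (t0 i) (t0 (i + 1))) ->
  (forall i : int, n <= i -> forall t, Q t -> exists2 t', Q t' & R i t t') ->
  exists2 t, (forall i : int, i <= n -> t i = t0 i) &
             forall i, Q (t i) /\ R i (t i) (t (i + 1)).
Proof.
move=> hle hlt hge.
have [nxt nxtP] : exists nxt : forall i, T i -> T (i + 1),
    forall i (t : T i), n <= i -> Q t -> Q (nxt i t) /\ R i t (nxt i t).
  have h i : exists f : T i -> T (i + 1),
      forall t, n <= i /\ Q t -> Q (f t) /\ R i t (f t).
    apply: (@pair_choice _ _ (fun t => n <= i /\ Q t)
      (fun t t' => Q t' /\ R i t t') (fun=> t0 (i + 1))) => t [lin qt].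
    by have [t' qt' rt] := hge i lin t qt; exists t'.
  exists (fun i => projT1 (cid (h i))) => i t lin qt.
  by case: (cid (h i)) => f /= hf; apply: hf.
(* Going up, the step that defines the value at [i] lands in [T (i - 1 + 1)], whence the cast. *)
pose g := fix g (m : nat) : forall i, T i :=
  if m is m'.+1 then fun i => if i <= n then t0 i else
    ecast j (T j) (subrK 1 i) (nxt (i - 1) (g m' (i - 1))) else t0.
pose t i := g `|(i - n)%R|%N i.
have tle i : i <= n -> t i = t0 i.
  by move=> le_ni; rewrite /t; case: `|_|%N => //= m; rewrite le_ni.
have tgt i : n <= i -> t (i + 1) = nxt i (t i).
  move=> le_ni; rewrite /t.
  have -> : `|(i + 1 - n)%R|%N = `|(i - n)%R|%N.+1 by lia.
  have nle : (i + 1 <= n) = false by lia.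
  rewrite /= nle; move: (subrK _ _).
  rewrite (_ : i + 1 - 1 = i); last by lia.
  by move=> e; rewrite (eq_axiomK e).
have tQ m i : (i - n <= m%:Z)%R -> Q (t i).
  elim: m i => [|m IHm] i him; first by rewrite tle; [apply: hle; lia|lia].
  case: (leP i n) => [lni|lin]; first by rewrite (tle _ lni); apply: hle.
  have [j ej] : exists j, i = j + 1 by exists (i - 1); lia.
  have lnj : n <= j by lia.
  rewrite {}ej in him lin *.
  by rewrite (tgt _ lnj); apply: (proj1 (nxtP _ _ lnj _)); apply: IHm; lia.
have {}tQ i : Q (t i) by apply: (tQ `|(i - n)%R|%N); lia.
exists t => // i; split=> //.
case: (leP n i) => [lni|lin]; first by rewrite (tgt _ lni); apply: (proj2 (nxtP _ _ lni _)).
by rewrite !tle; [exact: hlt|lia|lia].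
Qed.
End IntRecursion.

Lemma addKB (V : zmodType) (a b : V) : a + b - a = b.
Proof. by rewrite addrC addKr. Qed.

Lemma subKD (V : zmodType) (a b : V) : a + (b - a) = b.
Proof. by rewrite addrC subrK. Qed.

Lemma addNKD (V : zmodType) (a b : V) : - a + (b + a) = b.
Proof. by rewrite addrC addrK. Qed.

Lemma addNDK (V : zmodType) (a b : V) : - a + b + a = b.
Proof. by rewrite addrAC addNr add0r. Qed.

Lemma subNNDK (V : zmodType) (a b c : V) : c - (- a + (- b + c)) = a + b.
Proof. by rewrite !opprD !opprK [c + _]addrC addrA subrK. Qed.

Lemma addKB5 (V : zmodType) (p q r t : V) : r + t + p + q - t = p + (q + r).
Proof. by rewrite [LHS](ACl (3 * (4 * 1) * (2 * 5)))%AC /= subrr addr0. Qed.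

Lemma rotate_sum (V : zmodType) (a b c d e : V) :
  c + (d + b) - (d - e) = - a + b + (c + (e + a)).
Proof.
rewrite opprB !addrA [LHS](ACl ((2 * 5) * (1 * (3 * 4))))%AC.
by rewrite [RHS](ACl ((1 * 5) * (3 * (2 * 4))))%AC /= subrr addNr.
Qed.

Lemma subKB (V : zmodType) (a b : V) : a - (a - b) = b.
Proof. exact: subKr. Qed.

Section LinBasics.
Variables (k : comPzRingType) (A : lincat k).
Implicit Types X Y Z : A.

Lemma from_zero X Y (f : lhom X Y) : is_zero X -> f = 0.
Proof. by move=> hX; rewrite -[f]lcompm1 hX lcompm0. Qed.

Lemma to_zero X Y (f : lhom X Y) : is_zero Y -> f = 0.
Proof. by move=> hY; rewrite -[f]lcomp1m hY lcomp0m. Qed.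

Lemma lcompBl X Y Z (f : lhom X Y) (g g' : lhom Y Z) :
  (g - g') \oL f = g \oL f - g' \oL f.
Proof. by rewrite lcompDl lcompNl. Qed.

Lemma lcompBr X Y Z (g : lhom Y Z) (f f' : lhom X Y) :
  g \oL (f - f') = g \oL f - g \oL f'.
Proof. by rewrite lcompDr lcompNr. Qed.

Lemma lcompK X Y Z W (a : lhom Y Z) (b : lhom X Y) c (x : lhom Z W) :
  a \oL b = c -> x \oL a \oL b = x \oL c.
Proof. by move=> <-; rewrite lcompA. Qed.

(** The identity, read as a morphism along an equality of objects; it compares complexes whose terms
    agree only propositionally. *)
Definition eqm X Y (e : X = Y) : lhom X Y := eq_rect X (fun Z => lhom X Z) (lid X) Y e.

Section Biprod.
Variables (Z X Y : A) (iX : lhom X Z) (iY : lhom Y Z) (pX : lhom Z X) (pY : lhom Z Y).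
Hypothesis b : is_biprod iX iY pX pY.

Lemma biprod_in T (g h : lhom T Z) :
  pX \oL g = pX \oL h -> pY \oL g = pY \oL h -> g = h.
Proof.
move=> hX hY; rewrite -[g]lcomp1m -[h]lcomp1m -(biprod1 b) !lcompDl.
by rewrite -!lcompA hX hY.
Qed.

Lemma biprod_out T (g h : lhom Z T) :
  g \oL iX = h \oL iX -> g \oL iY = h \oL iY -> g = h.
Proof.
move=> hX hY; rewrite -[g]lcompm1 -[h]lcompm1 -(biprod1 b) !lcompDr.
by rewrite !lcompA hX hY.
Qed.
End Biprod.

Definition has_biprods := forall X Y, exists Z iX iY pX pY, @is_biprod k A Z X Y iX iY pX pY.

End LinBasics.

Definition lcompE := (lcompDl, lcompDr, lcompNl, lcompNr, lcompBl, lcompBr, lcomp0m,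
  lcompm0, lcomp1m, lcompm1, lcompA).

Notation liso f := (@is_iso (cat_of _) _ _ f).
Notation lisomorphic X Y := (@isomorphic (cat_of _) X Y).

Lemma lisoP (k : comPzRingType) (A : lincat k) (X Y : A) (f : lhom X Y) :
  liso f -> exists g : lhom Y X, g \oL f = lid X /\ f \oL g = lid Y.
Proof. by []. Qed.

(** * Exactness of Hom complexes; homotopies and maps built degree by degree *)

Section Exactness.
Variables (k : comPzRingType) (A : lincat k).
Implicit Types X Y Z P : cplx A.

(* Exactness of [Hom(N, X)] in degree [i + 1], for all [N] in [Q]. *)
Definition qex (Q : A -> Prop) X (i : int) : Prop :=
  forall N, Q N -> forall u : lhom N (X (i + 1)), cd X (i + 1) \oL u = 0 ->
    exists v, cd X i \oL v = u.

Lemma kclass0 X Y (f : cmap X Y) : kclass f = 0 <-> is_nullhtpy f.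
Proof. by rewrite -[f in is_nullhtpy f]subr0; exact: kclassP. Qed.

Lemma khomE X Y (f : khom X Y) : exists g : cmap X Y, f = kclass g.
Proof. by exists (krepr f); rewrite kreprK. Qed.

Lemma kclassD X Y (f g : cmap X Y) : kclass (f + g) = kclass f + kclass g.
Proof. exact: (raddfD (qpi (nullhtpy X Y))). Qed.

(** A homotopy given from degree [n] on is continued downwards. The invariant [(f - d t) d = 0]
    makes the defect in the next degree a cycle, to which the lifting hypothesis applies. *)
Lemma null_lift P X (f : cmap P X) n (h0 : forall i, lhom (P (i + 1)) (X i)) :
  (forall i, n <= i ->
    f (i + 1) = cd X i \oL h0 i + h0 (i + 1) \oL cd P (i + 1)) ->
  (forall i, i < n -> forall u : lhom (P (i + 1)) (X (i + 1)),
    cd X (i + 1) \oL u = 0 -> exists v, cd X i \oL v = u) ->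
  is_nullhtpy f.
Proof.
move=> hge hlt.
have [i lin|i lin t' qt'|t _ ht] := @int_descend (fun i => lhom (P (i + 1)) (X i)) n h0
  (fun i t => (f (i + 1) - cd X i \oL t) \oL cd P i = 0)
  (fun i t' t => f (i + 1) = cd X i \oL t + t' \oL cd P (i + 1)).
- by split; [rewrite (hge _ lin) addKB -lcompA cdd lcompm0|exact: hge].
- have [|v hv] := hlt i lin (f (i + 1) - t' \oL cd P (i + 1)).
    by rewrite -[RHS]qt' !lcompE cfunP.
  exists v; last by rewrite hv subrK.
  by rewrite hv subKB -lcompA cdd lcompm0.
by exists t => i; case: (ht i).
Qed.

Lemma null_lift0 P X (f : cmap P X) n :
  (forall i, n < i -> f i = 0) ->
  (forall i, i < n -> forall u : lhom (P (i + 1)) (X (i + 1)),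
    cd X (i + 1) \oL u = 0 -> exists v, cd X i \oL v = u) ->
  is_nullhtpy f.
Proof.
move=> hf; apply: (@null_lift _ _ _ _ (fun=> 0)) => i lin.
by rewrite lcomp0m lcompm0 addr0; apply: hf; lia.
Qed.

Lemma null_qex (Q : A -> Prop) P X (f : cmap P X) :
  (forall i, Q (P i)) -> (forall i, qex Q X i) -> is_nullhtpy f.
Proof.
move=> hP hX; have [n hn] := cbd P.
apply: (@null_lift0 _ _ _ n) => [i lin|i _ u]; first by apply: from_zero (hn _ lin).
exact: hX.
Qed.

(** Dual to [null_lift]: the homotopy starts as [0] in low degrees and is continued upwards, each
    component being an extension along a differential of [X]. *)
Lemma null_ext X J (f : cmap X J) n :
  (forall i, i <= n -> f i = 0) ->
  (forall i, n <= i -> forall u : lhom (X (i + 1)) (J (i + 1)),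
    u \oL cd X i = 0 -> exists v, v \oL cd X (i + 1) = u) ->
  is_nullhtpy f.
Proof.
move=> hle hge.
have [i lin|i lin|i lin t qt|t _ ht] := @int_ascend (fun i => lhom (X (i + 1)) (J i)) n
  (fun=> 0) (fun i t => (f (i + 1) - cd J i \oL t) \oL cd X i = 0)
  (fun i t t' => f (i + 1) = cd J i \oL t + t' \oL cd X (i + 1)).
- by rewrite lcompm0 subr0 -cfunP hle // lcompm0.
- by rewrite hle ?lcompm0 ?lcomp0m ?addr0 //; lia.
- have [t' ht'] := hge i lin (f (i + 1) - cd J i \oL t) qt.
  exists t'; last by rewrite ht' subKD.
  by rewrite lcompBl -lcompA ht' !lcompE cfunP cdd lcomp0m subr0 subrr.
by exists t => i; case: (ht i).
Qed.

(** The comparison theorem. The invariant, that [d t] factors through the differential of [P], makes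
    the next composite a cycle. *)
Lemma ext_map P X n (g : forall i, lhom (P i) (X i)) :
  (forall i, n <= i -> cd X i \oL g i = g (i + 1) \oL cd P i) ->
  (forall i, i < n -> forall u : lhom (P i) (X (i + 1)), cd X (i + 1) \oL u = 0 ->
    exists v, cd X i \oL v = u) ->
  exists f : cmap P X, forall i, n <= i -> f i = g i.
Proof.
move=> hge hlt.
have [i lin|i lin t' [s hs]|t ht1 ht2] := @int_descend (fun i => lhom (P i) (X i)) n g
  (fun i t => exists s : lhom (P (i + 1)) (X (i + 1)), cd X i \oL t = s \oL cd P i)
  (fun i t' t => cd X i \oL t = t' \oL cd P i).
- by split; [exists (g (i + 1))|]; apply: hge.
- have [|v hv] := hlt i lin (t' \oL cd P i).
    by rewrite lcompA hs -lcompA cdd lcompm0.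
  by exists v => //; exists t'.
by exists (@Cmap k A P X t (fun i => proj2 (ht2 i))).
Qed.

(** [Y] is a homotopy retract of [X]: a cycle of [Y] becomes a boundary in [X], and the homotopy
    corrects the difference after the return to [Y]. *)
Lemma qex_iso Q X Y (f : cmap X Y) (g : cmap Y X) i :
  is_nullhtpy (cmapM f g - cmap1 Y) -> qex Q X i -> qex Q Y i.
Proof.
case=> h hfg hX N hN u hu.
have [|v hv] := hX N hN (g (i + 1) \oL u).
  by rewrite lcompA cfunP -lcompA hu lcompm0.
exists (f i \oL v - h i \oL u).
have := congr1 (fun x => x \oL u) (hfg i) => /=.
rewrite !lcompE -[h (i + 1) \oL _ \oL u]lcompA hu lcompm0 addr0 => <-.
by rewrite cfunP -[_ \oL cd X i \oL v]lcompA hv !lcompE subKB.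
Qed.

Lemma kisoP X Y (a : lhom (X : Kminus A) Y) :
  liso a -> exists (f : cmap X Y) (g : cmap Y X),
   [/\ a = kclass f, is_nullhtpy (cmapM f g - cmap1 Y) & is_nullhtpy (cmapM g f - cmap1 X)].
Proof.
case=> b [ba ab]; have [f def_a] := khomE a; have [g def_b] := khomE b.
exists f, g; split=> //; apply/kclassP; first by rewrite -kcompE -def_a -def_b; exact: ab.
by rewrite -kcompE -def_a -def_b; exact: ba.
Qed.

Lemma qex_isomorphic Q X Y i :
  lisomorphic (X : Kminus A) (Y : Kminus A) -> qex Q X i <-> qex Q Y i.
Proof.
by case=> a /kisoP[f [g [_ fg gf]]]; split; apply: qex_iso; [exact: fg|exact: gf].
Qed.

Lemma qex_zero Q X i : is_zero (X (i + 1)) -> qex Q X i.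
Proof. by move=> z N _ u _; exists 0; rewrite lcompm0 [u]to_zero. Qed.

End Exactness.

Section Iso.
Variables (A : Defs.cat).

Lemma is_iso1 (X : A) : is_iso (idm X).
Proof. by exists (idm X); rewrite comp1m. Qed.

Lemma is_isoM (X Y Z : A) (f : hom X Y) (g : hom Y Z) :
  is_iso f -> is_iso g -> is_iso (comp g f).
Proof.
move=> [f' [ff f'f]] [g' [gg g'g]]; exists (comp f' g'); split.
  by rewrite -compA (compA g') gg comp1m.
by rewrite -compA (compA f) f'f comp1m.
Qed.

Lemma isomorphic_refl (X : A) : isomorphic X X.
Proof. by exists (idm X); apply: is_iso1. Qed.

Lemma isomorphic_sym (X Y : A) : isomorphic X Y -> isomorphic Y X.
Proof. by case=> f [g [gf fg]]; exists g, f. Qed.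

Lemma isomorphic_trans (X Y Z : A) : isomorphic X Y -> isomorphic Y Z -> isomorphic X Z.
Proof. by case=> f hf [g hg]; exists (comp g f); apply: is_isoM. Qed.
End Iso.

Lemma fmap_iso (A B : Defs.cat) (F : functor A B) (X Y : A) (f : hom X Y) :
  is_iso f -> is_iso (fmap F f).
Proof.
by case=> g [gf fg]; exists (fmap F g); rewrite -!fmapM gf fg !fmap1.
Qed.

Lemma fob_isomorphic (A B : Defs.cat) (F : functor A B) (X Y : A) :
  isomorphic X Y -> isomorphic (F X) (F Y).
Proof. by case=> f hf; exists (fmap F f); apply: fmap_iso. Qed.

Lemma int_fun (T : int -> Type) (G : forall i, T (i + 1)) :
  exists f : forall j, T j, forall i, f (i + 1) = G i.
Proof.
exists (fun j => ecast j (T j) (subrK 1 j) (G (j - 1))) => i.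
move: (subrK _ _); rewrite (_ : i + 1 - 1 = i); last by lia.
by move=> e; rewrite (eq_axiomK e).
Qed.

Lemma int_pred (j : int) : exists i : int, j = i + 1.
Proof. by exists (j - 1); rewrite subrK. Qed.

(** * Homotopy category and cones *)

Section KMorphisms.
Variables (k : comPzRingType) (A : lincat k).
Implicit Types X Y Z : Kminus A.

(** [kclass] with its value typed as a morphism of [Kminus A], so that composites and images under
    functors elaborate. *)
Definition kc X Y (f : cmap X Y) : lhom X Y := kclass f.

Lemma kcP X Y (a : lhom X Y) : exists f : cmap X Y, a = kc f.
Proof. exact: khomE. Qed.

Lemma kcM X Y Z (g : cmap Y Z) (f : cmap X Y) : kc g \oL kc f = kc (cmapM g f).
Proof. exact: kcompE. Qed.

Lemma kc_eq X Y (f g : cmap X Y) : kc f = kc g <-> is_nullhtpy (f - g).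
Proof. exact: kclassP. Qed.

Lemma kc_eq0 X Y (f : cmap X Y) : kc f = 0 <-> is_nullhtpy f.
Proof. exact: kclass0. Qed.

Lemma kcD X Y (f g : cmap X Y) : kc (f + g) = kc f + kc g.
Proof. exact: kclassD. Qed.

Lemma kc1 X : lid X = kc (cmap1 X).
Proof. by []. Qed.

Lemma kc_shift X Y (f : cmap X Y) : lmap (shift A) (kc f) = kc (cmap_shift f).
Proof. exact: kshiftE. Qed.

Lemma strict_iso X Y (f : cmap X Y) (g : cmap Y X) :
  (forall i, f i \oL g i = lid _) -> (forall i, g i \oL f i = lid _) -> liso (kc f).
Proof.
move=> fg gf; exists (kc g).
by split; rewrite -[LHS]/(_ \oL _) kcM -[RHS]kc1; congr kc; apply: cmap_ext => i /=.
Qed.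
End KMorphisms.

Section Shift.
Variables (k : comPzRingType) (A : lincat k).
Implicit Types X Y Z : Kminus A.

Lemma null_shift X Y (f : cmap X Y) : is_nullhtpy (cmap_shift f) <-> is_nullhtpy f.
Proof.
split; last exact: cmap_shift_null.
case=> h hf; have [h' hh'] := @int_fun (fun j => lhom (X (j + 1)) (Y j)) (fun i => - h i).
exists h' => j; have [i ->] := int_pred j; rewrite !hh'.
by rewrite -[LHS]/(cmap_shift f (i + 1)) hf /= !lcompE.
Qed.

Lemma cunshift X Y (G : forall i, lhom (X (i + 1)) (Y (i + 1))) :
  (forall i, cd Y (i + 1) \oL G i = G (i + 1) \oL cd X (i + 1)) ->
  exists f : cmap X Y, forall i, f (i + 1) = G i.
Proof.
move=> hG; have [f fG] := @int_fun (fun j => lhom (X j) (Y j)) G.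
have fP i : cd Y i \oL f i = f (i + 1) \oL cd X i.
  by have [j ->] := int_pred i; rewrite !fG.
by exists (@Cmap k A X Y f fP).
Qed.

Lemma shift_full X Y (g : cmap (shift A X) (shift A Y)) :
  exists f : cmap X Y, cmap_shift f = g.
Proof.
have [i|f fg] := @cunshift X Y (fun i => g i).
  by have := cfunP g i; rewrite /= !lcompE => /oppr_inj.
by exists f; apply: cmap_ext => i /=; rewrite fg.
Qed.

Lemma kshift_inj X Y (a b : lhom X Y) : lmap (shift A) a = lmap (shift A) b -> a = b.
Proof.
have [f ->] := kcP a; have [g ->] := kcP b; rewrite !kc_shift => /kc_eq h.
by apply/kc_eq/null_shift.
Qed.

Lemma kshift_full X Y (b : lhom (shift A X) (shift A Y)) :
  exists a : lhom X Y, lmap (shift A) a = b.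
Proof.
have [g ->] := kcP b; have [f fg] := shift_full g.
by exists (kc f); rewrite kc_shift fg.
Qed.

Lemma eqmK (X Y : A) (e : X = Y) : eqm (esym e) \oL eqm e = lid X.
Proof. by case: _ / e; rewrite /eqm /= lcomp1m. Qed.

Lemma eqmKV (X Y : A) (e : X = Y) : eqm e \oL eqm (esym e) = lid Y.
Proof. by case: _ / e; rewrite /eqm /= lcomp1m. Qed.

(** The terms of the desuspension are recorded as equalities of objects, because membership in [C]
    or in a class of test objects has to be transferred along them. *)
Lemma unshift_exists (W : Kminus A) : exists W' : Kminus A,
  (forall i, W' (i + 1) = W i :> A) /\ lisomorphic (shift A W') W.
Proof.
have [ob e] := @int_fun (fun=> A) W.
have [d dE] := @int_fun (fun j => lhom (ob j) (ob (j + 1)))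
  (fun i => - (eqm (esym (e (i + 1))) \oL cd W i \oL eqm (e i))).
have dd i : d (i + 1) \oL d i = 0.
  have [j ->] := int_pred i; rewrite !dE !lcompE.
  by rewrite (lcompK _ (eqmKV _)) lcompm1 opprK (lcompK _ (cdd W j)) !lcompE.
have bd : exists n : int, forall i, n < i -> is_zero (ob i).
  have [n hn] := cbd W; exists (n + 1) => i; have [j ->] := int_pred i => hj.
  by rewrite e; apply: hn; lia.
pose W' : Kminus A := @Cplx k A ob d dd bd.
have fP i : cd W i \oL eqm (e i) = eqm (e (i + 1)) \oL cd (cshift W') i.
  by rewrite /= dE opprK !lcompE eqmKV lcomp1m.
have gP i : cd (cshift W') i \oL eqm (esym (e i)) = eqm (esym (e (i + 1))) \oL cd W i.
  by rewrite /= dE opprK (lcompK _ (eqmKV _)) lcompm1.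
exists W'; split=> //.
exists (kc (@Cmap k A (shift A W') W (fun i => eqm (e i)) fP)).
apply: (strict_iso (g := @Cmap k A W (shift A W') (fun i => eqm (esym (e i))) gP)) => i /=.
  exact: eqmKV.
exact: eqmK.
Qed.
End Shift.

(** * Mapping cones and their long exact sequences *)

Section Cone.
Variables (k : comPzRingType) (A : lincat k).

Section Fixed.
Variables (X Y Z : Kminus A) (f : cmap X Y) (v : cmap Y Z) (w : cmap Z (shift A X)).
Variables (iX : forall i, lhom (X (i + 1)) (Z i)) (pY : forall i, lhom (Z i) (Y i)).
Hypothesis bi : forall i, is_biprod (iX i) (v i) (w i) (pY i).
Hypothesis dZ : forall i, cd Z i =
      - (iX (i + 1) \oL cd X (i + 1) \oL w i)
      + v (i + 1) \oL (f (i + 1) \oL w i + cd Y i \oL pY i).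

Let wiX i : w i \oL iX i = lid _. Proof. exact: biprodXX (bi i). Qed.
Let pYv i : pY i \oL v i = lid _. Proof. exact: biprodYY (bi i). Qed.
Let wv i : w i \oL v i = 0. Proof. exact: biprodXY (bi i). Qed.
Let pYiX i : pY i \oL iX i = 0. Proof. exact: biprodYX (bi i). Qed.

Let pYdZ i : pY (i + 1) \oL cd Z i = f (i + 1) \oL w i + cd Y i \oL pY i.
Proof. by rewrite dZ !lcompE pYiX pYv !lcompE oppr0 add0r. Qed.

Let dZiX i : cd Z i \oL iX i = - (iX (i + 1) \oL cd X (i + 1)) + v (i + 1) \oL f (i + 1).
Proof.
rewrite dZ !lcompE (lcompK _ (wiX _)) (lcompK _ (pYiX _)) (lcompK _ (wiX _)).
by rewrite !lcompE addr0.
Qed.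

Let wdZ i : w (i + 1) \oL cd Z i = - (cd X (i + 1) \oL w i).
Proof. by rewrite -cfunP /= lcompNl. Qed.

Let wiXK i T (x : lhom _ T) : x \oL w i \oL iX i = x.
Proof. by rewrite (lcompK _ (wiX i)) lcompm1. Qed.
Let pYvK i T (x : lhom _ T) : x \oL pY i \oL v i = x.
Proof. by rewrite (lcompK _ (pYv i)) lcompm1. Qed.
Let wvK i T (x : lhom _ T) : x \oL w i \oL v i = 0.
Proof. by rewrite (lcompK _ (wv i)) lcompm0. Qed.
Let pYiXK i T (x : lhom _ T) : x \oL pY i \oL iX i = 0.
Proof. by rewrite (lcompK _ (pYiX i)) lcompm0. Qed.
Let coneE := (wiX, pYv, wv, pYiX, wiXK, pYvK, wvK, pYiXK, addr0, add0r, oppr0, subr0,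
  @lcompDl, @lcompDr, @lcompNl, @lcompNr, @lcompBl, @lcompBr, @lcomp0m, @lcompm0, @lcomp1m,
  @lcompm1, @lcompA).

Lemma cone_vf0 : is_nullhtpy (cmapM v f).
Proof.
by exists iX => i /=; rewrite dZiX addNDK.
Qed.

Lemma cone_fw0 : is_nullhtpy (cmapM (cmap_shift f) w).
Proof.
exists (fun i => pY (i + 1)) => i /=.
by rewrite pYdZ lcompNl addNKD.
Qed.

(** The components of a null homotopy of [v g] along [w] and along [pY] are, up to sign, the lift of
    [g] and the homotopy between [f g'] and [g]. *)
Lemma cone_exact2 P (g : cmap P Y) : is_nullhtpy (cmapM v g) ->
  exists g' : cmap P X, is_nullhtpy (cmapM f g' - g).
Proof.
case=> H hH; have [i|g' hg'] := @cunshift k A P X (fun i => w i \oL H i).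
  have := congr1 (fun x => w (i + 1) \oL x) (hH i) => /=.
  rewrite lcompDr !lcompA wv wdZ lcomp0m lcompNl.
  by move/esym/(canRL (addKr _)); rewrite addr0 opprK.
exists g'; exists (fun i => - (pY i \oL H i)) => i /=.
have := congr1 (fun x => pY (i + 1) \oL x) (hH i) => /=.
rewrite lcompDr !lcompA pYv pYdZ lcomp1m => ->.
rewrite hg' !lcompE -addrA opprD addrA subrr add0r opprD.
by [].
Qed.

(** If [H] is a null homotopy of [w g], then [iX H] is a homotopy that moves [g] into the image of
    [v]. *)
Lemma cone_exact3 P (g : cmap P Z) : is_nullhtpy (cmapM w g) ->
  exists g' : cmap P Y, is_nullhtpy (cmapM v g' - g).
Proof.
case=> H hH.
have hH' i : w (i + 1) \oL g (i + 1) =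
    - (cd X (i + 1) \oL H i) + H (i + 1) \oL cd P (i + 1).
  by have := hH i; rewrite /= lcompNl.
pose G i := pY (i + 1) \oL g (i + 1) - f (i + 1) \oL H i.
have vG i : v (i + 1) \oL G i = g (i + 1)
    - (cd Z i \oL (iX i \oL H i) + iX (i + 1) \oL H (i + 1) \oL cd P (i + 1)).
  rewrite /G lcompA dZiX; apply: (biprod_in (bi (i + 1))).
    by rewrite ?coneE hH' ?coneE subrr.
  by rewrite ?coneE.
have [i|g' hg'] := @cunshift k A P Y G.
  have vinj T (a b : lhom T (Y (i + 1 + 1))) : v (i + 1 + 1) \oL a = v (i + 1 + 1) \oL b -> a = b.
    by move=> /(congr1 (fun x => pY (i + 1 + 1) \oL x)); rewrite !lcompA pYv !lcomp1m.
  apply: vinj; rewrite [LHS]lcompA -(cfunP v) -lcompA vG [RHS]lcompA vG !lcompE cfunP.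
  by rewrite (lcompK _ (cdd P (i + 1))) cdd ?coneE.
exists g'; exists (fun i => - (iX i \oL H i)) => i /=.
by rewrite hg' vG addrAC subrr add0r !lcompE opprD.
Qed.

(** A null homotopy of [f[1] g] is the missing [Y]-component of a map into the cone; the lift is
    therefore strict. *)
Lemma cone_exact4 P (g : cmap P (shift A X)) : is_nullhtpy (cmapM (cmap_shift f) g) ->
  exists g' : cmap P Z, cmapM w g' = g.
Proof.
case=> H hH.
have hH' i : f (i + 1 + 1) \oL g (i + 1) =
    - (cd Y (i + 1) \oL H i) + H (i + 1) \oL cd P (i + 1).
  by have := hH i; rewrite /= lcompNl.
have gP i : - (cd X (i + 1) \oL g i) = g (i + 1) \oL cd P i.
  by have := cfunP g i; rewrite /= lcompNl.
have [i|g' hg'] := @cunshift k A P Z (fun i => iX (i + 1) \oL g (i + 1) + v (i + 1) \oL H i).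
  apply: (biprod_in (bi (i + 1 + 1))).
    by rewrite ?coneE wdZ ?coneE gP.
  by rewrite ?coneE pYdZ ?coneE hH' ?coneE addNDK.
exists g'; apply: cmap_ext => j; have [i ->] := int_pred j.
by rewrite /= hg' ?coneE.
Qed.

Lemma cone_ext3 T (g : cmap Y T) : is_nullhtpy (cmapM g f) ->
  exists g' : cmap Z T, cmapM g' v = g.
Proof.
case=> H hH.
have gP i : cd T i \oL (g i \oL pY i + H i \oL w i) =
  (g (i + 1) \oL pY (i + 1) + H (i + 1) \oL w (i + 1)) \oL cd Z i.
  apply: (biprod_out (bi i)); rewrite -lcompA -[RHS]lcompA.
    by rewrite dZiX ?coneE -[g _ \oL f _]/(cmapM g f (i + 1)) hH addrK.
  by rewrite cfunP ?coneE cfunP.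
exists (@Cmap k A Z T (fun i => g i \oL pY i + H i \oL w i) gP); apply: cmap_ext => i /=.
by rewrite ?coneE.
Qed.

(** Restricting the null homotopy along [v] gives the extension, and along [iX] the homotopy that
    compares it with [g]. *)
Lemma cone_ext2 T (g : cmap X T) : is_nullhtpy (cmapM (cmap_shift g) w) ->
  exists g' : cmap Y T, is_nullhtpy (cmapM g' f - g).
Proof.
case=> H hH.
have hH' i : g (i + 1 + 1) \oL w (i + 1) =
    - (cd T (i + 1) \oL H i) + H (i + 1) \oL cd Z (i + 1).
  by have := hH i; rewrite /= lcompNl.
have [i|g' hg'] := @cunshift k A Y T (fun i => H i \oL v (i + 1)).
  have := congr1 (fun x => x \oL v (i + 1)) (hH' i).
  rewrite -lcompA wv lcompm0 !lcompE -[_ \oL cd Z _ \oL _]lcompA cfunP lcompA.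
  by move/esym/(canRL (addKr _)); rewrite addr0 opprK.
exists g'; apply/null_shift; exists (fun i => - (H i \oL iX (i + 1))) => i /=.
have := congr1 (fun x => x \oL iX (i + 1)) (hH' i).
rewrite -lcompA wiX lcompm1 => ->.
rewrite hg' !lcompE -[_ \oL cd Z _ \oL _]lcompA dZiX !lcompE !opprK.
by rewrite subNNDK.
Qed.
End Fixed.
End Cone.

(** * Triangles in the homotopy category and the five lemma *)

Section Triangles.
Variables (k : comPzRingType) (A : lincat k).
Implicit Types X Y Z P T : Kminus A.
Local Notation sh := (lmap (shift A)).

(** Triangles that are given by actual cones; the distinguished ones are those isomorphic to such a
    triangle. *)
Definition ctri X Y Z (u : lhom X Y) (v : lhom Y Z) (w : lhom Z (shift A X)) : Prop :=
  exists (f : cmap X Y) (g : cmap Y Z) (h : cmap Z (shift A X)),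
    [/\ u = kc f, v = kc g, w = kc h & is_cone f g h].

Section Exact.
Variables (X Y Z : Kminus A) (u : lhom X Y) (v : lhom Y Z) (w : lhom Z (shift A X)).
Hypothesis t : ctri u v w.

Lemma tri_vu0 : v \oL u = 0.
Proof.
case: t => f [g [h [-> -> _ [iX [pY [bi dZ]]]]]]; rewrite kcM; apply/kc_eq0.
exact: cone_vf0 bi dZ.
Qed.

Lemma tri_uw0 : sh u \oL w = 0.
Proof.
case: t => f [g [h [-> _ -> [iX [pY [bi dZ]]]]]]; rewrite kc_shift kcM; apply/kc_eq0.
exact: cone_fw0 bi dZ.
Qed.

Lemma tri_exact2 P (a : lhom P Y) : v \oL a = 0 -> exists b, u \oL b = a.
Proof.
case: t => f [g [h [-> -> _ [iX [pY [bi dZ]]]]]].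
have [a' ->] := kcP a; rewrite kcM => /kc_eq0/(cone_exact2 bi dZ)[b hb].
by exists (kc b); rewrite kcM; apply/kc_eq.
Qed.

Lemma tri_exact3 P (a : lhom P Z) : w \oL a = 0 -> exists b, v \oL b = a.
Proof.
case: t => f [g [h [_ -> -> [iX [pY [bi dZ]]]]]].
have [a' ->] := kcP a; rewrite kcM => /kc_eq0/(cone_exact3 bi dZ)[b hb].
by exists (kc b); rewrite kcM; apply/kc_eq.
Qed.

Lemma tri_exact4 P (a : lhom P (shift A X)) : sh u \oL a = 0 -> exists b, w \oL b = a.
Proof.
case: t => f [g [h [-> _ -> [iX [pY [bi dZ]]]]]].
have [a' ->] := kcP a; rewrite kc_shift kcM => /kc_eq0/(cone_exact4 bi dZ)[b hb].
by exists (kc b); rewrite kcM hb.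
Qed.

Lemma tri_ext3 T (a : lhom Y T) : a \oL u = 0 -> exists b, b \oL v = a.
Proof.
case: t => f [g [h [-> -> _ [iX [pY [bi dZ]]]]]].
have [a' ->] := kcP a; rewrite kcM => /kc_eq0/(cone_ext3 bi dZ)[b hb].
by exists (kc b); rewrite kcM hb.
Qed.

Lemma tri_ext2 T (a : lhom X T) : sh a \oL w = 0 -> exists b, b \oL u = a.
Proof.
case: t => f [g [h [-> _ -> [iX [pY [bi dZ]]]]]].
have [a' ->] := kcP a; rewrite kc_shift kcM => /kc_eq0/(cone_ext2 bi dZ)[b hb].
by exists (kc b); rewrite kcM; apply/kc_eq.
Qed.
End Exact.

(** The square commutes up to a homotopy [s], which becomes the off-diagonal entry of the map
    between the cones. *)
Lemma tri_map X Y Z X' Y' Z' (u : lhom X Y) v (w : lhom Z _)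
    (u' : lhom X' Y') v' (w' : lhom Z' _) (a : lhom X X') (b : lhom Y Y') :
  ctri u v w -> ctri u' v' w' -> b \oL u = u' \oL a ->
  exists c : lhom Z Z', c \oL v = v' \oL b /\ w' \oL c = sh a \oL w.
Proof.
case=> f [g [h [-> -> -> [iX [pY [bi dZ]]]]]].
case=> f' [g' [h' [-> -> -> [iX' [pY' [bi' dZ']]]]]].
have [a' ->] := kcP a; have [b' ->] := kcP b.
rewrite kc_shift !kcM => /kc_eq[s hs].
have hs' i : b' (i + 1) \oL f (i + 1) =
    cd Y' i \oL s i + s (i + 1) \oL cd X (i + 1) + f' (i + 1) \oL a' (i + 1).
  by rewrite -hs /= subrK.
pose c i := iX' i \oL a' (i + 1) \oL h i + g' i \oL (b' i \oL pY i + s i \oL h i).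
have hiX i := biprodXX (bi i); have gpY i := biprodYY (bi i).
have hg i := biprodXY (bi i); have pYiX i := biprodYX (bi i).
have hiX' i := biprodXX (bi' i); have gpY' i := biprodYY (bi' i).
have hg' i := biprodXY (bi' i); have pYiX' i := biprodYX (bi' i).
have hK i (T : A) (x : lhom (X' (i + 1)) T) : x \oL h' i \oL iX' i = x by rewrite (lcompK _ (hiX' i)) lcompm1.
have pK i (T : A) (x : lhom (Y' i) T) : x \oL pY' i \oL g' i = x by rewrite (lcompK _ (gpY' i)) lcompm1.
have hK0 i (T : A) (x : lhom (X' (i + 1)) T) : x \oL h' i \oL g' i = 0 by rewrite (lcompK _ (hg' i)) lcompm0.
have pK0 i (T : A) (x : lhom (Y' i) T) : x \oL pY' i \oL iX' i = 0 by rewrite (lcompK _ (pYiX' i)) lcompm0.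
have E := (hiX', gpY', hg', pYiX', hK, pK, hK0, pK0).
have hdZ i : h (i + 1) \oL cd Z i = - (cd X (i + 1) \oL h i) by rewrite -cfunP /= lcompNl.
have pdZ i : pY (i + 1) \oL cd Z i = f (i + 1) \oL h i + cd Y i \oL pY i.
  by rewrite dZ !lcompE pYiX gpY !lcompE oppr0 add0r.
have cP i : cd Z' i \oL c i = c (i + 1) \oL cd Z i.
  rewrite /c dZ'; apply: (biprod_in (bi' (i + 1))).
    rewrite !lcompE ?E ?lcompE ?E ?lcompE ?addr0 ?add0r ?oppr0 ?addr0.
    by rewrite -[RHS]lcompA hdZ lcompNr lcompA cfunP.
  rewrite !lcompE ?E ?lcompE ?E ?lcompE ?addr0 ?add0r ?oppr0 ?addr0 ?add0r.
  rewrite -[b' _ \oL _ \oL _]lcompA -[s _ \oL _ \oL _]lcompA hdZ pdZ !lcompE hs' !lcompE cfunP.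
  exact: esym (addKB5 _ _ _ _).
exists (kc (@Cmap k A Z Z' c cP)); rewrite !kcM.
split; congr kc; apply: cmap_ext => i /=; rewrite /c !lcompE ?E ?lcompE ?addr0 //.
  by rewrite (lcompK _ (hg i)) (lcompK _ (gpY i)) (lcompK _ (hg i)) !lcompE addr0 add0r.
Qed.

(** With [W] the complexes of projective objects this is the working form of a quasi-isomorphism;
    with [W] everything it characterizes isomorphisms. *)
Definition bijH (W : Kminus A -> Prop) X Y (a : lhom X Y) : Prop :=
  forall P, W P ->
    (forall b : lhom P X, a \oL b = 0 -> b = 0) /\ (forall b : lhom P Y, exists c, a \oL c = b).

(** The five lemma involves [Hom(P, X[1])], which is controlled by [Hom(P', X)] for a desuspension
    [P'] of [P] in [W]. *)
Definition unshift_closed (W : Kminus A -> Prop) : Prop :=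
  forall P, W P -> exists2 P', W P' & lisomorphic (shift A P') P.

Lemma bijH_shift W X Y (a : lhom X Y) : unshift_closed W -> bijH W a -> bijH W (sh a).
Proof.
move=> hW ha P /hW[P' hP' [e [e' [e'e ee']]]]; have [inj sur] := ha P' hP'.
have {}ee' : e \oL e' = lid _ := ee'.
have {}e'e : e' \oL e = lid _ := e'e.
split=> b.
  move=> hab; have [b' hb'] := kshift_full (b \oL e).
  have := inj b' _; rewrite -[b]lcompm1 -ee' lcompA -hb' => ->.
    by rewrite lmap0 lcomp0m.
  by apply: kshift_inj; rewrite lmapM hb' lmap0 lcompA hab lcomp0m.
have [b' hb'] := kshift_full (b \oL e); have [c hc] := sur b'.
exists (sh c \oL e'); rewrite lcompA -lmapM hc hb' -lcompA ee' lcompm1.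
by [].
Qed.

Lemma five W X Y Z X' Y' Z' (u : lhom X Y) v (w : lhom Z _)
    (u' : lhom X' Y') v' (w' : lhom Z' _) (a : lhom X X') (b : lhom Y Y') (c : lhom Z Z') :
  unshift_closed W -> ctri u v w -> ctri u' v' w' -> b \oL u = u' \oL a ->
  c \oL v = v' \oL b -> w' \oL c = sh a \oL w ->
  bijH W a -> bijH W b -> bijH W c.
Proof.
move=> hW t t' bu cv wc ha hb P hP.
have [ia sa] := ha P hP; have [ib sb] := hb P hP.
have [ia1 sa1] := bijH_shift hW ha hP; have [ib1 _] := bijH_shift hW hb hP.
split=> z.
  move=> cz; have wz : w \oL z = 0.
    by apply: ia1; rewrite lcompA -wc -lcompA cz lcompm0.
  have [y hy] := tri_exact3 t wz.
  have [x' hx'] : exists x', u' \oL x' = b \oL y.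
    by apply: (tri_exact2 t'); rewrite lcompA -cv -lcompA hy.
  have [x hx] := sa x'.
  have hyx : y = u \oL x.
    apply/eqP; rewrite -subr_eq0; apply/eqP/ib.
    by rewrite lcompBr -hx' -hx !lcompA bu subrr.
  by rewrite -hy hyx lcompA (tri_vu0 t) lcomp0m.
have [x hx] := sa1 (w' \oL z).
have ux : sh u \oL x = 0.
  apply: ib1; rewrite lcompA -lmapM bu lmapM -lcompA hx lcompA.
  by rewrite (tri_uw0 t') lcomp0m.
have [z0 hz0] := tri_exact4 t ux.
have [y' hy'] : exists y', v' \oL y' = z - c \oL z0.
  by apply: (tri_exact3 t'); rewrite lcompBr lcompA wc -lcompA hz0 hx subrr.
have [y hy] := sb y'.
by exists (z0 + v \oL y); rewrite lcompDr lcompA cv -lcompA hy hy' subKD.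
Qed.

Lemma bijH_iso X Y (a : lhom X Y) : bijH (fun=> True) a -> liso a.
Proof.
move=> ha; have [_ /(_ (lid Y))[b ab]] := ha Y I; exists b; split; last exact: ab.
have [inj _] := ha X I; apply/eqP; rewrite -subr_eq0; apply/eqP/inj.
by rewrite lcompBr lcompA ab lcomp1m lcompm1 subrr.
Qed.

Lemma iso_bijH W X Y (a : lhom X Y) : liso a -> bijH W a.
Proof.
case=> b [ba ab] P _; split=> c.
  by move=> ac; rewrite -[c]lcomp1m -[lid X]ba -[comp b a]/(b \oL a) -lcompA ac lcompm0.
by exists (b \oL c); rewrite lcompA -[RHS]lcomp1m -[lid Y]ab.
Qed.

Lemma unshift_all : unshift_closed (fun=> True).
Proof. by move=> P _; have [P' [_ hP']] := unshift_exists P; exists P'. Qed.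

Lemma tri_iso X Y Z X' Y' Z' (u : lhom X Y) v (w : lhom Z _)
    (u' : lhom X' Y') v' (w' : lhom Z' _) (a : lhom X X') (b : lhom Y Y') :
  ctri u v w -> ctri u' v' w' -> b \oL u = u' \oL a -> liso a -> liso b ->
  exists c : lhom Z Z', [/\ liso c, c \oL v = v' \oL b & w' \oL c = sh a \oL w].
Proof.
move=> t t' bu ha hb; have [c [cv wc]] := tri_map t t' bu.
exists c; split=> //; apply: bijH_iso.
exact: (five unshift_all t t' bu cv wc (iso_bijH ha) (iso_bijH hb)).
Qed.

Lemma ctri_distinguished X Y Z (u : lhom X Y) (v : lhom Y Z) w :
  distinguished u v w <-> exists X' Y' Z' (u' : lhom X' Y') v' (w' : lhom Z' (shift A X'))
   (a : lhom X X') (b : lhom Y Y') (c : lhom Z Z'),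
   [/\ ctri u' v' w', [/\ liso a, liso b & liso c] &
     [/\ b \oL u = u' \oL a, c \oL v = v' \oL b & sh a \oL w = w' \oL c]].
Proof.
split.
  case=> X' [Y' [Z' [f [g [h [a [b [c [h1 [h2 h3]]]]]]]]]].
  exists X', Y', Z', (kc f), (kc g), (kc h), a, b, c; split=> //.
  by exists f, g, h.
case=> X' [Y' [Z' [u' [v' [w' [a [b [c [[f [g [h [-> -> -> h1]]]] h2 h3]]]]]]]]].
by exists X', Y', Z', f, g, h, a, b, c.
Qed.

(** The part of the rotation axiom that recovers the first object of a triangle from the other two.
    The terms of [Z2] consist of those of [Y[1]], [X[1]] and [Y], and the homotopy [j1 pY p2]
    contracts the two copies of [Y]. *)
Lemma cone_rotate X Y Z Z2 (f : cmap X Y) (v : cmap Y Z) (w : cmap Z (shift A X))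
   (v2 : cmap Z Z2) (w2 : cmap Z2 (shift A Y)) :
  is_cone f v w -> is_cone v v2 w2 -> lisomorphic Z2 (shift A X).
Proof.
move=> [iX [pY [bi dZ]]] [j1 [p2 [bi2 dZ2]]].
have wiX i := biprodXX (bi i); have pYv i := biprodYY (bi i).
have wv i := biprodXY (bi i); have pYiX i := biprodYX (bi i).
have wj i := biprodXX (bi2 i); have pv2 i := biprodYY (bi2 i).
have wv2 i := biprodXY (bi2 i); have pj i := biprodYX (bi2 i).
have pdZ i : p2 (i + 1) \oL cd Z2 i = v (i + 1) \oL w2 i + cd Z i \oL p2 i.
  by rewrite dZ2 !lcompE pj pv2 !lcompE oppr0 add0r.
have dZj i : cd Z2 i \oL j1 i = - (j1 (i + 1) \oL cd Y (i + 1)) + v2 (i + 1) \oL v (i + 1).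
  rewrite dZ2 !lcompE ?(lcompK _ (wj _)) ?(lcompK _ (pj _)) ?(lcompK _ (wj _)) !lcompE.
  by rewrite addr0.
have pdZ' i : pY (i + 1) \oL cd Z i = f (i + 1) \oL w i + cd Y i \oL pY i.
  by rewrite dZ !lcompE pYiX pYv !lcompE oppr0 add0r.
have dZiX i : cd Z i \oL iX i = - (iX (i + 1) \oL cd X (i + 1)) + v (i + 1) \oL f (i + 1).
  rewrite dZ !lcompE ?(lcompK _ (wiX _)) ?(lcompK _ (pYiX _)) ?(lcompK _ (wiX _)) !lcompE.
  by rewrite addr0.
pose s i := v2 i \oL iX i - j1 i \oL f (i + 1).
have sP i : cd Z2 i \oL s i = s (i + 1) \oL cd (shift A X) i.
  rewrite /s /= !lcompE dZj cfunP -[v2 _ \oL _ \oL _]lcompA dZiX !lcompE opprD !opprK.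
  rewrite -[j1 _ \oL cd Y _ \oL _]lcompA cfunP lcompA.
  by rewrite -addrA [_ + (j1 _ \oL _ \oL _ - _)]addrC subrK.
have rP i : cd (shift A X) i \oL (w i \oL p2 i) = (w (i + 1) \oL p2 (i + 1)) \oL cd Z2 i.
  by rewrite lcompA cfunP -!lcompA pdZ !lcompDr !lcompA wv lcomp0m add0r.
pose r := @Cmap k A Z2 (shift A X) (fun i => w i \oL p2 i) rP.
pose s' := @Cmap k A (shift A X) Z2 s sP.
exists (kc r), (kc s'); split; rewrite -[LHS]/(_ \oL _) kcM -[RHS]kc1; last first.
  congr kc; apply: cmap_ext => i; rewrite /= /s !lcompE ?(lcompK _ (pv2 _)) ?(lcompK _ (pj _)).
  by rewrite !lcompE subr0 wiX.
apply/esym/kc_eq; exists (fun i => j1 i \oL pY (i + 1) \oL p2 (i + 1)) => i.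
rewrite /= /s !lcompE dZj -[_ \oL p2 _ \oL cd _ _]lcompA pdZ !lcompE.
rewrite ?(lcompK _ (pYv _)) !lcompE.
rewrite -[j1 _ \oL pY _ \oL _]lcompA pdZ' !lcompE.
rewrite -(biprod1 (bi2 (i + 1))).
have -> : v2 (i + 1) \oL p2 (i + 1) = v2 (i + 1) \oL iX (i + 1) \oL w (i + 1) \oL p2 (i + 1)
    + v2 (i + 1) \oL v (i + 1) \oL pY (i + 1) \oL p2 (i + 1).
  by rewrite -[in LHS](lcompm1 (v2 (i + 1))) -(biprod1 (bi (i + 1))) !lcompE.
exact: rotate_sum.
Qed.
End Triangles.

Section ConeExistence.
Variables (k : comPzRingType) (A : lincat k) (C : A -> Prop).
Hypothesis Cadd : forall X Y, C X -> C Y ->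
    exists Z iX iY pX pY, @is_biprod k A Z X Y iX iY pX pY /\ C Z.

Lemma biprod_zero Z X Y iX iY pX pY : @is_biprod k A Z X Y iX iY pX pY ->
  is_zero X -> is_zero Y -> is_zero Z.
Proof.
move=> b hX hY; rewrite /is_zero -(biprod1 b).
by rewrite [iX]from_zero // [iY]from_zero // !lcomp0m addr0.
Qed.

Lemma cone_exists (X Y : Kminus A) (f : cmap X Y) : inT C X -> inT C Y ->
  exists (Z : Kminus A) (v : cmap Y Z) (w : cmap Z (shift A X)), is_cone f v w /\ inT C Z.
Proof.
move=> hX hY.
pose S (i : int) := {Z : A & prod (prod (lhom (X (i + 1)) Z) (lhom (Y i) Z))
                               (prod (lhom Z (X (i + 1))) (lhom Z (Y i)))}.
have h i : exists t : S i, is_biprod (projT2 t).1.1 (projT2 t).1.2 (projT2 t).2.1 (projT2 t).2.2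
   /\ C (projT1 t).
  have [Z [iX [iY [pX [pY hZ]]]]] := Cadd (hX (i + 1)) (hY i).
  by exists (existT _ Z ((iX, iY), (pX, pY))).
pose B i := projT1 (cid (h i)).
have hB i := projT2 (cid (h i)); rewrite -/(B _) in hB.
pose iX i := (projT2 (B i)).1.1; pose v i := (projT2 (B i)).1.2.
pose w i := (projT2 (B i)).2.1; pose pY i := (projT2 (B i)).2.2.
have bi i : is_biprod (iX i) (v i) (w i) (pY i) by case: (hB i).
pose d i := - (iX (i + 1) \oL cd X (i + 1) \oL w i)
      + v (i + 1) \oL (f (i + 1) \oL w i + cd Y i \oL pY i).
have wiX i := biprodXX (bi i); have pYv i := biprodYY (bi i).
have wv i := biprodXY (bi i); have pYiX i := biprodYX (bi i).
have dd i : d (i + 1) \oL d i = 0.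
  rewrite /d !lcompE ?(lcompK _ (wiX _)) ?(lcompK _ (pYiX _)) ?(lcompK _ (wv _)) ?(lcompK _ (pYv _)).
  rewrite ?lcompE ?(lcompK _ (wv _)) ?(lcompK _ (pYv _)) ?lcompE.
  rewrite ?(lcompK _ (cdd X _)) ?(lcompK _ (cdd Y _)) ?lcompE ?oppr0 ?addr0 ?add0r.
    rewrite oppr0 add0r -[v _ \oL _ \oL _]lcompA cfunP lcompA addNr.
  by [].
have bd : exists n : int, forall i, n < i -> is_zero (projT1 (B i)).
  have [n hn] := cbd X; have [m hm] := cbd Y; exists (Num.max n m) => i.
  rewrite gt_max => /andP[ni mi].
  by apply: biprod_zero (bi i) _ _; [apply: hn; lia|apply: hm].
pose Z : Kminus A := @Cplx k A (fun i => projT1 (B i)) d dd bd.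
have vP i : cd Z i \oL v i = v (i + 1) \oL cd Y i.
  rewrite /= /d !lcompE ?(lcompK _ (wv _)) ?(lcompK _ (pYv _)) !lcompE ?oppr0 ?addr0 ?add0r.
  by [].
have wP i : cd (shift A X) i \oL w i = w (i + 1) \oL cd Z i.
  by rewrite /= /d !lcompE wiX wv !lcompE ?oppr0 ?addr0 ?add0r.
exists Z, (@Cmap k A Y Z v vP), (@Cmap k A Z (shift A X) w wP); split; last first.
  by move=> i; case: (hB i).
by exists iX, pY.
Qed.
End ConeExistence.

Section DegreewiseSplit.
Variables (k : comPzRingType) (A : lincat k).

(** A degreewise split sequence [S -> X -> T] yields a triangle: the connecting map [T -> S[1]] is
    the off-diagonal entry of the differential of [X], negated because the shift negates
    differentials. *)
Lemma split_cone (S X T : Kminus A) (v : cmap S X) (w : cmap X T)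
    (iX : forall i, lhom (T i) (X i)) (pY : forall i, lhom (X i) (S i)) :
  (forall i, is_biprod (iX i) (v i) (w i) (pY i)) ->
  exists (f : cmap T (shift A S)) (v' : cmap (shift A S) (shift A X))
         (w' : cmap (shift A X) (shift A T)), is_cone f v' w'.
Proof.
move=> bi.
have wiX i := biprodXX (bi i); have pYv i := biprodYY (bi i).
have wv i := biprodXY (bi i); have pYiX i := biprodYX (bi i).
have key i : cd X i \oL iX i = iX (i + 1) \oL cd T i
    + v (i + 1) \oL (pY (i + 1) \oL cd X i \oL iX i).
  apply: (biprod_in (bi (i + 1))); rewrite !lcompE ?wiX ?wv ?pYiX ?pYv !lcompE ?addr0 ?add0r //.
  by rewrite -cfunP (lcompK _ (wiX _)) lcompm1.
have fP i : cd (shift A S) i \oL - (pY (i + 1) \oL cd X i \oL iX i)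
   = - (pY (i + 1 + 1) \oL cd X (i + 1) \oL iX (i + 1)) \oL cd T i.
  have := congr1 (fun x => pY (i + 1 + 1) \oL cd X (i + 1) \oL x) (key i).
  rewrite /= !lcompE (lcompK _ (cdd X i)) !lcompE opprK.
  rewrite -[_ \oL cd X _ \oL v _]lcompA cfunP !lcompE pYv !lcompE.
  by move/esym/eqP; rewrite addr_eq0 => /eqP ->; rewrite opprK.
exists (@Cmap k A T (shift A S) _ fP), (cmap_shift v), (cmap_shift w).
exists (fun i => iX (i + 1)), (fun i => pY (i + 1)); split=> [i|i] /=; first exact: bi.
apply: (biprod_out (bi (i + 1))); rewrite !lcompE.
  rewrite key ?(lcompK _ (wiX _)) ?(lcompK _ (pYiX _)) !lcompE ?addr0 ?opprD.
  by rewrite subr0.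
by rewrite (cfunP v) ?(lcompK _ (wv _)) ?(lcompK _ (pYv _)) !lcompE ?oppr0 ?add0r.
Qed.
End DegreewiseSplit.

Lemma int_at (T : int -> Type) (n : int) (t0 : forall i, T i) (t : T n) :
  exists f : forall i, T i, f n = t /\ forall i, i != n -> f i = t0 i.
Proof.
exists (fun i => if i =P n is ReflectT e then ecast j (T j) (esym e) t else t0 i).
split=> [|i]; first by case: eqP => // e; rewrite (eq_axiomK e).
by case: eqP.
Qed.

(** * Complexes concentrated in one degree *)

Section Concentrated.
Variables (k : comPzRingType) (A : lincat k).
Implicit Types S X : Kminus A.

(** These are the test objects: homotopy classes of maps from one of them into [X] compute the
    cohomology of [Hom(N, X)] in that degree. *)
Definition concentrated S (n : int) : Prop := forall i, i != n -> is_zero (cob S i).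

Lemma concentrated_exists (O : A) (hO : is_zero O) (M : A) n :
  exists S : Kminus A, [/\ S n = M :> A, concentrated S n & forall i, S i = M :> A \/ S i = O :> A].
Proof.
have [ob [obn obi]] := @int_at (fun=> A) n (fun=> O) M.
have bd : exists m : int, forall i, m < i -> is_zero (ob i).
  by exists n => i ni; rewrite obi //; lia.
exists (@Cplx k A ob (fun=> 0) (fun=> lcompm0 _ _) bd); split=> // i /=.
  by move=> ni; rewrite /= obi.
by have [->|ni] := eqVneq i n; [left|right; apply: obi].
Qed.

Lemma conc_map S X n (u : lhom (S n) (X n)) :
  concentrated S n -> cd X n \oL u = 0 -> exists f : cmap S X, f n = u.
Proof.
move=> hS du; have [f [fn fi]] := @int_at (fun i => lhom (S i) (X i)) n (fun=> 0) u.
have fP i : cd X i \oL f i = f (i + 1) \oL cd S i.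
  have [->|ni] := eqVneq i n; last by apply: etrans (from_zero _ _) (esym (from_zero _ _)); apply: hS.
  by rewrite fn du [f (n + 1)]from_zero ?lcomp0m //; apply: hS; lia.
by exists (@Cmap k A S X f fP).
Qed.

Lemma conc_null S X i (f : cmap S X) : concentrated S (i + 1) ->
  is_nullhtpy f <-> exists v, cd X i \oL v = f (i + 1).
Proof.
move=> hS; split=> [[h hf]|[v hv]].
  exists (h i); rewrite hf [cd S (i + 1)]to_zero ?lcompm0 ?addr0 //; apply: hS; lia.
have [h [hi hj]] := @int_at (fun i => lhom (S (i + 1)) (X i)) i (fun=> 0) v.
exists h => j; have [->|nj] := eqVneq j i; last by apply: etrans (from_zero _ _) (esym (from_zero _ _)); apply: hS; lia.
by rewrite hi hj ?lcomp0m ?addr0 ?hv //; lia.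
Qed.
End Concentrated.

(** * Maps inducing isomorphisms on the cohomology of Hom complexes *)

Section WeakEquivalence.
Variables (k : comPzRingType) (A : lincat k) (Q : A -> Prop).
Implicit Types X Y Z : Kminus A.

(* [f] induces isomorphisms on the cohomology of [Hom(N, -)], for all [N] in [Q]. *)
Definition weq X Y (f : cmap X Y) : Prop := forall (i : int) (N : A), Q N ->
  (forall x : lhom N (X (i + 1)), cd X (i + 1) \oL x = 0 ->
    (exists y, cd Y i \oL y = f (i + 1) \oL x) -> exists x', cd X i \oL x' = x) /\
  (forall y : lhom N (Y (i + 1)), cd Y (i + 1) \oL y = 0 ->
    exists x y', cd X (i + 1) \oL x = 0 /\ y = f (i + 1) \oL x + cd Y i \oL y').

Lemma cone_qex X Y Z (f : cmap X Y) v (w : cmap Z (shift A X)) i :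
  is_cone f v w -> weq f -> qex Q Z i.
Proof.
case=> iX [pY [bi dZ]] hf N hN z dz.
have wiX i := biprodXX (bi i); have pYv i := biprodYY (bi i).
have wv i := biprodXY (bi i); have pYiX i := biprodYX (bi i).
pose x := w (i + 1) \oL z; pose y := pY (i + 1) \oL z.
have dx : cd X (i + 1 + 1) \oL x = 0.
  have := congr1 (fun t => w (i + 1 + 1) \oL t) dz.
  rewrite lcompm0 lcompA -(cfunP w) /= lcompNl lcompNl -lcompA -/x => /eqP.
  by rewrite oppr_eq0 => /eqP.
have dy : f (i + 1 + 1) \oL x + cd Y (i + 1) \oL y = 0.
  have := congr1 (fun t => pY (i + 1 + 1) \oL t) dz.
  rewrite lcompm0 dZ !lcompE pYiX pYv !lcompE oppr0 add0r => <-.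
  by [].
have [inj _] := hf (i + 1) N hN.
have [x' hx'] := inj x dx (ex_intro _ (- y) (etrans (lcompNr _ _) (addr0_eq (etrans (addrC _ _) dy)))).
have [_ /(_ (y + f (i + 1) \oL x')) []] := hf i N hN.
  by rewrite lcompDr lcompA cfunP -lcompA hx'; apply: etrans (addrC _ _) dy.
move=> x'' [y'' [dx'' hy]].
exists (iX i \oL (x'' - x') + v i \oL y'').
apply: (biprod_in (bi (i + 1))).
  rewrite lcompA -(cfunP w) /= -/x !lcompE ?(lcompK _ (wiX _)) ?(lcompK _ (wv _)) !lcompE.
  by rewrite dx'' hx' oppr0 sub0r opprK addr0.
rewrite dZ !lcompE pYiX pYv !lcompE ?(lcompK _ (wiX _)) ?(lcompK _ (wv _)).
rewrite ?(lcompK _ (pYv _)) ?(lcompK _ (pYiX _)) ?lcompE.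
rewrite -/y ?addr0 ?add0r ?oppr0 ?subr0 ?add0r.
by rewrite addr0 addrAC -hy addrK.
Qed.

Lemma unshift_entries : unshift_closed (fun W : Kminus A => forall i, Q (W i)).
Proof.
move=> P hP; have [P' [e iso]] := unshift_exists P; exists P' => // j.
by have [i ->] := int_pred j; rewrite e.
Qed.

(** The cone of [f] is exact for [Q], so a map into it from a complex with terms in [Q] is null, and
    the long exact sequence gives the bijection. *)
Lemma weq_bijH X Y (f : cmap X Y) : has_biprods A ->
  weq f -> bijH (fun W : Kminus A => forall i, Q (W i)) (kc f).
Proof.
move=> hA hf P hP.
have hA' (U V : A) : True -> True ->
    exists (N : A) iX iY pX pY, @is_biprod k A N U V iX iY pX pY /\ True.
  by move=> _ _; have [Z0 [iX [iY [pX [pY b]]]]] := hA U V; exists Z0, iX, iY, pX, pY.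
have [Z [v [w [hc _]]]] := @cone_exists k A (fun=> True) hA' X Y f (fun=> I) (fun=> I).
have t : ctri (kc f) (kc v) (kc w) by exists f, v, w.
have null (P' : Kminus A) (b : lhom P' Z) : (forall i, Q (P' i)) -> b = 0.
  move=> hP'; have [b' ->] := kcP b; apply/kc_eq0; apply: (@null_qex k A Q P' Z b' hP') => i.
  exact: (cone_qex hc hf).
split=> b.
  move=> fb; apply: kshift_inj; rewrite lmap0.
  have [c <-] := tri_exact4 t (etrans (esym (lmapM _ _ _)) (etrans (congr1 _ fb) (lmap0 _ _ _))).
  by rewrite (null _ c) ?lcompm0 // => i; apply: hP.
by apply: (tri_exact2 t); apply: null.
Qed.

(** The converse of [weq_bijH]: complexes concentrated in degree [i + 1] read off the cohomology
    there. *)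
Lemma bijH_weq (O : A) (hO : is_zero O) (QO : Q O) X Y (f : cmap X Y) :
  bijH (fun W : Kminus A => forall i, Q (W i)) (kc f) -> weq f.
Proof.
move=> hf i N hN.
have [S [Sn Sc SQ]] := concentrated_exists hO N (i + 1).
have hS j : Q (S j) by case: (SQ j) => ->.
have {hf} [inj sur] := hf S hS; case: _ / Sn {SQ hN}; split=> [x dx [y hy]|y dy].
  have [g gx] := conc_map Sc dx.
  have : kc g = 0 by apply: inj; rewrite kcM; apply/kc_eq0/(conc_null _ Sc); exists y; rewrite hy /= gx.
  by move/kc_eq0/(conc_null _ Sc) => [x' hx']; exists x'; rewrite hx'.
have [g gy] := conc_map Sc dy.
have [c hc] := sur (kc g); have [c' ec] := kcP c; move: hc.
rewrite ec kcM => /esym/kc_eq/(conc_null _ Sc)[y' /= hy'].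
exists (c' (i + 1)), y'; rewrite hy' gy subKD; split=> //.
by rewrite cfunP [cd S _]to_zero ?lcompm0 //; apply: Sc; lia.
Qed.

End WeakEquivalence.

(** * Truncation by splitting idempotents and by finite resolutions *)

Section Truncation.
Variables (k : comPzRingType) (A : lincat k) (C : A -> Prop).
Implicit Types X Y Z : Kminus A.

Lemma qex_shift X i : qex C (shift A X) i <-> qex C X (i + 1).
Proof.
split=> h N hN u; rewrite /= => du.
  by have [|v] := h N hN u; [rewrite /= lcompNl du oppr0|rewrite /= lcompNl -lcompNr; exists (- v)].
have [|v hv] := h N hN u; first by apply: oppr_inj; rewrite -lcompNl du oppr0.
by exists (- v); rewrite lcompNl lcompNr opprK.
Qed.

Lemma iso_unshift X Y : lisomorphic (shift A X) (shift A Y) -> lisomorphic X Y.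
Proof.
case=> a [b [ba ab]]; have [a' ha] := kshift_full a; have [b' hb] := kshift_full b.
exists a', b'; split; apply: kshift_inj; rewrite ?lmap1.
  by apply: etrans (lmapM _ _ _) _; rewrite ha hb.
by apply: etrans (lmapM _ _ _) _; rewrite ha hb.
Qed.

Lemma iso_shift X Y : lisomorphic X Y -> lisomorphic (shift A X) (shift A Y).
Proof. exact: (fob_isomorphic (shift A)). Qed.

Definition idem_split : Prop := forall M, C M -> forall e : lhom M M, e \oL e = e ->
  exists N (s : lhom N M) (r : lhom M N), [/\ C N, r \oL s = lid N & s \oL r = e].

(** As [X] is bounded above, exactness in positive degrees splits it there from the top down, by a
    contraction [s]. Then [1 - s d] is an idempotent of [X 0] that projects onto the cycles, and
    splitting it cuts off the positive part. *)
Lemma truncate_above (O : A) (hO : is_zero O) (CO : C O) X : idem_split -> inT C X ->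
  (forall i : int, 0 <= i -> qex C X i) ->
  exists Y, [/\ inT C Y, forall i : int, 0 < i -> is_zero (Y i) & lisomorphic X Y].
Proof.
move=> hC CX hX; have [n hn] := cbd X.
have [s s0 hs] : exists2 s : forall i, lhom (X (i + 1)) (X i),
    (forall i, i < 0 -> s i = 0) &
    forall i : int, 0 <= i -> lid (X (i + 1)) = cd X i \oL s i + s (i + 1) \oL cd X (i + 1).
  have [i lin|i lin t' qt'|s hs1 hs2] := @int_descend (fun i => lhom (X (i + 1)) (X i))
    (Num.max n 0) (fun=> 0)
    (fun i t => 0 <= i -> cd X i \oL t \oL cd X i = cd X i)
    (fun i t' t => 0 <= i -> lid (X (i + 1)) = cd X i \oL t + t' \oL cd X (i + 1)).
  - have z : is_zero (X (i + 1)) by apply: hn; lia.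
    by split=> _; [rewrite lcompm0 lcomp0m [RHS]to_zero|rewrite [LHS]z lcompm0 lcomp0m addr0].
  - case: (leP 0 i) => [i0|]; last by exists 0; lia.
    have i1 : 0 <= i + 1 by lia.
    have [|v hv] := hX i i0 _ (CX _) (lid _ - t' \oL cd X (i + 1)).
      by rewrite lcompBr lcompm1 lcompA qt' // subrr.
    exists v => _; last by rewrite hv subrK.
    by rewrite hv lcompBl lcomp1m -lcompA cdd lcompm0 subr0.
  exists (fun i => if 0 <= i then s i else 0) => i; first by rewrite ltNge => /negbTE ->.
  move=> i0; have i1 : 0 <= i + 1 by lia.
  by rewrite i0 i1; case: (hs2 i) => _; apply.
pose p : lhom (X 0) (X 0) := lid (X 0) - s 0 \oL cd X 0.
have dsd : cd X 0 \oL s 0 \oL cd X 0 = cd X 0.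
  have := congr1 (fun x => x \oL cd X 0) (hs 0 (lexx _)).
  by rewrite lcomp1m lcompDl -[s (0 + 1) \oL _ \oL _]lcompA cdd lcompm0 addr0.
have dp : cd X 0 \oL p = 0 by rewrite lcompBr lcompm1 lcompA dsd subrr.
have pp : p \oL p = p.
  by rewrite {1}/p lcompBl lcomp1m -lcompA dp lcompm0 subr0.
have [M [j [r [CM rj jr]]]] := hC _ (CX 0) p pp.
pose ob i := match i with Posz 0 => M | Posz _.+1 => O | Negz _ => X i end.
pose d i : lhom (ob i) (ob (i + 1)) :=
  match i return lhom (ob i) (ob (i + 1)) with
  | Posz _ => 0 | Negz 0 => r \oL cd X (Negz 0) | Negz n.+1 => cd X (Negz n.+1) end.
have pd : p \oL cd X (Negz 0) = cd X (Negz 0).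
  by rewrite lcompBl lcomp1m -lcompA [cd X 0 \oL _](cdd X (Negz 0)) lcompm0 subr0.
have dd i : d (i + 1) \oL d i = 0.
  case: i => [m|[|[|m]]]; rewrite /d ?lcompm0 ?lcomp0m //.
    by rewrite -lcompA [cd X _ \oL _](cdd X (Negz 1)) lcompm0.
  exact: (cdd X (Negz m.+2)).
have bd : exists n : int, forall i, n < i -> is_zero (ob i).
  by exists 0; case=> [[|m]|m].
pose Y : Kminus A := @Cplx k A ob d dd bd.
exists Y; split.
- by case=> [[|m]|m] //=; apply: CX.
- by case=> [[|m]|m].
pose f i : lhom (X i) (Y i) := match i return lhom (X i) (ob i) with
  | Posz 0 => r | Posz _.+1 => 0 | Negz m => lid (X (Negz m)) end.
pose g i : lhom (Y i) (X i) := match i return lhom (ob i) (X i) with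
  | Posz 0 => j | Posz _.+1 => 0 | Negz m => lid (X (Negz m)) end.
have ob0 m : is_zero (ob (Posz m + 1)) by rewrite -PoszD addn1.
have fP i : cd Y i \oL f i = f (i + 1) \oL cd X i.
  case: i => [m|[|m]].
  - by rewrite [LHS](to_zero _ (ob0 m)) [RHS](to_zero _ (ob0 m)).
  - by rewrite /= lcompm1.
  by rewrite [LHS]lcompm1; apply: esym (lcomp1m _).
have dj : cd X 0 \oL j = 0 by rewrite -[j]lcompm1 -rj !lcompA -(lcompA _ j) jr dp lcomp0m.
have gP i : cd X i \oL g i = g (i + 1) \oL cd Y i.
  case: i => [[|m]|[|m]].
  - by rewrite [LHS]dj /= lcompm0.
  - by rewrite [LHS]from_zero ?[RHS]from_zero.
  - by rewrite /= lcompm1 lcompA jr pd.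
  by rewrite [LHS]lcompm1; apply: esym (lcomp1m _).
exists (kc (@Cmap k A X Y f fP)), (kc (@Cmap k A Y X g gP)).
split; rewrite -[LHS]/(_ \oL _) kcM -[RHS]kc1; last first.
  congr kc; apply: cmap_ext => -[[|m]|m] /=; [exact: rj|by rewrite lcompm0 hO|exact: lcomp1m].
apply/esym/kc_eq; exists s => i; rewrite /=.
have gf0 m : g (Posz m + 1) \oL f (Posz m + 1) = 0.
  by rewrite [f _](to_zero _ (ob0 m)) lcompm0.
case: i => [m|[|m]].
- by rewrite gf0 subr0; apply: hs.
- by rewrite (s0 (Negz 0)) // lcompm0 add0r /= jr /p subKB.
rewrite (s0 (Negz m.+1)) // (s0 (Negz m.+1 + 1)) // lcompm0 lcomp0m addr0.
by rewrite [X in _ - X]lcomp1m subrr.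
Qed.

(** The maps given from degree [n] on extend downwards by exactness, and their composites differ
    from the identities by maps that vanish from degree [n] on, hence are null. *)
Lemma agree_iso X Y n (g : forall i, lhom (X i) (Y i)) (g' : forall i, lhom (Y i) (X i)) :
  inT C X -> inT C Y ->
  (forall i, n <= i -> cd Y i \oL g i = g (i + 1) \oL cd X i) ->
  (forall i, n <= i -> cd X i \oL g' i = g' (i + 1) \oL cd Y i) ->
  (forall i, n <= i -> g i \oL g' i = lid _) ->
  (forall i, n <= i -> g' i \oL g i = lid _) ->
  (forall i, i < n -> qex C X i) -> (forall i, i < n -> qex C Y i) ->
  lisomorphic X Y.
Proof.
move=> CX CY hg hg' gg' g'g eX eY.
have [f hf] := ext_map hg (fun i lin u du => eY i lin _ (CX i) u du).
have [f' hf'] := ext_map hg' (fun i lin u du => eX i lin _ (CY i) u du).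
exists (kc f), (kc f'); split; rewrite -[LHS]/(_ \oL _) kcM -[RHS]kc1; apply/kc_eq.
  apply: (@null_lift0 _ _ _ _ _ n) => [i lin|i lin u du].
    by rewrite /= hf ?hf' ?g'g ?subrr //; lia.
  exact: (eX i lin _ (CX _)).
apply: (@null_lift0 _ _ _ _ _ n) => [i lin|i lin u du].
  by rewrite /= hf ?hf' ?gg' ?subrr //; lia.
exact: (eY i lin _ (CY _)).
Qed.

Definition has_kernels : Prop := forall (X Y : A) (f : lhom X Y),
  exists (K : A) (i : lhom K X), is_kernel i f.

Lemma kernel_mono (K X Y T : A) (i : lhom K X) (f : lhom X Y) (a b : lhom T K) :
  is_kernel i f -> i \oL a = i \oL b -> a = b.
Proof.
case=> fi hi ab; have [|c [_ hc]] := hi T (i \oL a); first by rewrite lcompA fi lcomp0m.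
by rewrite -(hc a (erefl _)) -(hc b (esym ab)).
Qed.

(** The part of [X] below degree [-1] is exchanged for a finite [C]-resolution of the kernel of
    [X^-1 -> X^0]; both resolve this kernel in the sense of [Hom(N, -)] for [N] in [C]. *)
Lemma bounded_below0 (N : nat) X : has_kernels ->
  (forall M, exists2 n, has_resolution C M n & (n <= N)%N) ->
  inT C X -> (forall i : int, i + 1 < 0 -> qex C X i) ->
  exists Y, [/\ inT C Y, forall i : int, i < - (N%:Z + 2) -> is_zero (Y i) & lisomorphic X Y].
Proof.
move=> hK hres CX eX.
have [K [j hj]] := hK _ _ (cd X (Negz 0)).
have [n [F [d [e [res Fz]]]] le_nN] := hres K.
(* [F m] is placed in degree [-(m + 2)], which is the origin of the bound [N + 2]. *)
pose ob i := match i with Posz _ => X i | Negz 0 => X i | Negz m.+1 => F m end.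
pose dob i : lhom (ob i) (ob (i + 1)) := match i return lhom (ob i) (ob (i + 1)) with
  | Posz m => cd X (Posz m) | Negz 0 => cd X (Negz 0)
  | Negz 1 => j \oL e | Negz m.+2 => d m end.
have dd i : dob (i + 1) \oL dob i = 0.
  case: i => [m|[|[|[|m]]]].
  - exact: (cdd X (Posz m)).
  - exact: (cdd X (Negz 0)).
  - by rewrite [LHS]lcompA; case: hj => -> _; rewrite lcomp0m.
  - by rewrite -[LHS]/(j \oL e \oL d 0%N) -lcompA; case: (res_exact0 res) => -> _; rewrite lcompm0.
  by case: (res_exactS res m).
have bd : exists m : int, forall i, m < i -> is_zero (ob i).
  have [m hm] := cbd X; exists (Num.max m 0) => -[i|i] hi; last by lia.
  by apply: hm; lia.
pose Y : Kminus A := @Cplx k A ob dob dd bd.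
have CY : inT C Y.
  by case=> [m|[|m]]; [exact: CX|exact: CX|exact: (res_in res)].
exists Y; split=> //.
  case=> [m|[|m]] hm /=; [lia|lia|].
  by apply: Fz; lia.
pose g i : lhom (X i) (Y i) := match i return lhom (X i) (ob i) with
  | Posz m => lid (X (Posz m)) | Negz 0 => lid (X (Negz 0)) | _ => 0 end.
pose g' i : lhom (Y i) (X i) := match i return lhom (ob i) (X i) with
  | Posz m => lid (X (Posz m)) | Negz 0 => lid (X (Negz 0)) | _ => 0 end.
apply: (@agree_iso _ _ (Negz 0) g g') => //.
- by case=> [m|[|m]] // _; rewrite [LHS]lcompm1; apply: esym (lcomp1m _).
- by case=> [m|[|m]] // _; rewrite [LHS]lcompm1; apply: esym (lcomp1m _).
- by case=> [m|[|m]] // _; apply: lcomp1m.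
- by case=> [m|[|m]] // _; apply: lcomp1m.
- by move=> i hi; apply: eX; lia.
case=> [m|[|[|[|m]]]] // _ P hP u du.
- have [v [hv _]] := proj2 hj _ u du.
  have [w hw] := res_hom_epi res hP v.
  by exists w; rewrite -hv -hw; apply: esym (lcompA _ _ _).
- have [|v hv] := res_hom_exact0 res hP (u := u); last by exists v.
  by apply: (kernel_mono hj); rewrite lcompm0 -[RHS]du; apply: lcompA.
by have [v hv] := res_hom_exactS res hP du; exists v.
Qed.

(** Shifting reduces to [p = 0]; the two inductions treat the two signs of [p]. *)
Lemma bounded_below (N : nat) (p : int) X : has_kernels ->
  (forall M, exists2 n, has_resolution C M n & (n <= N)%N) ->
  inT C X -> (forall i : int, i + 1 < p -> qex C X i) ->
  exists Y, [/\ inT C Y, forall i : int, i < p - (N%:Z + 2) -> is_zero (Y i) & lisomorphic X Y].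
Proof.
move=> hK hres.
have up (m : nat) Z : inT C Z -> (forall i : int, i + 1 < m%:Z -> qex C Z i) ->
    exists Y, [/\ inT C Y, forall i : int, i < m%:Z - (N%:Z + 2) -> is_zero (Y i) & lisomorphic Z Y].
  elim: m Z => [|m IHm] Z CZ eZ.
    have [Y [CY zY ZY]] := bounded_below0 hK hres CZ eZ; exists Y; split=> // i hi.
    by apply: zY; lia.
  have [|i hi|Y [CY zY ZY]] := IHm (shift A Z); first by move=> i; apply: CZ.
    by apply/qex_shift/eZ; lia.
  have [Y' [eY' iY']] := unshift_exists Y; exists Y'; split.
  - by move=> i; have [l ->] := int_pred i; rewrite eY'.
  - by move=> i; have [l ->] := int_pred i => hl; rewrite eY'; apply: zY; lia.
  by apply: iso_unshift; apply: isomorphic_trans ZY (isomorphic_sym iY').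
have down (m : nat) Z : inT C Z -> (forall i : int, i + 1 < - m%:Z -> qex C Z i) ->
    exists Y, [/\ inT C Y, forall i : int, i < - m%:Z - (N%:Z + 2) -> is_zero (Y i) & lisomorphic Z Y].
  elim: m Z => [|m IHm] Z CZ eZ.
    have [Y [CY zY ZY]] := bounded_below0 hK hres CZ eZ; exists Y; split=> // i hi.
    by apply: zY; lia.
  have [Z' [eZ' iZ']] := unshift_exists Z.
  have [|i hi|Y [CY zY ZY]] := IHm Z'.
  - by move=> i; have [l ->] := int_pred i; rewrite eZ'.
  - have [l el] := int_pred i; rewrite {}el in hi *.
    apply/qex_shift/(qex_isomorphic _ _ iZ'); apply: eZ; lia.
  exists (shift A Y); split.
  - by move=> i; apply: CY.
  - by move=> i hi; apply: zY; lia.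
  by apply: isomorphic_trans (isomorphic_sym iZ') (iso_shift ZY).
move=> CX eX; case: p eX => [m|m] eX; first exact: up.
have [|i hi|Y [CY zY ZY]] := down m.+1 X; first exact: CX.
  by apply: eX; lia.
by exists Y; split=> // i hi; apply: zY; lia.
Qed.
End Truncation.

Definition mklin (R : pzRingType) (V W : lmodType R) (f : V -> W) (h : linear f) :
  {linear V -> W} := HB.pack f (GRing.isLinear.Build R V W _ f h).

(** * Duality over an artinian ring *)

Section Submodules.
Variables (R : pzRingType) (V : lmodType R) (U : submod V).

Definition subm : Type := {x : V | U x}.

HB.instance Definition _ := gen_eqMixin subm.
HB.instance Definition _ := gen_choiceMixin subm.

Definition smval (x : subm) : V := proj1_sig x.

Lemma smval_inj : injective smval.
Proof. by move=> [x hx] [y hy] /= e; apply: eq_exist. Qed.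

Definition sm0 : subm := exist _ 0 (submod0 U).
Definition smD (x y : subm) : subm :=
  exist _ (smval x + smval y) (submodD (proj2_sig x) (proj2_sig y)).
Definition smN (x : subm) : subm := exist _ (- smval x) (submodN (proj2_sig x)).
Definition smZ a (x : subm) : subm := exist _ (a *: smval x) (submodZ a (proj2_sig x)).

Fact smDA : associative smD. Proof. by move=> x y z; apply: smval_inj; apply: addrA. Qed.
Fact smDC : commutative smD. Proof. by move=> x y; apply: smval_inj; apply: addrC. Qed.
Fact smD0 : left_id sm0 smD. Proof. by move=> x; apply: smval_inj; apply: add0r. Qed.
Fact smDN : left_inverse sm0 smN smD.
Proof. by move=> x; apply: smval_inj; apply: addNr. Qed.

HB.instance Definition _ := GRing.isZmodule.Build subm smDA smDC smD0 smDN.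

Fact smZA a b x : smZ a (smZ b x) = smZ (a * b) x.
Proof. by apply: smval_inj; apply: scalerA. Qed.
Fact smZ1 : left_id 1 smZ. Proof. by move=> x; apply: smval_inj; apply: scale1r. Qed.
Fact smZDr : right_distributive smZ +%R.
Proof. by move=> a x y; apply: smval_inj; apply: scalerDr. Qed.
Fact smZDl x : {morph smZ^~ x : a b / a + b}.
Proof. by move=> a b; apply: smval_inj; apply: scalerDl. Qed.

HB.instance Definition _ := GRing.Zmodule_isLmodule.Build R subm smZA smZ1 smZDr smZDl.

Fact smval_linear : linear smval. Proof. by []. Qed.
HB.instance Definition _ := GRing.isLinear.Build R subm V _ smval smval_linear.
End Submodules.

Section QuotientFactor.
Variables (R : pzRingType) (V W : lmodType R) (N : submod V).

Lemma quot_factor (f : {linear V -> W}) : (forall x, N x -> f x = 0) ->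
  exists g : {linear quotmod N -> W}, forall x, g (qpi N x) = f x.
Proof.
move=> hf; have fE x y : qpi N x = qpi N y -> f x = f y.
  by move/qpiP/hf/eqP; rewrite linearB subr_eq0 => /eqP.
have gE x : f (qrepr (qpi N x)) = f x by apply: fE; rewrite qpi_repr.
have glin : linear (fun x : quotmod N => f (qrepr x)).
  move=> a x y; rewrite -(qpi_repr x) -(qpi_repr y).
  by rewrite -linearP !gE linearP.
by exists (mklin glin) => x; apply: gE.
Qed.
End QuotientFactor.

Section Modules.
Variables (k : comPzRingType).
Implicit Types V W : lmodType k.

Definition dcc V : Prop := forall U : nat -> submod V,
  (forall n x, U n.+1 x -> U n x) ->
  exists n, forall m, (n <= m)%N -> forall x, U n x -> U m x.

Lemma dcc_min V (P : submod V -> Prop) : dcc V -> (exists U, P U) ->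
  exists2 U, P U & forall U', P U' -> (forall x, U' x -> U x) -> forall x, U x -> U' x.
Proof.
move=> hV [U0 PU0]; apply: contrapT => hno.
have step (U : {U | P U}) : exists U' : {U | P U},
    (forall x, sval U' x -> sval U x) /\ ~ (forall x, sval U x -> sval U' x).
  apply: contrapT => hU; apply: hno; exists (sval U) => [|U' PU' sub]; first exact: proj2_sig U.
  by apply: contrapT => nsub; apply: hU; exists (exist _ U' PU').
pose nxt U := projT1 (cid (step U)).
pose c n := iter n nxt (exist P U0 PU0).
have [|n hn] := hV (fun n => sval (c n)).
  by move=> n x; rewrite /c /= /nxt; case: (cid _) => U' [] /= h _; apply: h.
have := projT2 (cid (step (c n))); rewrite -[projT1 _]/(c n.+1) => -[_]; apply.
exact: hn.
Qed.

Definition sub_scale V (a : k) (U : submod V) : submod V.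
Proof.
exists (fun y => exists2 x, U x & y = a *: x).
  by exists 0; [exact: submod0|rewrite scaler0].
move=> b _ _ [x hx ->] [y hy ->]; exists (b *: x + y); first exact: submod_lin.
by rewrite scalerDr !scalerA mulrC.
Defined.

Definition sub_ker V W (f : {linear V -> W}) (U : submod V) : submod V.
Proof.
exists (fun x => U x /\ f x = 0).
  by split; [exact: submod0|rewrite linear0].
move=> b x y [hx fx] [hy fy]; split; first exact: submod_lin.
by rewrite linearP fx fy scaler0 addr0.
Defined.

Fact scale_linear V (a : k) : linear (fun x : V => a *: x).
Proof. by move=> b x y; rewrite scalerDr !scalerA mulrC. Qed.
Definition scale_lin V (a : k) : {linear V -> V} := mklin (@scale_linear V a).

Fact line_linear V (x : V) : linear (fun b : k^o => b *: x).
Proof. by move=> a b c; rewrite scalerDl -scalerA. Qed.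
Definition line V (x : V) : {linear (k^o : lmodType k) -> V} := mklin (line_linear x).

(** The submodule [N + k x]. *)
Definition span1 V (N : submod V) (x : V) : submod V.
Proof.
exists (fun y => exists b, N (y - b *: x)).
  by exists 0; rewrite scale0r subr0; apply: submod0.
move=> a y z [b hb] [c hc]; exists (a * b + c).
rewrite scalerDl -scalerA opprD addrACA -scalerBr; exact: submod_lin.
Defined.

Definition zero_sub V : submod V.
Proof.
exists (fun x => x = 0) => // a x y -> ->; by rewrite scaler0 addr0.
Defined.

Lemma maximal_inv (p : ideal k) a : maximal_ideal p -> ~ p a -> exists b, p (1 - b * a).
Proof.
move=> [p1 pmax] pa; apply: contrapT => hno; apply: pa.
apply: (pmax (span1 p a)); first by case=> b hb; apply: hno; exists b.
  by move=> x px; exists 0; rewrite scale0r subr0.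
by exists 1; rewrite scale1r subrr; apply: submod0.
Qed.

Lemma ideal_mull (p : ideal k) (a b : k) : p b -> p (a * b).
Proof. exact: (@submodZ _ _ p). Qed.
Lemma ideal_mulr (p : ideal k) (a b : k) : p a -> p (a * b).
Proof. by rewrite mulrC; apply: ideal_mull. Qed.

Lemma maximal_prime (p : ideal k) a b : maximal_ideal p -> p (a * b) -> ~ p a -> p b.
Proof.
move=> hp pab pa; have [c hc] := maximal_inv hp pa.
have -> : b = b * (1 - c * a) + c * (a * b) by rewrite mulrBr mulr1 [c * (_ * _)]mulrA [b * _]mulrC subrK.
by apply: (@submodD _ _ p); apply: ideal_mull.
Qed.

Section Dual.
Variable E : lmodType k.
Hypothesis hE : injective_hull (quotmod (jacobson k)) E.
Hypothesis hk : artinian k.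

(** Injectivity of [E], applied to the injective map that [m] induces on the quotient of [V] by its
    kernel. *)
Lemma extend V W (m : {linear V -> W}) (f : {linear V -> E}) :
  (forall x, m x = 0 -> f x = 0) -> exists g : {linear W -> E}, forall x, g (m x) = f x.
Proof.
move=> mf; have ker_lin a x y : m x = 0 -> m y = 0 -> m (a *: x + y) = 0.
  by move=> mx my; rewrite linearP mx my scaler0 addr0.
pose N := @Submod _ _ (fun x => m x = 0) (linear0 m) ker_lin.
have [m' hm'] := @quot_factor k V W N m (fun x h => h).
have [f' hf'] := @quot_factor k V E N f mf.
have [|g hg] := (proj1 hE) _ _ m' f'.
  move=> x y; rewrite -(qpi_repr x) -(qpi_repr y) !hm' => h.
  by apply/qpiP; rewrite /= linearB h subrr.
by exists g => x; rewrite -hm' hg hf'.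
Qed.

(* [e] spans the socle component of [k / rad k] at [p]: it lies in all the
   maximal ideals but [p]. *)
Lemma residue_elt (p : ideal k) : maximal_ideal p ->
  exists e : k, [/\ ~ p e, forall a, p a -> jacobson k (a * e) &
    forall q : ideal k, maximal_ideal q -> ~ (forall x, p x -> q x) -> q e].
Proof.
move=> hp; have [p1 pmax] := hp.
(* Take [I] minimal among the ideals not contained in [p], and [e] in [I] outside [p]. For a maximal
   [q] not containing [p], the intersection of [I] and [q] is again not contained in [p], so it is
   all of [I] and [e] lies in [q]. *)
have [|I nIp Imin] := @dcc_min _ (fun I : ideal k => ~ (forall x, I x -> p x)) hk.
  have hT : exists I : ideal k, forall x, I x by exists (@Submod _ _ (fun _ : k^o => True) I (fun _ _ _ _ _ => I)).
  by case: hT => I hI; exists I => h; apply/p1/h.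
have [e /not_implyP[Ie pe]] : exists e, ~ (I e -> p e) by apply/not_existsP => h; apply: nIp => x; have := h x; move/contrapT.
have hq (q : ideal k) : maximal_ideal q -> ~ (forall x, p x -> q x) -> q e.
  move=> hq npq.
  have [t qt pt] : exists2 t, q t & ~ p t.
    apply: contrapT => hno; apply: npq; apply: (proj2 hq p) => // x qx.
    by apply: contrapT => px; apply: hno; exists x.
  have Iq_lin a x y : I x /\ q x -> I y /\ q y -> I (a *: x + y) /\ q (a *: x + y).
    by move=> [Ix qx] [Iy qy]; split; apply: submod_lin.
  pose J := @Submod _ _ (fun x => I x /\ q x) (conj (submod0 I) (submod0 q)) Iq_lin.
  suff : J e by case.
  apply: (Imin J) => //; last by move=> x [].
  move=> /(_ (t * e)) h; apply: pe; apply: (maximal_prime (a := t) hp) => //; apply: h; split.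
    exact: ideal_mull.
  exact: ideal_mulr.
exists e; split=> // a pa q hq'.
have [sub|nsub] := pselect (forall x, p x -> q x).
  by apply: ideal_mulr; apply: sub.
by apply: ideal_mull; apply: hq.
Qed.

(** The [p]-torsion of [E] is a line over [k / p]. By essentiality a nonzero [x] in it has a nonzero
    multiple in [k / rad k]; there the elements killed by [p] are multiples of the class of [e], and
    scalars outside [p] are invertible on [p]-torsion. *)
Lemma socle_simple (p : ideal k) (y z : E) : maximal_ideal p ->
  (forall a, p a -> a *: y = 0) -> (forall a, p a -> a *: z = 0) -> y != 0 ->
  exists a, z = a *: y.
Proof.
move=> hp py pz y0; have [e [pe he hq]] := residue_elt hp.
have [_ [j [jinj jess]]] := hE.
pose eps := j (qpi (jacobson k) e).
have inv a (x : E) : (forall a, p a -> a *: x = 0) -> ~ p a -> exists b, x = b *: (a *: x).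
  move=> px pa; have [b hb] := maximal_inv hp pa; exists b.
  by apply/eqP; rewrite scalerA -subr_eq0 -{1}[x]scale1r -scalerBl px.
have span x : (forall a, p a -> a *: x = 0) -> exists s, x = s *: eps.
  move=> px; have [->|x0] := eqVneq x 0; first by exists 0; rewrite scale0r.
  have [v [v0 [c hc]]] : exists v, v <> 0 /\ exists c, j v = c *: x.
    apply: contrapT => hno; case/eqP: x0.
    apply: (jess (span1 (zero_sub E) x)); last by exists 1; rewrite scale1r subrr.
    move=> v [b hb]; apply: contrapT => v0; apply: hno; exists v; split=> //; exists b.
    by apply/eqP; rewrite -subr_eq0; apply/eqP.
  have hv : forall a, p a -> a *: v = 0.
    by move=> a pa; apply: jinj; rewrite linearZ /= hc scalerA mulrC -scalerA px // scaler0 linear0.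
  have [c' hc'] := maximal_inv hp pe.
  have hv' : v = (qrepr v * c') *: qpi (jacobson k) e.
    rewrite -{1}[v]qpi_repr -linearZ; apply/qpiP => q hq'.
    have -> : (qrepr v : k) - (qrepr v * c') * e = (1 - c' * e) * qrepr v.
      by rewrite mulrBl mul1r; congr (_ - _); rewrite [RHS]mulrC mulrA.
    have := hv _ hc'; rewrite -[v in _ *: v]qpi_repr -linearZ -(linear0 (qpi (jacobson k))).
    by move/qpiP; rewrite subr0; apply.
  have pc : ~ p c by move=> pc; apply: v0; apply: jinj; rewrite hc px // linear0.
  have [b ->] := inv c x px pc; rewrite -hc hv' linearZ scalerA; by eexists.
have [s hs] := span z pz; have [t ht] := span y py.
have peps a : p a -> a *: eps = 0.
  by move=> pa; rewrite /eps -linearZ -linearZ -(linear0 j) -(linear0 (qpi (jacobson k))); congr (j _);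
     apply/qpiP; rewrite subr0; apply: he.
have pt : ~ p t by move=> pt; case/eqP: y0; rewrite ht peps.
have [b hb] := inv t eps peps pt.
by exists (s * b); rewrite -scalerA ht -hb.
Qed.

(** Among the nonzero multiples of [x] choose [y = a x] with [k y] minimal, expressed by the ideal
    of all [b] with [b x] in [k y]. Then [k y] is simple, it embeds in [E] through the socle element
    [e], and injectivity extends the embedding to [V]. *)
Lemma cogenerator V (x : V) : x != 0 -> exists f : {linear V -> E}, f x != 0.
Proof.
move=> x0.
pose P (I : ideal k) := exists2 a : k, a *: x != 0 & forall b, I b <-> exists c, b *: x = (c * a) *: x.
have [|I [a ax0 hI] Imin] := @dcc_min _ P hk.
  have lin0 : exists c : k, 0 *: x = (c * 1) *: x by exists 0; rewrite mul0r.
  have lin a b c : (exists t : k, b *: x = (t * 1) *: x) -> (exists t : k, c *: x = (t * 1) *: x) ->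
     exists t : k, (a * b + c) *: x = (t * 1) *: x by exists (a * b + c); rewrite mulr1.
  by exists (@Submod _ (k^o : lmodType k) (fun b => exists c, b *: x = (c * 1) *: x) lin0 lin); exists 1; rewrite ?scale1r.
set y := a *: x in ax0.
have key b : b *: y != 0 -> exists c, y = c *: (b *: y).
  move=> by0.
  have lin0 : exists c : k, 0 *: x = (c * (b * a)) *: x by exists 0; rewrite mul0r.
  have lin t u v : (exists c : k, u *: x = (c * (b * a)) *: x) -> (exists c : k, v *: x = (c * (b * a)) *: x) ->
     exists c : k, (t * u + v) *: x = (c * (b * a)) *: x.
    move=> [c hc] [d hd]; exists (t * c + d).
    by rewrite scalerDl -scalerA hc hd scalerA [in RHS]mulrDl [RHS]scalerDl -[in RHS]mulrA.
  pose J := @Submod _ (k^o : lmodType k) (fun u => exists c, u *: x = (c * (b * a)) *: x) lin0 lin.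
  have [c hc] : J a.
    apply: (Imin J).
    - by exists (b * a); [rewrite -scalerA|move=> c; split].
    - by move=> u [c hc]; apply/hI; exists (c * b); rewrite -mulrA.
    by apply/hI; exists 1; rewrite mul1r.
  by exists c; rewrite /y !scalerA -mulrA -hc.
pose p := @Submod _ (k^o : lmodType k) (fun b => b *: y = 0) (scale0r y)
  (fun c u v hu hv => etrans (scalerDl _ _ _) (etrans (congr2 _ (etrans (esym (scalerA _ _ _)) (etrans (congr1 _ hu) (scaler0 _ _))) hv) (addr0 _))).
have hp : maximal_ideal p.
  split=> [|I' I1 sub b I'b]; first by rewrite /= scale1r; apply/eqP.
  apply: contrapT => /eqP by0; have [c hc] := key b by0; apply: I1.
  have -> : 1 = (1 - c * b) + c * b :> k by rewrite subrK.
  apply: (@submodD _ _ I'); last exact: ideal_mull.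
  by apply: sub; rewrite /= scalerBl scale1r -scalerA -hc subrr.
have [e [pe he _]] := residue_elt hp; have [_ [j [jinj _]]] := hE.
have flin : linear (fun b : k^o => j (qpi (jacobson k) (b * e))).
  by move=> c u v; rewrite -!linearP /=; congr (j (qpi _ _)); rewrite mulrDl -mulrA.
have [b|g hg] := @extend _ _ (line y) (mklin flin).
  rewrite /= => /he h; rewrite -(linear0 j); congr (j _).
  by rewrite -(linear0 (qpi (jacobson k))); apply/qpiP; rewrite subr0.
exists g; apply/eqP => gx; apply: pe; rewrite /= .
have gy : g y = 0 by rewrite /y linearZ /= gx scaler0.
have := hg 1; rewrite /= scale1r mul1r gy -(linear0 j) => /jinj.
rewrite -(linear0 (qpi (jacobson k))) => /esym/qpiP; rewrite subr0 => Je.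
exact: (Je p hp).
Qed.

(** If [w] is not in the image of [f], a form on the quotient by the image detects its class. This
    turns the existence of a solution into a statement on linear forms. *)
Lemma farkas V W (f : {linear V -> W}) (w : W) :
  (forall t : {linear W -> E}, (forall v, t (f v) = 0) -> t w = 0) -> exists v, f v = w.
Proof.
move=> h; apply: contrapT => hno.
have N_lin a x y : (exists v, x = f v) -> (exists v, y = f v) -> exists v, a *: x + y = f v.
  by move=> [u ->] [v ->]; exists (a *: u + v); rewrite linearP.
pose N := @Submod _ _ (fun x => exists v, x = f v) (ex_intro _ 0 (esym (linear0 f))) N_lin.
have [|t ht] := @cogenerator _ (qpi N w).
  apply/eqP; rewrite -(linear0 (qpi N)) => /qpiP; rewrite subr0 => -[v hv].
  by apply: hno; exists v.
case/eqP: ht; apply: (h (t \o qpi N)) => v /=.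
have -> : qpi N (f v) = 0; last exact: linear0.
by rewrite -(linear0 (qpi N)); apply/qpiP; exists v; rewrite subr0.
Qed.

(** An induction in place of composition series. On a minimal counterexample [U] every scalar acts
    as [0] or surjectively, so the annihilator [p] of [U] is maximal; a form that does not vanish on
    [U] then cuts out a strictly smaller submodule. *)
Lemma dcc_ind V (Q : submod V -> Prop) : dcc V ->
  (forall U : submod V, (forall x, U x -> x = 0) -> Q U) ->
  (forall (U : submod V) a, Q (sub_scale a U) -> Q (sub_ker (scale_lin V a) U) -> Q U) ->
  (forall (U : submod V) (p : ideal k) (f : {linear V -> E}) x, maximal_ideal p ->
     (forall a u, p a -> U u -> a *: u = 0) -> U x -> f x != 0 -> Q (sub_ker f U) -> Q U) ->
  forall U, Q U.
Proof.
move=> hV Q0 QS QP U1; apply: contrapT => nQ1.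
have [|U nQ Umin] := @dcc_min _ (fun U => ~ Q U) hV; first by exists U1.
have prop (U' : submod V) : (forall x, U' x -> U x) -> (exists2 x, U x & ~ U' x) -> Q U'.
  by move=> sub [x Ux nU'x]; apply: contrapT => nQ'; apply: nU'x; apply: (Umin U').
have [/existsNP[x /not_implyP[Ux /eqP x0]]|/contrapT z] := pselect (~ forall x, U x -> x = 0); last first.
  by apply: nQ; apply: Q0.
have dich a : (forall u, U u -> a *: u = 0) \/ (forall u, U u -> exists2 v, U v & u = a *: v).
  apply: contrapT => /not_orP[/existsNP[u /not_implyP[Uu au]] /existsNP[v /not_implyP[Uv av]]].
  apply: nQ; apply: (QS U a); apply: prop.
  - by move=> _ [w Uw ->]; apply: submodZ.
  - by exists v.
  - by move=> w [].
  by exists u => // -[].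
pose p := @Submod _ (k^o : lmodType k) (fun b => forall u, U u -> b *: u = 0) (fun u _ => scale0r u)
  (fun c b d hb hd u Uu => etrans (scalerDl _ _ _) (etrans (congr2 _ (etrans (esym (scalerA _ _ _)) (etrans (congr1 _ (hb u Uu)) (scaler0 _ _))) (hd u Uu)) (addr0 _))).
have hp : maximal_ideal p.
  split=> [p1|I I1 sub a Ia]; first by move: (p1 x Ux); rewrite scale1r => /eqP; rewrite (negbTE x0).
  (* The ideals generated by the powers of [a] become stationary: [a ^ n = d a ^ (n + 1)]. Hence
     [1 - d a] kills [a ^ n U = U], so it lies in [I]. *)
  have [//|onto] := dich a; case: I1.
  have pow_lin n t b c : (exists d, b = d * a ^+ n) -> (exists d, c = d * a ^+ n) ->
     exists d, t * b + c = d * a ^+ n.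
    by move=> [d ->] [e ->]; exists (t * d + e); rewrite mulrDl mulrA.
  pose c n := @Submod _ (k^o : lmodType k) (fun b => exists d, b = d * a ^+ n)
    (ex_intro _ 0 (esym (mul0r _))) (@pow_lin n).
  have [|n /(_ n.+1 (leqnSn n) (a ^+ n))[|d hd]] := hk (I := c).
  - by move=> n b [d ->]; exists (d * a); rewrite exprS mulrA.
  - by exists 1; rewrite mul1r.
  have -> : 1 = (1 - d * a) + d * a :> k by rewrite subrK.
  apply: (@submodD _ _ I); last exact: ideal_mull.
  apply: sub => u Uu.
  have [w Uw ->] : exists2 w, U w & u = a ^+ n *: w.
    elim: n {hd} u Uu => [|n IHn] u Uu; first by exists u; rewrite ?expr0 ?scale1r.
    have [v Uv ->] := IHn u Uu; have [w Uw ->] := onto v Uv.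
    by exists w => //; rewrite scalerA -exprSr.
  by rewrite scalerA mulrBl mul1r -mulrA -exprS -hd subrr scale0r.
have [f fx] := cogenerator x0.
apply: nQ; apply: (QP U p f x hp) => //; first by move=> a u pa; apply: pa.
apply: prop; first by move=> u [].
by exists x => // -[_ fx0]; case/eqP: fx.
Qed.

End Dual.
End Modules.

(** * Reflexivity and finite generation from the descending chain condition *)

Section ChainConditions.
Variable k : comPzRingType.
Implicit Types V W : lmodType k.

(** The [g j] embed [V] in a finite power of [W]. Induction on the number of maps that separate the
    points of the chain: the images under the last map and the intersections with its kernel both
    become stationary. *)
Lemma dcc_joint V W n (g : 'I_n -> {linear V -> W}) : dcc W ->
  (forall x, (forall j, g j x = 0) -> x = 0) -> dcc V.
Proof.
move=> hW ginj.
suff H m : (m <= n)%N -> forall U : nat -> submod V, (forall i x, U i.+1 x -> U i x) ->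
    (forall x, U 0%N x -> (forall j : 'I_n, (j < m)%N -> g j x = 0) -> x = 0) ->
    exists i, forall j, (i <= j)%N -> forall x, U i x -> U j x.
  by move=> U hU; apply: (H n) => // x _ gx; apply: ginj => j; apply: gx.
have mono (T : Type) (P : nat -> T -> Prop) : (forall i x, P i.+1 x -> P i x) ->
    forall i j x, (i <= j)%N -> P j x -> P i x.
  move=> hP i j x /subnK <-; elim: (j - i)%N => [//|d IHd]; rewrite addSn => /hP; exact: IHd.
elim: m => [|m IHm] lemn U hU U0.
  exists 0%N => j _ x Ux; rewrite (U0 x Ux) //; exact: submod0.
pose gm := g (Ordinal lemn).
have img_lin i a x y : (exists2 u, U i u & x = gm u) -> (exists2 u, U i u & y = gm u) ->
   exists2 u, U i u & a *: x + y = gm u.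
  move=> [u Uu ->] [v Uv ->]; exists (a *: u + v); first exact: submod_lin.
  by rewrite linearP.
pose I i := @Submod _ _ (fun x => exists2 u, U i u & x = gm u)
  (ex_intro2 _ _ 0 (submod0 _) (esym (linear0 gm))) (@img_lin i).
have [|N1 hN1] := hW I; first by move=> i x [u Uu ->]; exists u => //; apply: hU.
have [||N2 hN2] := IHm (ltnW lemn) (fun i => sub_ker gm (U i)).
- by move=> i x [Ux gx]; split=> //; apply: hU.
- move=> x [Ux gx] hx; apply: U0 => // j; rewrite ltnS leq_eqVlt => /orP[/eqP jm|]; last exact: hx.
  by rewrite -[RHS]gx; congr (g _ x); apply: val_inj.
exists (maxn N1 N2) => j; rewrite geq_max => /andP[l1 l2] x Ux.
have Ux1 : U N1 x by apply: (mono _ _ hU) Ux; apply: leq_maxl.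
have [|u Uu gu] := hN1 j l1 (gm x); first by exists x.
have Uu2 : U N2 u by apply: (mono _ _ hU) Uu.
have Ux2 : U N2 x by apply: (mono _ _ hU) Ux; apply: leq_maxr.
have [|Uxu _] := hN2 j l2 (x - u).
  split; last by rewrite linearB gu subrr.
  by apply: submodD => //; apply: submodN.
by rewrite -(subrK u x); apply: submodD.
Qed.

Lemma dcc_surj V W (f : {linear V -> W}) : (forall w, exists v, f v = w) -> dcc V -> dcc W.
Proof.
move=> fsurj hV U hU.
have pre0 i : U i (f 0) by rewrite linear0; apply: submod0.
have pre_lin i a x y : U i (f x) -> U i (f y) -> U i (f (a *: x + y)).
  by rewrite linearP; apply: submod_lin.
pose P i := @Submod _ _ (fun x => U i (f x)) (pre0 i) (@pre_lin i).
have [|n hn] := hV P; first by move=> i x; apply: hU.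
exists n => m lnm w; have [v <-] := fsurj w; exact: (hn m lnm v).
Qed.

Section Dual.
Variable E : lmodType k.
Hypothesis hE : injective_hull (quotmod (jacobson k)) E.
Hypothesis hk : artinian k.

Fact lcomb_linear V (a : k) (f g : {linear V -> E}) : linear (fun x => a *: f x + g x).
Proof.
move=> b x y; rewrite /= !linearP /= !scalerA [a * b]mulrC.
by rewrite addrACA.
Qed.
Definition lcomb V a (f g : {linear V -> E}) : {linear V -> E} := mklin (lcomb_linear a f g).

Fact lscale_linear V (a : k) (f : {linear V -> E}) : linear (fun x => a *: f x).
Proof. by move=> b x y; rewrite !linearP /= !scalerA mulrC. Qed.
Definition lscale V a (f : {linear V -> E}) : {linear V -> E} := mklin (lscale_linear a f).

Fact lzero_linear V : linear (fun _ : V => 0 : E).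
Proof. by move=> b x y; rewrite scaler0 addr0. Qed.
Definition lzero V : {linear V -> E} := mklin (@lzero_linear V).

Lemma kill_scale V (U : submod V) a (f : {linear V -> E}) :
  (forall u, U u -> a *: u = 0 -> f u = 0) ->
  exists g : {linear V -> E}, forall u, U u -> f u = g (a *: u).
Proof.
move=> hf.
have [|g hg] := @extend k E hE _ _ (scale_lin V a \o @smval _ _ U) (f \o @smval _ _ U).
  by move=> u; apply: hf; exact: proj2_sig u.
by exists g => u Uu; have := hg (exist _ u Uu).
Qed.

(** Since [p] kills [U], both forms take values in the [p]-torsion of [E], a line spanned by [f0 x].
    The value of [f] at [x] fixes the factor, as every [u] is a multiple of [x] modulo the kernel of
    [f0]. *)
Lemma simple_factor V (U : submod V) (p : ideal k) (f0 f : {linear V -> E}) x :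
  maximal_ideal p -> (forall a u, p a -> U u -> a *: u = 0) -> U x -> f0 x != 0 ->
  (forall u, U u -> f0 u = 0 -> f u = 0) -> exists b, forall u, U u -> f u = b *: f0 u.
Proof.
move=> hp pU Ux fx hf.
have pE (h : {linear V -> E}) u a : U u -> p a -> a *: h u = 0.
  by move=> Uu pa; rewrite -linearZ /= pU // linear0.
have [b hb] := socle_simple hE hk hp (pE f0 x ^~ Ux) (pE f x ^~ Ux) fx.
exists b => u Uu.
have [c hc] := socle_simple hE hk hp (pE f0 x ^~ Ux) (pE f0 u ^~ Uu) fx.
have h0 : f0 (u - c *: x) = 0 by rewrite raddfB /= linearZ /= -hc subrr.
have /eqP := hf _ (submodD Uu (submodN (submodZ c Ux))) h0; rewrite raddfB /= linearZ /=.
by rewrite subr_eq0 => /eqP ->; rewrite hb hc !scalerA mulrC.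
Qed.

(** An element of the double dual of [V]. Linearity is expressed through pointwise values, as the
    type of linear forms carries no module structure at this point. *)
Definition functional V (l : {linear V -> E} -> E) : Prop :=
  forall a (f g h : {linear V -> E}), (forall x, h x = a *: f x + g x) -> l h = a *: l f + l g.

Section Functional.
Variables (V : lmodType k) (l : {linear V -> E} -> E).
Hypothesis hl : functional l.

Lemma functional0 (f : {linear V -> E}) : (forall x, f x = 0) -> l f = 0.
Proof.
move=> f0; have : l f = 1 *: l f + l f by apply: hl => x; rewrite f0 scaler0 addr0.
by rewrite scale1r -[X in X = _]addr0 => /addrI/esym.
Qed.

Lemma functionalZ a (f g : {linear V -> E}) : (forall x, g x = a *: f x) -> l g = a *: l f.
Proof.
move=> gE; rewrite (hl (a := a) (f := f) (g := lzero V)) => [|x]; last by rewrite gE addr0.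
by rewrite (@functional0 (lzero V)) ?addr0.
Qed.

Lemma functionalB (f g h : {linear V -> E}) : (forall x, h x = f x - g x) -> l h = l f - l g.
Proof.
by move=> hE'; rewrite (hl (a := -1) (f := g) (g := f)) ?scaleN1r 1?addrC // => x; rewrite hE' scaleN1r addrC.
Qed.
End Functional.

(** By [dcc_ind], a functional that depends only on the restrictions of forms to [U] is evaluation
    at an element of [U]. For a scalar [a], the functional [a l] lives on [a U] and gives some [v],
    and [l] minus evaluation at [v] lives on the [a]-torsion. In the third case [l f0] is a multiple
    of [f0 x], and what remains lives on the kernel of [f0]. *)
Lemma dcc_reflexive V : dcc V -> forall l : {linear V -> E} -> E, functional l ->
  exists v, forall f, l f = f v.
Proof.
move=> hV.
pose Q (U : submod V) := forall l : {linear V -> E} -> E, functional l ->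
  (forall f : {linear V -> E}, (forall u, U u -> f u = 0) -> l f = 0) ->
  exists2 v, U v & forall f, l f = f v.
have sub_ev l v : functional l -> functional (fun f => l f - f v).
  move=> hl a f g h hh; rewrite (hl a f g h hh) hh scalerBr opprD !addrA.
  by congr (_ + _); rewrite addrAC.
suff H : forall U, Q U.
  move=> l hl; have T_lin (a : k) (x y : V) : True -> True -> True by [].
  have [|v _ hv] := H (@Submod k V (fun=> True) I T_lin) l hl; last by exists v.
  by move=> f f0; apply: functional0 => // x; apply: f0.
apply: (dcc_ind hE hk hV) => [U U0 l hl lU|U a Q1 Q2 l hl lU|U p f0 x hp pU Ux f0x Q1 l hl lU].
- by exists 0; [exact: submod0|move=> f; rewrite linear0; apply: lU => u /U0 ->; rewrite linear0].
- have [||_ [v Uv ->] hv] := Q1 (fun f => a *: l f).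
  + by move=> b f g h hh; rewrite (hl b f g h hh) scalerDr !scalerA mulrC.
  + move=> f f0; rewrite -(functionalZ hl (g := lscale a f)) //.
    by apply: lU => u Uu /=; rewrite -linearZ /=; apply: f0; exists u.
  have [||v' [Uv' _] hv'] := Q2 (fun f => l f - f v); first exact: sub_ev.
    move=> f f0; have [|g hg] := @kill_scale V U a f; first by move=> u Uu au; apply: f0.
    have fg : l f = l (lscale a g).
      apply/eqP; rewrite -subr_eq0; apply/eqP.
      rewrite -(functionalB hl (h := lcomb (-1) (lscale a g) f)) => [|x]; last by rewrite /= scaleN1r addrC.
      by apply: lU => u Uu; rewrite /= scaleN1r hg // [g (a *: u)]linearZ /= addNr.
    by rewrite fg (functionalZ hl (a := a) (f := g)) // hv /= -hg // subrr.
  exists (v + v'); first exact: submodD.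
  by move=> f; rewrite linearD /= -hv' addrC subrK.
have kl a : p a -> a *: l f0 = 0.
  move=> pa; rewrite -(functionalZ hl (g := lscale a f0)) //; apply: lU => u Uu /=.
  by rewrite -linearZ /= pU // linear0.
have kx a : p a -> a *: f0 x = 0 by move=> pa; rewrite -linearZ /= pU // linear0.
have [c hc] := socle_simple hE hk hp kx kl f0x.
have [||v [Uv _] hv] := Q1 (fun f => l f - f (c *: x)); first exact: sub_ev.
  move=> f f0'; have [|b hb] := @simple_factor V U p f0 f x hp pU Ux f0x.
    by move=> u Uu hu; apply: f0'.
  have fg : l f = l (lscale b f0).
    apply/eqP; rewrite -subr_eq0; apply/eqP.
    rewrite -(functionalB hl (h := lcomb (-1) (lscale b f0) f)) => [|y]; last by rewrite /= scaleN1r addrC.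
    by apply: lU => u Uu; rewrite /= scaleN1r hb // addNr.
  rewrite fg (functionalZ hl (a := b) (f := f0)) // hc (hb (c *: x)); last exact: submodZ.
  by rewrite [f0 (c *: x)]linearZ /= subrr.
exists (c *: x + v); first by apply: submodD => //; apply: submodZ.
by move=> f; rewrite linearD /= -hv addrC subrK.
Qed.

Lemma reflexive_inj V (x : V) : (forall f : {linear V -> E}, f x = 0) -> x = 0.
Proof.
move=> h; apply/eqP; case: eqVneq => // /(cogenerator hE hk)[f]; by rewrite h eqxx.
Qed.

(* The induction proves that every submodule is finitely generated in the form
   that it lies in all the submodules containing its generators. *)
Lemma dcc_fg V (U : submod V) : dcc V -> exists n (v : 'I_n -> V),
  (forall i, U (v i)) /\ forall x, U x -> exists a : 'I_n -> k, x = \sum_(i < n) a i *: v i.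
Proof.
move=> hV.
pose Q (U : submod V) := exists n (v : nat -> V), (forall i, (i < n)%N -> U (v i)) /\
  forall N : submod V, (forall i, (i < n)%N -> N (v i)) -> forall x, U x -> N x.
suff H : forall U, Q U.
  have [n [v [Uv hv]]] := H U; exists n, (fun i => v i); split=> [i|x Ux]; first exact: Uv.
  have N_lin a z y : (exists b : 'I_n -> k, z = \sum_(i < n) b i *: v i) ->
      (exists b : 'I_n -> k, y = \sum_(i < n) b i *: v i) ->
      exists b : 'I_n -> k, a *: z + y = \sum_(i < n) b i *: v i.
    move=> [b ->] [c ->]; exists (fun i => a * b i + c i).
    by rewrite scaler_sumr -big_split; apply: eq_bigr => i _; rewrite scalerDl scalerA.
  have N0 : exists b : 'I_n -> k, 0 = \sum_(i < n) b i *: v i.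
    by exists (fun=> 0); rewrite big1 // => i _; rewrite scale0r.
  apply: (hv (Submod N0 N_lin)) => // i lin; exists (fun j => (j == i :> nat)%:R).
  rewrite (bigD1 (Ordinal lin)) //= eqxx scale1r big1 ?addr0 // => j.
  by rewrite -val_eqE /= => /negbTE ->; rewrite scale0r.
apply: (dcc_ind hE hk hV) => [U' U0|U' a [n1 [v1 [Uv1 hv1]]] [n2 [v2 [Uv2 hv2]]]|U' p f x hp pU Ux fx [n [v [Uv hv]]]].
- by exists 0%N, (fun=> 0); split=> // N _ x /U0 ->; apply: submod0.
- have [w hw] : exists w : nat -> V, forall i, (i < n1)%N -> U' (w i) /\ v1 i = a *: w i.
    apply: (@pair_choice _ _ (fun i => (i < n1)%N) (fun i w => U' w /\ v1 i = a *: w) (fun=> 0)) => i /Uv1[u Uu ->].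
    by exists u.
  exists (n1 + n2)%N, (fun i => if (i < n1)%N then w i else v2 (i - n1)%N); split=> [i lin|N hN x Ux].
    by case: ifP => [/hw[]//|] /negbT; rewrite -leqNgt => le_i; case: (Uv2 (i - n1)%N); first lia.
  have N1 : forall i, (i < n1)%N -> N (w i).
    by move=> i lin; have := hN i; rewrite lin; apply; lia.
  have N2 : forall i, (i < n2)%N -> N (v2 i).
    move=> i lin; have := hN (n1 + i)%N; rewrite [(_ < n1)%N]ltnNge leq_addr /= addKn; apply; lia.
  have M_lin b y z : (exists2 u, N u /\ U' u & y = a *: u) -> (exists2 u, N u /\ U' u & z = a *: u) ->
      exists2 u, N u /\ U' u & b *: y + z = a *: u.
    move=> [u [Nu Uu] ->] [u' [Nu' Uu'] ->]; exists (b *: u + u'); first by split; apply: submod_lin.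
    by rewrite scalerDr !scalerA mulrC.
  pose M := @Submod _ _ (fun y => exists2 u, N u /\ U' u & y = a *: u)
    (ex_intro2 _ _ 0 (conj (submod0 N) (submod0 U')) (esym (scaler0 _ a))) M_lin.
  have [i lin||u [Nu Uu] hu] := hv1 M _ (a *: x).
  + by have [Uw ->] := hw i lin; exists (w i) => //; split=> //; apply: N1.
  + by exists x.
  rewrite -(subrK u x); apply: submodD => //; apply: hv2 => //; split.
    by apply: submodD => //; apply: submodN.
  by rewrite /= scalerBr hu subrr.
exists n.+1, (fun i => if (i < n)%N then v i else x); split=> [i lin|N hN u Uu].
  by case: ifP => // /Uv[].
have Nx : N x by have := hN n (ltnSn n); rewrite ltnn.
have pE y : U' y -> forall a, p a -> a *: f y = 0.
  by move=> Uy a pa; rewrite -linearZ /= pU // linear0.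
have [c hc] := socle_simple hE hk hp (pE x Ux) (pE u Uu) fx.
rewrite -(subrK (c *: x) u); apply: submodD; last exact: submodZ.
apply: hv; last by split; [apply: submodD => //; apply: submodN; apply: submodZ|rewrite linearB linearZ /= hc subrr].
by move=> i lin; have := hN i; rewrite lin; apply; lia.
Qed.

(** The same induction. A form on [U] is first corrected by generators for the [a]-torsion, after
    which it factors through [a U]; in the third case by generators for the kernel of [f0], after
    which it is a multiple of [f0]. *)
Lemma dual_fg V : dcc V -> exists n (m : 'I_n -> {linear V -> E}),
  forall f : {linear V -> E}, exists a : 'I_n -> k, forall x, f x = \sum_(i < n) a i *: m i x.
Proof.
move=> hV.
pose comb n (m : nat -> {linear V -> E}) (a : nat -> k) x := \sum_(i < n) a i *: m i x.
pose Q (U : submod V) := exists n (m : nat -> {linear V -> E}),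
  forall f : {linear V -> E}, exists a : nat -> k, forall x, U x -> f x = comb n m a x.
suff H : forall U, Q U.
  have T_lin (a : k) (x y : V) : True -> True -> True by [].
  have [n [m hm]] := H (@Submod k V (fun=> True) I T_lin).
  by exists n, (fun i => m i) => f; have [a ha] := hm f; exists (fun i => a i) => x; apply: ha.
have comb_lin n m a : linear (comb n m a).
  move=> b x y; rewrite /comb scaler_sumr -big_split; apply: eq_bigr => i _.
  by rewrite linearP scalerDr !scalerA mulrC.
have comb_cat n1 n2 m1 m2 a1 a2 x :
   comb (n1 + n2)%N (fun i => if (i < n1)%N then m1 i else m2 (i - n1)%N)
     (fun i => if (i < n1)%N then a1 i else a2 (i - n1)%N) x = comb n1 m1 a1 x + comb n2 m2 a2 x.
  rewrite /comb big_split_ord; congr (_ + _); apply: eq_bigr => i _ /=; first by rewrite ltn_ord.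
  by rewrite ltnNge leq_addr /= addKn.
apply: (dcc_ind hE hk hV) => [U U0|U a [n1 [m1 h1]] [n2 [m2 h2]]|U p f0 x hp pU Ux f0x [n [m hm]]].
- by exists 0%N, (fun=> lzero V) => f; exists (fun=> 0) => x /U0 ->; rewrite linear0 /comb big_ord0.
- exists (n2 + n1)%N, (fun i => if (i < n2)%N then m2 i else lscale a (m1 (i - n2)%N)) => f.
  have [a2 ha2] := h2 f.
  pose f' := lcomb (-1) (mklin (comb_lin n2 m2 a2)) f.
  have [|g hg] := @kill_scale V U a f'.
    by move=> u Uu au; rewrite /= scaleN1r ha2 ?addNr.
  have [a1 ha1] := h1 g.
  exists (fun i => if (i < n2)%N then a2 i else a1 (i - n2)%N) => u Uu.
  rewrite (comb_cat n2 n1 m2 (fun i => lscale a (m1 i)) a2 a1).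
  have -> : comb n1 (fun i => lscale a (m1 i)) a1 u = comb n1 m1 a1 (a *: u).
    by apply: eq_bigr => i _ /=; rewrite [m1 i (a *: u)]linearZ.
  rewrite -ha1; last by exists u.
  by rewrite -hg // /= scaleN1r addNKr.
exists (n + 1)%N, (fun i => if (i < n)%N then m i else f0) => f.
have [a ha] := hm f; pose f' := lcomb (-1) (mklin (comb_lin n m a)) f.
have [|b hb] := @simple_factor V U p f0 f' x hp pU Ux f0x.
  by move=> u Uu hu; rewrite /= scaleN1r ha ?addNr.
exists (fun i => if (i < n)%N then a i else b) => u Uu.
rewrite (comb_cat n 1%N m (fun=> f0) a (fun=> b)) {2}/comb big_ord1 -hb //= scaleN1r.
by rewrite addNKr.
Qed.
End Dual.
End ChainConditions.

(** * Finitely generated modules over an artin algebra *)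

Section Restriction.
Variables (k : comPzRingType) (R : pzRingType) (iota : {rmorphism k -> R}).

(** Restriction of scalars to [k]; [iota] is kept in the type so that the scaling can be inferred
    from it. *)
Definition res of {rmorphism k -> R} : lmodType R -> Type := fun M => M.

HB.instance Definition _ M := GRing.Zmodule.copy (res iota M) M.

Section Scale.
Variable M : lmodType R.
Definition rscale (a : k) (x : res iota M) : res iota M := iota a *: (x : M).
Fact rscaleA a b x : rscale a (rscale b x) = rscale (a * b) x.
Proof. by rewrite /rscale scalerA rmorphM. Qed.
Fact rscale1 : left_id 1 rscale.
Proof. by move=> x; rewrite /rscale rmorph1 scale1r. Qed.
Fact rscaleDr : right_distributive rscale +%R.
Proof. by move=> a x y; apply: scalerDr. Qed.
Fact rscaleDl x : {morph rscale^~ x : a b / a + b}.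
Proof. by move=> a b; rewrite /rscale rmorphD scalerDl. Qed.
HB.instance Definition _ :=
  GRing.Zmodule_isLmodule.Build k (res iota M) rscaleA rscale1 rscaleDr rscaleDl.
End Scale.
End Restriction.

Section ModR.
Variables (k : comPzRingType) (R : pzRingType) (iota : {rmorphism k -> R}).
Hypothesis hR : is_artin_algebra iota.
Variable E : lmodType k.
Hypothesis hE : injective_hull (quotmod (jacobson k)) E.
Local Notation A := (modR hR).
Local Notation mod M := (proj1_sig M).
Local Notation hk := (center_artinian hR).

Definition app (M N : A) (f : lhom M N) : {linear mod M -> mod N} := f.

Lemma app_ext (M N : A) (f g : lhom M N) : (forall x, app f x = app g x) -> f = g.
Proof. exact: linear_ext. Qed.

Lemma app_comp (M N L : A) (g : lhom N L) (f : lhom M N) x : app (g \oL f) x = app g (app f x).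
Proof. by []. Qed.

Lemma app_lin (M N : A) a (f g : lhom M N) x : app (a *: f + g) x = iota a *: app f x + app g x.
Proof. by []. Qed.

Lemma app0 (M N : A) x : app (0 : lhom M N) x = 0.
Proof. by []. Qed.

Definition reslin (M N : lmodType R) (f : {linear M -> N}) : {linear res iota M -> res iota N} :=
  @mklin k (res iota M) (res iota N) f (fun a x y => linearP f (iota a) x y).

Lemma dcc_rV n : dcc (res iota 'rV[R]_n).
Proof.
have dR : dcc (res iota (R^o : lmodType R)).
  have [m [v hv]] := finite_over_center hR.
  have flin : linear (fun a : 'rV[k]_m => (\sum_i iota (a 0 i) * v i : res iota (R^o : lmodType R))).
    move=> c a b; rewrite scaler_sumr -big_split; apply: eq_bigr => i _.
    by rewrite !mxE rmorphD rmorphM mulrDl -mulrA.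
  apply: (dcc_surj (f := mklin flin)) => [x|].
    have [a ha] := hv x; exists (\row_i a i); rewrite [RHS]ha.
    by apply: eq_bigr => i _; rewrite mxE.
  have clin (i : 'I_m) : linear (fun a : 'rV[k]_m => a 0 i : k^o) by move=> c a b; rewrite !mxE.
  apply: (dcc_joint (g := fun i => mklin (clin i)) hk) => a ha.
  by apply/rowP => i; rewrite [LHS]ha mxE.
have clin (i : 'I_n) : linear (fun a : res iota 'rV[R]_n => (a : 'rV[R]_n) 0 i : res iota (R^o : lmodType R)).
  by move=> c a b; rewrite !mxE.
apply: (dcc_joint (g := fun i => mklin (clin i)) dR) => a ha.
by apply/rowP => i; rewrite [LHS]ha mxE.
Qed.

Lemma dcc_fgmod (M : lmodType R) : finitely_generated M -> dcc (res iota M).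
Proof.
case=> n [v hv].
have flin : linear (fun a : 'rV[R]_n => \sum_i a 0 i *: v i).
  move=> c a b; rewrite scaler_sumr -big_split; apply: eq_bigr => i _.
  by rewrite !mxE scalerDl scalerA.
apply: (dcc_surj (f := reslin (mklin flin))) (@dcc_rV n) => x.
have [a ha] := hv x; exists (\row_i a i); rewrite [RHS]ha.
by apply: eq_bigr => i _; rewrite mxE.
Qed.

Lemma dcc_mod (M : A) : dcc (res iota (mod M)).
Proof. exact: dcc_fgmod (proj2_sig M). Qed.
Arguments dcc_mod : clear implicits.

Lemma dcc_hom (M N : A) : dcc (lhom M N).
Proof.
have [n [v hv]] := proj2_sig M.
have elin (i : 'I_n) : linear (fun f : lhom M N => app f (v i) : res iota (mod N)) by [].
apply: (dcc_joint (V := lhom M N) (g := fun i => mklin (elin i)) (dcc_mod N)) => f hf.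
apply: app_ext => x; have [a ->] := hv x.
have fv i : app f (v i) = 0 := hf i.
by rewrite linear_sum /= big1 // => i _; rewrite linearZ /= fv scaler0.
Qed.

Lemma fg_surj (M N : lmodType R) (f : {linear M -> N}) :
  (forall y, exists x, f x = y) -> finitely_generated M -> finitely_generated N.
Proof.
move=> fs [n [v hv]]; exists n, (fun i => f (v i)) => y; have [x <-] := fs y.
have [a ->] := hv x; exists a; rewrite linear_sum; apply: eq_bigr => i _.
by rewrite linearZ.
Qed.

(** A submodule of [M] is a [k]-submodule of a module with the descending chain condition, so
    [dcc_fg] generates it already over [k]. *)
Lemma fg_subm (M : A) (U : submod (mod M)) : finitely_generated (subm U).
Proof.
have U_lin (a : k) (x y : res iota (mod M)) : U x -> U y -> U (a *: x + y).
  by move=> Ux Uy; apply: (@submod_lin _ _ U (iota a)).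
pose Uk := @Submod k (res iota (mod M)) U (submod0 U) U_lin.
have [n [v [Uv hv]]] := dcc_fg hE hk Uk (dcc_mod M).
exists n, (fun i => exist _ (v i) (Uv i) : subm U) => -[x Ux].
have [a ha] := hv x Ux; exists (fun i => iota (a i)); apply: smval_inj.
by rewrite linear_sum; rewrite [LHS]ha; apply: eq_bigr => i _; rewrite linearZ.
Qed.

Lemma modR_kernels : has_kernels A.
Proof.
move=> M N f.
have U_lin a x y : app f x = 0 -> app f y = 0 -> app f (a *: x + y) = 0.
  by move=> fx fy; rewrite linearP fx fy scaler0 addr0.
pose U := @Submod _ _ (fun x => app f x = 0) (linear0 (app f)) U_lin.
pose K : A := exist _ (subm U : lmodType R) (fg_subm U).
exists K, (@smval _ _ U : {linear subm U -> mod M}); split=> [|T t ft].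
  by apply: app_ext => -[x Ux].
have hu x : U (app t x) by have := congr1 (fun g => app g x) ft.
have u_lin : linear (fun x => exist _ (app t x) (hu x) : subm U).
  by move=> a x y; apply: smval_inj; apply: (linearP (app t)).
exists (mklin u_lin); split=> [|u' hu']; first exact: app_ext.
apply: app_ext => x; apply: smval_inj.
by have := congr1 (fun g => app g x) hu'.
Qed.

Lemma split_l m n (i : 'I_m) : split (lshift n i) = inl i.
Proof. exact: (unsplitK (inl i)). Qed.

Lemma split_r m n (j : 'I_n) : split (rshift m j) = inr j.
Proof. exact: (unsplitK (inr j)). Qed.

Lemma fg_prod (M N : A) : finitely_generated (mod M * mod N)%type.
Proof.
have [m [v hv]] := proj2_sig M; have [n [w hw]] := proj2_sig N.
exists (m + n)%N, (fun i => match split i with inl i => (v i, 0) | inr j => (0, w j) end).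
case=> x y; have [a ->] := hv x; have [b ->] := hw y.
exists (fun i => match split i with inl i => a i | inr j => b j end).
rewrite big_split_ord.
under eq_bigr => i _ do rewrite split_l.
under [X in _ = _ + X]eq_bigr => i _ do rewrite split_r.
rewrite [LHS](_ : _ = (\sum_(i < m) a i *: v i, 0) + (0, \sum_(i < n) b i *: w i)).
  congr (_ + _).
    elim/big_ind2: _ => // [x1 x2 y1 y2 <- <-|i _]; first by apply: injective_projections => //=; rewrite addr0.
    by apply: injective_projections => //=; rewrite scaler0.
  elim/big_ind2: _ => // [x1 x2 y1 y2 <- <-|i _]; first by apply: injective_projections => //=; rewrite addr0.
  by apply: injective_projections => //=; rewrite scaler0.
by apply: injective_projections => /=; rewrite ?addr0 ?add0r.
Qed.

Lemma modR_biprods : has_biprods A.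
Proof.
move=> M N; pose Z : A := exist _ ((mod M * mod N)%type : lmodType R) (fg_prod M N).
have l1 : linear (fun x : mod M => (x, 0) : mod M * mod N).
  by move=> a x y; apply: injective_projections => //=; rewrite scaler0 addr0.
have l2 : linear (fun y : mod N => (0, y) : mod M * mod N).
  by move=> a x y; apply: injective_projections => //=; rewrite scaler0 addr0.
have l3 : linear (fun z : mod M * mod N => z.1) by [].
have l4 : linear (fun z : mod M * mod N => z.2) by [].
exists Z, (mklin l1), (mklin l2), (mklin l3), (mklin l4); split; try exact: app_ext.
by apply: app_ext => -[x y]; apply: injective_projections; [apply: addr0|apply: add0r].
Qed.

Lemma epi_surj (M N : A) (f : lhom M N) : epi f -> forall y, exists x, app f x = y.
Proof.
move=> fe y.
have U_lin a z w : (exists x, app f x = z) -> (exists x, app f x = w) -> exists x, app f x = a *: z + w.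
  by move=> [x <-] [x' <-]; exists (a *: x + x'); rewrite linearP.
pose U := @Submod _ _ (fun z => exists x, app f x = z) (ex_intro _ 0 (linear0 (app f))) U_lin.
have qfg : finitely_generated (quotmod U).
  by apply: (fg_surj (f := qpi U)) (proj2_sig N) => z; exists (qrepr z); apply: qpi_repr.
pose Q : A := exist _ (quotmod U : lmodType R) qfg.
have e : (qpi U : lhom N Q) = 0.
  apply: fe; apply: app_ext => x; rewrite app_comp lcomp0m app0.
  by rewrite -(linear0 (qpi U)); apply/qpiP; rewrite subr0; exists x.
have : qpi U y = qpi U 0 by rewrite linear0 -[LHS]/(app (qpi U : lhom N Q) y) e.
by move/qpiP; rewrite subr0.
Qed.

Lemma regular_fg : finitely_generated (R^o : lmodType R).
Proof. by exists 1%N, (fun=> 1) => x; exists (fun=> x); rewrite big_ord1 [RHS]mulr1. Qed.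

Definition regular : A := exist _ (R^o : lmodType R) regular_fg.

Fact elt_linear (M : A) (x : mod M) : linear (fun r : (R^o : lmodType R) => (r : R) *: x).
Proof. by move=> a b c; rewrite scalerDl -scalerA. Qed.
Definition elt (M : A) (x : mod M) : lhom regular M := mklin (elt_linear x).

(** An element killed by [g] is a map from the regular module, so it factors through the kernel
    object, onto which the epimorphism [p] is surjective. *)
Lemma exact_at_elt (M N L : A) (f : lhom M N) (g : lhom N L) : exact_at f g ->
  forall y, app g y = 0 -> exists x, app f x = y.
Proof.
case=> gf [K [i [p [[gi hi] ip pe]]]] y gy.
have [|u [hu _]] := hi _ (elt y).
  by apply: app_ext => r; rewrite app_comp /= linearZ /= gy scaler0.
have [x hx] := epi_surj pe (app u 1); exists x.
rewrite -ip app_comp hx -app_comp hu; exact: scale1r.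
Qed.

Lemma factor_inj (N M L : A) (f : lhom M L) (u : lhom N L) :
  (forall x, app f x = 0 -> x = 0) -> (forall n, exists x, app f x = app u n) ->
  exists v, f \oL v = u.
Proof.
move=> finj hu; pose v n := projT1 (cid (hu n)).
have fv n : app f (v n) = app u n by rewrite /v; case: cid.
have vlin : linear v.
  move=> a x y; apply/eqP; rewrite -subr_eq0; apply/eqP/finj.
  by rewrite linearB linearP !fv linearP subrr.
by exists (mklin vlin); apply: app_ext => n; apply: fv.
Qed.

Lemma exact_at_zero (M N L : A) (f : lhom M N) (g : lhom N L) : is_zero N -> exact_at f g.
Proof.
move=> zN; split; first by rewrite [f]to_zero // lcompm0.
exists N, (lid N), f; split; [|exact: lcomp1m|].
  split=> [|T t _]; first by rewrite [g]from_zero // lcomp0m.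
  by exists t; split; [exact: lcomp1m|move=> t'; rewrite lcomp1m].
by move=> Z a b _; rewrite [a]from_zero // [b]from_zero.
Qed.

Lemma exact_at_mono (M N L : A) (f : lhom M N) (g : lhom N L) : is_zero M ->
  (forall T (t : lhom T N), g \oL t = 0 -> t = 0) -> exact_at f g.
Proof.
move=> zM gm; split; first by rewrite [f]from_zero // lcompm0.
exists M, f, (lid M); split; [|exact: lcompm1|].
  split=> [|T t /gm ->]; first by rewrite [f]from_zero // lcompm0.
  by exists 0; split; [exact: lcompm0|move=> t' _; rewrite [t']to_zero].
by move=> Z a b; rewrite !lcompm1.
Qed.

Lemma exact_at_kernel (M N L : A) (f : lhom M N) (g : lhom N L) : is_kernel f g -> exact_at f g.
Proof.
move=> hf; split; first by case: hf.
by exists M, f, (lid M); split; [|exact: lcompm1|move=> Z a b; rewrite !lcompm1].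
Qed.

Lemma modR_split : idem_split (fun _ : A => True).
Proof.
move=> M _ e ee; have [K [i hi]] := modR_kernels (lid M - e).
have ei : e \oL i = i.
  by case: hi => + _; rewrite lcompBl lcomp1m => /eqP; rewrite subr_eq0 => /eqP.
have [|r [ir _]] := proj2 hi _ e; first by rewrite lcompBl lcomp1m ee subrr.
exists K, i, r; split=> //; apply: (kernel_mono hi).
by rewrite lcompA ir ei lcompm1.
Qed.

(** The module presented by the matrix [rho]: maps out of it encode the solutions of a linear
    system. *)
Lemma fp_module p m (rho : 'I_m -> 'I_p -> R) : exists (M : A) (e : 'I_p -> mod M),
  (forall j, \sum_l rho j l *: e l = 0) /\
  forall (N : A) (h : 'I_p -> mod N), (forall j, \sum_l rho j l *: h l = 0) ->
    exists u : lhom M N, forall l, app u (e l) = h l.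
Proof.
pose F : lmodType R := 'rV[R]_p.
have Ffg : finitely_generated F.
  exists p, (fun i => delta_mx 0 i) => x; exists (fun i => x 0 i); exact: row_sum_delta.
pose row j : F := \row_l rho j l.
have N_lin a (x y : F) : (exists c : 'I_m -> R, x = \sum_j c j *: row j) ->
    (exists c : 'I_m -> R, y = \sum_j c j *: row j) ->
    exists c : 'I_m -> R, a *: x + y = \sum_j c j *: row j.
  move=> [c ->] [d ->]; exists (fun j => a * c j + d j).
  by rewrite scaler_sumr -big_split; apply: eq_bigr => j _; rewrite scalerDl scalerA.
have N0 : exists c : 'I_m -> R, 0 = \sum_j c j *: row j.
  by exists (fun=> 0); rewrite big1 // => j _; rewrite scale0r.
pose N := @Submod R F _ N0 N_lin.
have Qfg : finitely_generated (quotmod N).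
  by apply: (fg_surj (f := qpi N)) Ffg => z; exists (qrepr z); apply: qpi_repr.
exists (exist _ (quotmod N : lmodType R) Qfg), (fun l => qpi N (delta_mx 0 l)); split=> [j|L h hh].
  have hz : N (\sum_l rho j l *: delta_mx 0 l).
    exists (fun i => (i == j)%:R); rewrite (bigD1 j) //= eqxx scale1r.
    have -> : \sum_(i < m | i != j) (i == j)%:R *: row i = 0.
      by apply: big1 => i ij; rewrite (negbTE ij) scale0r.
    by rewrite addr0 [RHS]row_sum_delta; apply: eq_bigr => l _; rewrite mxE.
  transitivity (qpi N (\sum_l rho j l *: delta_mx 0 l)).
    by rewrite linear_sum; apply: eq_bigr => l _; rewrite linearZ.
  by rewrite -[RHS](linear0 (qpi N)); apply/qpiP; rewrite subr0.
have ulin : linear (fun x : F => \sum_l x 0 l *: h l).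
  move=> c a b; rewrite scaler_sumr -big_split; apply: eq_bigr => i _.
  by rewrite !mxE scalerDl scalerA.
have [|u hu] := @quot_factor R F (mod L) N (mklin ulin).
  move=> _ [c ->]; rewrite linear_sum big1 // => j _; rewrite linearZ /=.
  by under eq_bigr => l _ do rewrite mxE; rewrite hh scaler0.
exists u => l; rewrite [LHS]hu /= (bigD1 l) //= mxE !eqxx scale1r.
rewrite [X in _ + X]big1 ?addr0 // => i il.
by rewrite mxE eqxx /= (negbTE il) scale0r.
Qed.
End ModR.
Arguments dcc_mod {k R iota hR} M : rename.

Section DualModule.
Variables (k : comPzRingType) (E : lmodType k).
Hypothesis hE : injective_hull (quotmod (jacobson k)) E.
Hypothesis hk : artinian k.

(** Regarding [k] as an artin algebra over itself puts a [k]-module structure on the linear forms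
    [modhom V E]. *)
Lemma self_artin : is_artin_algebra (idfun : {rmorphism k -> k}).
Proof.
split=> //; first by move=> z; split=> [_|_ r]; [exists z|rewrite mulrC].
by exists 1%N, (fun=> 1) => x; exists (fun=> x); rewrite big_ord1 mulr1.
Qed.

Definition dual (V : lmodType k) : lmodType k := modhom V E self_artin.

(** By reflexivity a form on the dual of [V] is evaluation at some [v]; if it kills the image of
    [f], then [v = 0]. By [farkas] the image is the whole dual. *)
Lemma separating_span (V V0 : lmodType k) (f : {linear V0 -> dual V}) : dcc V ->
  (forall x, (forall s, (f s : {linear V -> E}) x = 0) -> x = 0) ->
  forall t : {linear V -> E}, exists s, forall x, t x = (f s : {linear V -> E}) x.
Proof.
move=> hV fsep t.
have [t' ht'|s hs] := @farkas k E hE hk V0 (dual V) f t; last by exists s => x; rewrite hs.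
have [|v hv] := dcc_reflexive hE hk hV (l := t').
  move=> a g h i hi; rewrite -linearP; congr (t' _); exact: linear_ext.
by rewrite hv (fsep v) ?linear0 // => s; rewrite -hv.
Qed.
End DualModule.

(** * Auslander-Reiten duality in mod(R) *)

Section EnoughInjectives.
Variables (k : comPzRingType) (R : pzRingType) (iota : {rmorphism k -> R}).
Hypothesis hR : is_artin_algebra iota.
Variable E : lmodType k.
Hypothesis hE : injective_hull (quotmod (jacobson k)) E.
Local Notation A := (modR hR).
Local Notation mod M := (proj1_sig M).
Local Notation hk := (center_artinian hR).

(** The contravariant functor [coker Hom(-, d)] embeds in [D Hom(M, -)] for [M = Tr D (ker d)], and
    [lam] defines the embedding. The right module [D (ker d)] is presented with the forms [mu j] as
    generators; its relations are the images of the [nu i] and the relations that the [mu j] satisfy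
    in [D L]. The matrix [rho] is the transpose of this presentation. *)
Lemma enough_injectives (L N : A) (d : lhom L N) :
  exists (M : A) (lam : {linear lhom M N -> E}),
    (forall w : lhom M L, lam (d \oL w) = 0) /\
    forall (N' : A) (g : lhom N' N), (forall u : lhom M N', lam (g \oL u) = 0) ->
      exists y : lhom N' L, d \oL y = g.
Proof.
have [m [mu hmu]] := dual_fg hE hk (dcc_mod L).
have [n [nu hnu]] := dual_fg hE hk (dcc_mod N).
have hr i := hmu (nu i \o reslin iota (app d)).
pose r i := projT1 (cid (hr i)).
have rE i (x : mod L) : nu i (app d x) = \sum_(j < m) r i j *: mu j x.
  by rewrite /r; case: cid => a ha; apply: ha.
have muZ j (a : k) (x : mod L) : mu j (iota a *: x) = a *: mu j x by exact (linearZ_LR (mu j) a x).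
have K_lin (a : k) (s s' : res iota 'rV[R]_m) :
  (forall x : mod L, \sum_j mu j ((s : 'rV[R]_m) 0 j *: x) = 0) ->
  (forall x : mod L, \sum_j mu j ((s' : 'rV[R]_m) 0 j *: x) = 0) ->
  (forall x : mod L, \sum_j mu j ((a *: s + s' : 'rV[R]_m) 0 j *: x) = 0).
  move=> hs hs' x.
  transitivity (a *: (\sum_j mu j ((s : 'rV[R]_m) 0 j *: x)) + \sum_j mu j ((s' : 'rV[R]_m) 0 j *: x)).
    2: by rewrite hs hs' scaler0 addr0.
  rewrite scaler_sumr -big_split; apply: eq_bigr => j _.
  rewrite -muZ /= -(raddfD (mu j)); congr (mu j _).
  by rewrite [LHS](_ : _ = (iota a * (s : 'rV[R]_m) 0 j + (s' : 'rV[R]_m) 0 j) *: x) ?mxE // scalerDl scalerA.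
have K_0 : forall x : mod L, \sum_j mu j ((0 : 'rV[R]_m) 0 j *: x) = 0.
  by move=> x; apply: big1 => j _; rewrite mxE scale0r linear0.
(* The [R]-linear relations between the forms [mu j] on [L], regarded as a [k]-module, for which
   [dcc_fg] supplies the generators [sv t]. *)
pose K := @Submod k (res iota 'rV[R]_m) _ K_0 K_lin.
have [T [sv [Ksv hsv]]] := dcc_fg hE hk K (dcc_rV hR (n := m)).
pose rho j (l : 'I_(n + T)) := match split l with
  inl i => iota (r i j) | inr t => (sv t : 'rV[R]_m) 0 j end.
have rho_sum (N' : A) (h : 'I_(n + T) -> mod N') j : \sum_l rho j l *: h l =
    \sum_(i < n) iota (r i j) *: h (lshift T i) + \sum_(t < T) (sv t : 'rV[R]_m) 0 j *: h (rshift n t).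
  by rewrite big_split_ord; congr (_ + _); apply: eq_bigr => i _; rewrite /rho ?split_l ?split_r.
have [M [e [he hM]]] := fp_module hR rho.
have lam_lin : linear (fun v : lhom M N => \sum_(i < n) nu i (app v (e (lshift T i)))).
  move=> a v w; rewrite scaler_sumr -big_split; apply: eq_bigr => i _.
  by rewrite app_lin; exact (linearP (nu i) a _ _).
exists M, (mklin lam_lin); split=> [w|N' g hg].
  rewrite [LHS](_ : _ = \sum_(i < n) \sum_(j < m) r i j *: mu j (app w (e (lshift T i)))); last first.
    by apply: eq_bigr => i _; apply: rE.
  rewrite exchange_big /=.
  transitivity (\sum_j mu j (- \sum_(t < T) (sv t : 'rV[R]_m) 0 j *: app w (e (rshift n t)))).
    apply: eq_bigr => j _.
    have := congr1 (app w) (he j); rewrite rho_sum raddfD !(raddf_sum (app w)) raddf0.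
    move/eqP; rewrite addr_eq0 => /eqP h.
    transitivity (mu j (\sum_(i < n) app w (iota (r i j) *: e (lshift T i)))).
      by rewrite (linear_sum (mu j)); apply: eq_bigr => i _; rewrite linearZ /= muZ.
    rewrite h; apply: (congr1 (fun z : mod L => mu j (- z))).
    by apply: eq_bigr => t _; exact (linearZ_LR (app w) _ _).
  under eq_bigr => j _ do rewrite linearN (linear_sum (mu j)).
  rewrite sumrN exchange_big big1 ?oppr0 // => t _; exact: Ksv.
have dN : dcc (lhom N' N) := dcc_hom (M := N') (N := N).
have dlin : linear (fun y : lhom N' L => d \oL y) by move=> a y y'; apply: lcompPr.
apply: (farkas hE hk (f := mklin dlin)) => th hth.
(* The forms [y |-> sum_i nu_i (y a_i)] separate the points of [Hom(N', N)], so [th] is one of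
   them. *)
have inner (a : {ffun 'I_n -> res iota (mod N')}) :
    linear (fun y : lhom N' N => \sum_(i < n) nu i (app y (a i))).
  move=> b y y'; rewrite scaler_sumr -big_split; apply: eq_bigr => i _.
  by rewrite app_lin; exact (linearP (nu i) b _ _).
pose ev a : dual E hk (lhom N' N) := mklin (inner a).
have ev_lin : linear ev.
  move=> b x y; apply: linear_ext => g'; rewrite [RHS](_ : _ =
    b *: (\sum_(i < n) nu i (app g' (x i))) + \sum_(i < n) nu i (app g' (y i))) //=.
  rewrite scaler_sumr -big_split; apply: eq_bigr => i _; rewrite !ffunE.
  exact (linearP (nu i \o reslin iota (app g')) b (x i) (y i)).
have nu_sep (z : mod N) : (forall i, nu i z = 0) -> z = 0.
  move=> hz; apply: (reflexive_inj hE hk (V := res iota (mod N))) => f.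
  by have [a ->] := hnu f; rewrite big1 // => i _; rewrite hz scaler0.
have [g' hg'|a ha] := @separating_span k E hE hk (lhom N' N) _ (mklin ev_lin) dN _ th.
  apply: app_ext => y; apply: nu_sep => i.
  have := hg' [ffun j => if j == i then y else 0]; rewrite /= (bigD1 i) //= ffunE eqxx.
  rewrite big1 ?addr0 // => j /negbTE ji; rewrite ffunE ji.
  exact (linear0 (nu j \o reslin iota (app g'))).
pose c : {ffun 'I_m -> res iota (mod N')} := [ffun j => \sum_(i < n) iota (r i j) *: (a i : mod N')].
have flin : linear (fun b : {ffun 'I_T -> res iota (mod N')} =>
    [ffun j => \sum_(t < T) (sv t : 'rV[R]_m) 0 j *: (b t : mod N')] : {ffun 'I_m -> res iota (mod N')}).
  move=> b x y; apply/ffunP => j; rewrite !ffunE scaler_sumr -big_split; apply: eq_bigr => t _.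
  rewrite !ffunE [LHS](_ : _ = (sv t : 'rV[R]_m) 0 j *: (iota b *: (x t : mod N') + y t)) //.
  by rewrite scalerDr scalerA -(iotaC hR) -scalerA.
(* A solution [b] of [sum_t sv_t b_t = c] makes [(a, -b)] a map [u : M -> N'], and then
   [th g = lam (g u) = 0]. Its existence is again tested on linear forms [t]. *)
have [t ht|b hb] := farkas hE hk (f := mklin flin) (w := c); last first.
  pose h l := match split l with inl i => (a i : mod N') | inr t => - (b t : mod N') end.
  have [j|u hu] := hM N' h.
    rewrite rho_sum; have := congr1 (fun f : {ffun _ -> _} => f j) hb; rewrite /= !ffunE => hbj.
    under eq_bigr => i _ do rewrite /h split_l.
    under [X in _ + X]eq_bigr => i _ do rewrite /h split_r scalerN.
    by rewrite sumrN [X in _ - X]hbj subrr.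
  rewrite ha -[RHS](hg u); apply: eq_bigr => i _.
  by rewrite app_comp hu /h split_l.
(* For fixed [y], the function [s |-> tv s y] vanishes on [K], so it depends only on the form [fs s]
   on [L]. By reflexivity of [L] it is evaluation at some [w y]. The map [w] is [R]-linear, and
   [t c] becomes [th (d w) = 0]. *)
pose tv (s : 'rV[R]_m) (y : mod N') : E :=
  t ([ffun j => s 0 j *: y] : {ffun 'I_m -> res iota (mod N')}).
have key1 s y : K s -> tv s y = 0.
  move=> /hsv[b sE]; rewrite -(ht [ffun t => iota (b t) *: y]) /tv; congr (t _).
  apply/ffunP => j; rewrite !ffunE sE summxE scaler_suml; apply: eq_bigr => l _.
  by rewrite !ffunE scalerA -(iotaC hR) !mxE.
have fs_lin (s : 'rV[R]_m) : linear (fun x : res iota (mod L) => \sum_j mu j (s 0 j *: (x : mod L))).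
  move=> b x y; rewrite scaler_sumr -big_split; apply: eq_bigr => j _.
  rewrite (_ : s 0 j *: _ = (b *: (s 0 j *: (x : mod L) : res iota (mod L)) + s 0 j *: (y : mod L))).
    exact (linearP (mu j) b _ _).
  rewrite [LHS](_ : _ = s 0 j *: (iota b *: (x : mod L) + y)) //.
  by rewrite scalerDr scalerA -(iotaC hR) -scalerA.
pose fs s := mklin (fs_lin s).
have fsB s s' x : fs (s - s') x = fs s x - fs s' x.
  rewrite /= -sumrB; apply: eq_bigr => j _.
  by rewrite !mxE scalerBl; exact (raddfB (mu j) _ _).
have tvB s s' y : tv (s - s') y = tv s y - tv s' y.
  rewrite /tv -raddfB; congr (t _); apply/ffunP => j; rewrite !ffunE !mxE.
  by rewrite scalerBl.
have key2 s s' y : (forall x, fs s x = fs s' x) -> tv s y = tv s' y.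
  move=> h; apply/eqP; rewrite -subr_eq0 -tvB; apply/eqP/key1 => x.
  by have := fsB s s' x; rewrite h subrr.
pose Af (f : {linear res iota (mod L) -> E}) := projT1 (cid (hmu f)).
have AfE (f : {linear res iota (mod L) -> E}) x : f x = \sum_j Af f j *: mu j x by rewrite /Af; case: cid => b hb; apply: hb.
pose rowA (b : 'I_m -> k) : 'rV[R]_m := \row_j iota (b j).
have fsA b x : fs (rowA b) x = \sum_j b j *: mu j x.
  by apply: eq_bigr => j _; rewrite mxE muZ.
have hx y : exists x : mod L, forall s, fs s x = tv s y.
  have lfun : functional (fun f => tv (rowA (Af f)) y).
    move=> b f g0 h hh; rewrite (key2 _ (rowA (fun j => b * Af f j + Af g0 j))).
      rewrite /tv -(linearP t); congr (t _); apply/ffunP => j; rewrite !ffunE !mxE.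
      by rewrite rmorphD rmorphM scalerDl -scalerA.
    move=> x; rewrite !fsA -AfE hh !AfE scaler_sumr -big_split; apply: eq_bigr => j _.
    by rewrite scalerDl scalerA.
  have [x hx] := dcc_reflexive hE hk (dcc_mod L) lfun.
  exists x => s; rewrite -hx; apply: key2 => z.
  by rewrite fsA -AfE.
pose w y := projT1 (cid (hx y)).
have wP y s : fs s (w y) = tv s y by rewrite /w; case: cid.
have fs_sep (z : mod L) : (forall s, fs s z = 0) -> z = 0.
  move=> hz; apply: (reflexive_inj hE hk (V := res iota (mod L))) => f.
  by rewrite AfE -fsA.
have wlin : linear w.
  move=> b y y'; apply/eqP; rewrite -subr_eq0; apply/eqP/fs_sep => s.
  transitivity (fs s (w (b *: y + y')) - (fs (\row_j (s 0 j * b)) (w y) + fs s (w y'))).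
    rewrite raddfB; congr (_ - _); rewrite /= -big_split; apply: eq_bigr => j _.
    by rewrite mxE scalerDr scalerA; exact (raddfD (mu j) _ _).
  rewrite !wP; apply/eqP; rewrite subr_eq0; apply/eqP.
  rewrite /tv -raddfD; congr (t _); apply/ffunP => j; rewrite !ffunE !mxE.
  by rewrite scalerDr scalerA.
pose wh : lhom N' L := mklin wlin.
transitivity (th (d \oL wh)); last exact: hth.
rewrite ha /=.
have -> : c = \sum_(i < n) ([ffun j => rowA (r i) 0 j *: (a i : mod N')] : {ffun 'I_m -> res iota (mod N')}).
  by apply/ffunP => j; rewrite sum_ffunE ffunE; apply: eq_bigr => i _; rewrite ffunE mxE.
rewrite raddf_sum; apply: eq_bigr => i _.
by rewrite -[LHS]/(tv (rowA (r i)) (a i)) -wP fsA rE.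
Qed.
End EnoughInjectives.

(** * Hearts *)

Section FullSubcategories.
Variables (k : comPzRingType) (A : lincat k) (P : A -> Prop).

Definition epi_in (X Y : A) (e : lhom X Y) : Prop :=
  forall Z, P Z -> forall g : lhom Y Z, g \oL e = 0 -> g = 0.

Definition mono_in (X Y : A) (m : lhom X Y) : Prop :=
  forall Z, P Z -> forall g : lhom Z X, m \oL g = 0 -> g = 0.

Lemma fullsub_epi (X Y : fullsub P) (e : lhom (proj1_sig X) (proj1_sig Y)) :
  @epi k (fullsub P) X Y e <-> epi_in e.
Proof.
split=> [he Z PZ g ge|he [Z PZ] g h].
  by apply: (he (exist _ Z PZ)); rewrite [LHS]ge [RHS]lcomp0m.
move: g h; rewrite /= => g h gh; apply/eqP; rewrite -subr_eq0; apply/eqP.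
by apply: (he Z PZ); rewrite lcompBl; apply/eqP; rewrite subr_eq0; apply/eqP.
Qed.

Lemma fullsub_mono (X Y : fullsub P) (m : lhom (proj1_sig X) (proj1_sig Y)) :
  @mono k (fullsub P) X Y m <-> mono_in m.
Proof.
split=> [hm Z PZ g mg|hm [Z PZ] g h].
  by apply: (hm (exist _ Z PZ)); rewrite [LHS]mg [RHS]lcompm0.
move: g h; rewrite /= => g h gh; apply/eqP; rewrite -subr_eq0; apply/eqP.
by apply: (hm Z PZ); rewrite lcompBr; apply/eqP; rewrite subr_eq0; apply/eqP.
Qed.

Lemma ProjP X : Proj P X <-> P X /\ forall U V (e : lhom U V) (f : lhom X V),
  P U -> P V -> epi_in e -> exists g, e \oL g = f.
Proof.
split=> [[hX pX]|[hX pX]].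
  split=> // U V e f hU hV he.
  by apply: (pX (exist _ U hU) (exist _ V hV) e f); apply/fullsub_epi.
by exists hX => -[U hU] [V hV] e f /fullsub_epi; apply: pX.
Qed.

Lemma InjP X : Inj P X <-> P X /\ forall U V (m : lhom U V) (f : lhom U X),
  P U -> P V -> mono_in m -> exists g, g \oL m = f.
Proof.
split=> [[hX pX]|[hX pX]].
  split=> // U V e f hU hV he.
  by apply: (pX (exist _ U hU) (exist _ V hV) e f); apply/fullsub_mono.
by exists hX => -[U hU] [V hV] e f /fullsub_mono; apply: pX.
Qed.

Lemma Proj_iso X Y : lisomorphic X Y -> P Y -> Proj P X -> Proj P Y.
Proof.
move=> [a /lisoP[b [ba ab]]] PY /ProjP[PX pX]; apply/ProjP; split=> // U V e f hU hV he.
have [g hg] := pX U V e (f \oL a) hU hV he.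
by exists (g \oL b); rewrite lcompA hg -lcompA ab lcompm1.
Qed.
End FullSubcategories.

(** * Stalk complexes and complexes with three terms *)

Section StalkFacts.
Variables (k : comPzRingType) (A : lincat k) (O : A) (hO : is_zero O).
Implicit Types X Y Z : Kminus A.
Local Notation P_ M := (stalk hO M : Kminus A).

Lemma stalk_conc (M : A) : concentrated (P_ M) 0.
Proof. by case=> [[|n]|n]. Qed.

Lemma stalk_lift (M : A) X (u : lhom M (X 0)) : cd X 0 \oL u = 0 ->
  exists f : cmap (P_ M) X, f 0 = u.
Proof. exact: (conc_map (n := 0) (@stalk_conc M)). Qed.

Lemma stalk_null (M : A) X (f : cmap (P_ M) X) :
  is_nullhtpy f <-> exists v : lhom M (X (Negz 0)), cd X (Negz 0) \oL v = f 0.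
Proof. exact: (@conc_null k A (P_ M) X (Negz 0) f (@stalk_conc M)). Qed.

Lemma stalk_full (M N : A) (a : lhom (P_ M) (P_ N)) : exists f, a = lmap (stalk hO) f.
Proof.
have [f ->] := kcP a; exists (f 0); apply/kc_eq/stalk_null; exists 0.
by rewrite lcompm0 /= subrr.
Qed.

Lemma stalk_faithful (M N : A) (f : lhom M N) : lmap (stalk hO) f = 0 -> f = 0.
Proof. by move/kc_eq0/stalk_null => [v]; rewrite lcomp0m. Qed.

Lemma zero_iso (X Y : A) : is_zero X -> is_zero Y -> lisomorphic X Y.
Proof.
by move=> hX hY; exists (0 : lhom X Y), (0 : lhom Y X); split; apply: etrans (from_zero _ _) (esym (from_zero _ _)).
Qed.

(** For [X] in degrees [<= 0] and [Z] exact in negative degrees, the component in degree [0]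
    decides: [v] starts the homotopy, and exactness continues it downwards. *)
Lemma null_below (Q : A -> Prop) X Z (f : cmap X Z) (v : lhom (X 0) (Z (Negz 0))) :
  (forall i, Q (X i)) -> (forall i : int, 0 < i -> is_zero (X i)) ->
  (forall i : int, i < -1 -> qex Q Z i) -> cd Z (Negz 0) \oL v = f 0 -> is_nullhtpy f.
Proof.
move=> QX zX eZ hv.
pose h0 i : lhom (X (i + 1)) (Z i) := match i return lhom (X (i + 1)) (Z i) with
  | Negz 0 => v | _ => 0 end.
apply: (@null_lift _ _ X Z f (-1) h0) => [i hi|i hi u]; last exact: eZ.
case: i hi => [m|[|m]] hi; last by lia.
  by apply: etrans (from_zero _ _) (esym (from_zero _ _)); apply: zX; lia.
by rewrite [h0 (Negz 0 + 1)]from_zero ?lcomp0m ?addr0; [exact: esym hv|apply: zX].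
Qed.

Definition cplx3_ob (X2 X1 X0 : A) (i : int) : A :=
  match i with Posz 0 => X0 | Negz 0 => X1 | Negz 1 => X2 | _ => O end.

Definition cplx3_d (X2 X1 X0 : A) (a : lhom X2 X1) (b : lhom X1 X0) i :
    lhom (cplx3_ob X2 X1 X0 i) (cplx3_ob X2 X1 X0 (i + 1)) :=
  match i return lhom (cplx3_ob X2 X1 X0 i) (cplx3_ob X2 X1 X0 (i + 1)) with
  | Negz 0 => b | Negz 1 => a | _ => 0 end.

Fact cplx3_dd (X2 X1 X0 : A) (a : lhom X2 X1) (b : lhom X1 X0) (ba : b \oL a = 0) i :
  cplx3_d a b (i + 1) \oL cplx3_d a b i = 0.
Proof.
case: i => [m|[|[|m]]]; rewrite /cplx3_d ?lcompm0 ?lcomp0m //.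
Qed.

Fact cplx3_bd (X2 X1 X0 : A) : exists n : int, forall i, n < i -> is_zero (cplx3_ob X2 X1 X0 i).
Proof. by exists 0; case=> [[|m]|m]. Qed.

Definition cplx3 (X2 X1 X0 : A) (a : lhom X2 X1) (b : lhom X1 X0) (ba : b \oL a = 0) : Kminus A :=
  @Cplx k A _ (cplx3_d a b) (cplx3_dd ba) (cplx3_bd X2 X1 X0).

End StalkFacts.

(** * The heart of [T_C] and its projective objects *)

Section HeartC.
Variables (k : comPzRingType) (A : lincat k) (O : A) (hO : is_zero O).
Variable C : A -> Prop.
Hypothesis (CO : C O) (Csplit : idem_split C).
Implicit Types X Y Z : Kminus A.
Local Notation P_ M := (stalk hO M : Kminus A).

Lemma inT_stalk M : C M -> inT C (P_ M).
Proof. by move=> CM; case=> [[|n]|n]. Qed.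

(** The index [-1] is degree [0]. Exactness in negative degrees comes from testing [ge0] on
    complexes concentrated in one degree, and in positive degrees from the representative in [le0];
    [truncate_above] gives the converse. *)
Lemma heartP X : heart C X <-> inT C X /\ forall i : int, i != -1 -> qex C X i.
Proof.
split=> [[[CX [Y [CY zY XY]] [_ geX]]]|[CX eX]].
  split=> // i ni; case: (leP 0 i) => [i0|i0].
    by apply/(qex_isomorphic _ _ XY)/qex_zero/zY; lia.
  move=> N hN u du.
  have [S [Sn Sc SQ]] := concentrated_exists hO N (i + 1 + 1).
  have CS : inT C S by move=> j; case: (SQ j) => ->.
  have leS : le0 C S.
    split=> //; exists S; split=> //; last exact: isomorphic_refl.
    by move=> j hj; apply: Sc; lia.
  have Sc' : concentrated (shift A S) (i + 1) by move=> j hj; apply: Sc; lia.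
  case: _ / Sn {SQ hN} in u du *.
  have [f fu] := conc_map (S := shift A S) Sc' du.
  have /kc_eq0/(conc_null _ Sc')[v hv] := geX S leS (kc f).
  by exists v; rewrite hv.
have [i i0|Y [CY zY XY]] := truncate_above hO CO Csplit CX; first by apply: eX; lia.
split; first by split=> //; exists Y; split.
split=> // W [CW [W' [CW' zW' WW']]] f.
have [g /lisoP[h [hg gh]]] := iso_shift (isomorphic_sym WW').
have [f' hf'] := kcP (f \oL g).
have z : f \oL g = 0.
  rewrite hf'; apply/kc_eq0/(@null_lift0 _ _ (shift A W') X f' (-1)) => [i hi|i hi u].
    by apply: from_zero; apply: zW'; lia.
  by apply: eX; [lia|exact: CW'].
by rewrite -[f]lcompm1 -gh lcompA z lcomp0m.
Qed.

Lemma heart_iso X Y : lisomorphic X Y -> inT C Y -> heart C X -> heart C Y.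
Proof.
move=> XY CY /heartP[CX eX]; apply/heartP; split=> // i ni.
by apply/(qex_isomorphic _ _ XY)/eX.
Qed.

Lemma heart_rep X : heart C X -> exists X', [/\ heart C X',
  forall i : int, 0 < i -> is_zero (X' i) & lisomorphic X X'].
Proof.
move=> hX; have [[CX [X' [CX' zX' XX']]] _] := hX; exists X'; split=> //.
exact: heart_iso hX.
Qed.

Lemma heart_stalk M : C M -> heart C (P_ M).
Proof.
move=> CM; apply/heartP; split; first exact: inT_stalk.
by move=> i ni; apply: qex_zero; apply: stalk_conc; lia.
Qed.

Lemma stalk_cover X : heart C X -> (forall i : int, 0 < i -> is_zero (X i)) ->
  exists p : lhom (P_ (X 0)) X, forall Z (g : lhom X Z), heart C Z -> g \oL p = 0 -> g = 0.
Proof.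
move=> /heartP[CX _] zX.
have [|p hp] := stalk_lift hO (X := X) (u := lid (X 0)).
  by apply: to_zero; apply: zX.
exists (kc p) => Z g /heartP[CZ eZ]; have [g' ->] := kcP g; rewrite kcM.
move=> /kc_eq0/stalk_null[v hv]; apply/kc_eq0.
apply: (@null_below k A C X Z g' v CX zX) => [i hi|]; first by apply: eZ; lia.
by rewrite hv /= hp lcompm1.
Qed.

(** A projective object is a direct summand of the stalk that covers it; the resulting idempotent
    comes from a morphism in [C], where it splits. *)
Lemma proj_heart X : Proj (heart C) X -> exists M, C M /\ lisomorphic X (P_ M).
Proof.
case/ProjP=> hX pX; have [X' [hX' zX' [a /lisoP[b [ba ab]]]]] := heart_rep hX.
have [p hp] := stalk_cover hX' zX'.
have CM : C (X' 0) by case/heartP: hX'.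
have [|s hs] := pX _ _ (b \oL p) (lid X) (heart_stalk CM) hX.
  move=> Z hZ g gbp.
  have zb := hp Z (g \oL b) hZ (etrans (esym (lcompA _ _ _)) gbp).
  by rewrite -[LHS]lcompm1 -ba lcompA zb lcomp0m.
have [q hq] : exists q, q = b \oL p by eexists.
rewrite -hq in hs; have [e he] := stalk_full (s \oL q).
have ee : e \oL e = e.
  apply/eqP; rewrite -subr_eq0; apply/eqP/(stalk_faithful (hO := hO)).
  rewrite -[e \oL e]scale1r -scaleN1r addrC lmap_linear scale1r scaleN1r lmapM -he.
  by rewrite -(lcompA s) (lcompA q) hs lcomp1m addNr.
have [N [j [r [CN rj jr]]]] := Csplit CM ee.
exists N; split=> //.
exists (lmap (stalk hO) r \oL s), (q \oL lmap (stalk hO) j).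
split; rewrite -[LHS]/(_ \oL _).
  rewrite lcompA -(lcompA q) -lmapM jr -he.
  by rewrite !lcompA hs lcomp1m hs.
rewrite lcompA -(lcompA _ s) he -!lmapM -jr.
by rewrite (lcompA r) rj lcomp1m rj lmap1.
Qed.
End HeartC.

Section SerrePairing.
Variables (k : comPzRingType) (E : lmodType k) (A : lincat k).
Variable SA : linfunctor (fullsub (Proj (@heartA k A))) (fullsub (Inj (@heartA k A))).
Local Notation obj P := (proj1_sig P).

(* The Serre duality isomorphisms are all determined by the linear forms
   [eta P], the images of the identities of the objects [S P]. *)
Lemma serre_eta : is_serre E SA ->
  exists eta : forall P, {linear lhom (obj P) (obj (SA P)) -> E},
  [/\ forall P X (g : lhom X (obj (SA P))), heartA X ->
        (forall u : lhom (obj P) X, eta P (g \oL u) = 0) -> g = 0,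
      forall P X (l : {linear lhom (obj P) X -> E}), heartA X ->
        exists g : lhom X (obj (SA P)), forall u, eta P (g \oL u) = l u &
      forall P P' (f : lhom (obj P) (obj P')) (v : lhom (obj P') (obj (SA P))),
        eta P' ((@lmap k _ _ SA P P' f : lhom (obj (SA P)) (obj (SA P'))) \oL v) = eta P (v \oL f)].
Proof.
case=> phi [phiD phi_bij phi_X phi_P].
have hS P : heartA (obj (SA P)) := Inj_sub (proj2_sig (SA P)).

pose eta P := phi P (exist _ _ (hS P)) (lid _).
have etaE P X (hX : heartA X) (g : lhom X (obj (SA P))) u : phi P (exist _ X hX) g u = eta P (g \oL u).
  by rewrite -[g in LHS]lcomp1m (phi_X P (exist _ X hX) (exist _ _ (hS P)) g (lid _) u).
exists eta; split=> [P X g hX hg|P X l hX|P P' f v].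
- have [g0 [_ hg0]] := phi_bij P (exist _ X hX) (lzero E (lhom (obj P) X)).
  rewrite -(hg0 0); first by apply: esym (hg0 g _) => u; rewrite etaE hg.
  by move=> u; rewrite etaE lcomp0m linear0.
- have [g [hg _]] := phi_bij P (exist _ X hX) l.
  by exists g => u; rewrite -hg etaE.
set Sf : lhom (obj (SA P)) (obj (SA P')) := lmap SA _.
have hP' := Proj_sub (proj2_sig P').
have e1 := etaE P' _ hP' (Sf \oL v) (lid (obj P')).
have e2 := etaE P _ hP' v (lid (obj P') \oL f).
rewrite lcompm1 in e1; rewrite lcomp1m in e2; rewrite -e1 -e2.
exact: etrans (phi_P P P' (exist _ _ hP') f v (lid (obj P'))) (congr1 (phi P (exist _ _ hP') v) (lcomp1m f)).
Qed.
End SerrePairing.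

(** * The heart of [T_A] *)

Section HeartA.
Variables (k : comPzRingType) (R : pzRingType) (iota : {rmorphism k -> R}).
Hypothesis hR : is_artin_algebra iota.
Variable E : lmodType k.
Hypothesis hE : injective_hull (quotmod (jacobson k)) E.
Local Notation A := (modR hR).
Local Notation hO := (mod0_zero hR).
Local Notation P_ M := (stalk hO M : Kminus A).
Local Notation all := (fun _ : A => True).
Implicit Types X Y Z : Kminus A.

Lemma app_zero (M : A) : is_zero M -> forall x : proj1_sig M, x = 0.
Proof. by move=> hM x; rewrite -[x]/(app (lid M) x) hM. Qed.

(** Exactness in negative degrees makes [Y^-2 -> Y^-1] a kernel of [Y^-1 -> Y^0], and kernels are
    preserved by [Hom(N, -)] for every [N]. *)
Lemma exact_qex (Y : Kminus A) :
  (forall i : int, (i < - 2%:Z) || (0 < i) -> is_zero (cob Y i)) ->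
  (forall i : int, i + 1 < 0 -> exact_at (cd Y i) (cd Y (i + 1))) ->
  forall i : int, i < -1 -> qex all Y i.
Proof.
move=> zY eY i hi N _ u du.
have [hi3|hi2] := ltP i (-3); first by exists 0; rewrite lcompm0 [u]to_zero //; apply: zY; lia.
have hz : is_zero (Y (-3)) by apply: zY.
have inj2 : forall x, app (cd Y (-3 + 1)) x = 0 -> x = 0.
  move=> x hx; have [z <-] := exact_at_elt (eY (-3) isT) hx.
  by rewrite [z](app_zero hz) raddf0.
have [ei|ni] := eqVneq i (-3).
  subst i; exists 0; rewrite lcompm0; apply: app_ext => x; rewrite app0; apply: esym; apply: inj2.
  by rewrite -app_comp du.
have ei : i = -2 by lia.
subst i; apply: (@factor_inj _ _ _ hR _ _ _ (cd Y (-2)) u) => [x|n]; first exact: inj2.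
apply: (exact_at_elt (eY (-2) isT)); by rewrite -app_comp du.
Qed.

Lemma heartA_rep X : heartA X -> exists Y, [/\ lisomorphic X Y,
  forall i : int, 0 < i -> is_zero (Y i) & forall i : int, i < -1 -> qex all Y i].
Proof.
case=> Y [zY eY XY]; exists Y; split=> //; first by move=> i i0; apply: zY; rewrite i0 orbT.
exact: exact_qex.
Qed.

Lemma heartA_iso X Y : lisomorphic X Y -> heartA X -> heartA Y.
Proof.
move=> XY [Z [zZ eZ XZ]]; exists Z; split=> //.
exact: isomorphic_trans (isomorphic_sym XY) XZ.
Qed.

Lemma heartA_stalk M : heartA (P_ M).
Proof.
exists (P_ M); split; last exact: isomorphic_refl.
  by case=> [[|n]|n] // _; exact: hO.
by case=> [n|[|n]] // _; apply: exact_at_zero; exact: hO.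
Qed.

Lemma heartA_cplx3 (X2 X1 X0 : A) (a : lhom X2 X1) (b : lhom X1 X0) (ba : b \oL a = 0) :
  is_kernel a b -> heartA (cplx3 hO ba).
Proof.
move=> hab; exists (cplx3 hO ba); split; last exact: isomorphic_refl.
  by case=> [[|m]|[|[|m]]] // _; exact: hO.
case=> [m|[|[|[|m]]]] // _.
- exact: exact_at_kernel.
- apply: exact_at_mono => [|T t h]; first exact: hO.
  by apply: (kernel_mono hab); rewrite h lcompm0.
by apply: exact_at_zero; exact: hO.
Qed.

Lemma cplx3_qex (X2 X1 X0 : A) (a : lhom X2 X1) (b : lhom X1 X0) (ba : b \oL a = 0) :
  is_kernel a b -> forall i : int, i < -1 -> qex all (cplx3 hO ba) i.
Proof.
move=> hab; case=> [m|[|[|[|m]]]] // _ N _ u du.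
- by have [v [hv _]] := proj2 hab N u du; exists v.
- exists 0; rewrite lcompm0.
  exact: (@kernel_mono _ _ _ _ _ N a b 0 u hab (etrans (lcompm0 _ _) (esym du))).
by exists 0; rewrite lcompm0 [RHS]to_zero //; exact: hO.
Qed.

(** The cokernel of [e] is represented by [W = [K -> U^0 (+) V^-1 -> V^0]], so for an epimorphism
    [e] the canonical map [V -> W] is null. A null homotopy splits [beta]; the first component of
    the splitting lifts [f] in degree [0], and the second gives the homotopy. *)
Lemma stalk_proj_heartA M : Proj (@heartA k A) (P_ M).
Proof.
apply/ProjP; split=> [|U V e f hU hV he]; first exact: heartA_stalk.
have [U' [[a /lisoP[a' [a'a aa']]] zU eU]] := heartA_rep hU.
have [V' [[b /lisoP[b' [b'b bb']]] zV eV]] := heartA_rep hV.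
have [e' he'] := kcP (b \oL e \oL a').
have [B [i1 [i2 [p1 [p2 bip]]]]] := modR_biprods (hR := hR) (U' 0) (V' (Negz 0)).
pose beta : lhom B (V' 0) := e' 0 \oL p1 + (cd V' (Negz 0) : lhom _ (V' 0)) \oL p2.
have [K [kap hK]] := modR_kernels hE beta.
have ba : beta \oL kap = 0 by case: hK.
pose W := cplx3 hO ba.
have b1 : beta \oL i1 = e' 0.
  by rewrite /beta lcompDl -!lcompA (biprodXX bip) (biprodYX bip) lcompm1 lcompm0 addr0.
have b2 : beta \oL i2 = cd V' (Negz 0).
  by rewrite /beta lcompDl -!lcompA (biprodXY bip) (biprodYY bip) lcompm1 lcompm0 add0r.
pose c0 i : lhom (V' i) (W i) := match i return lhom (V' i) (cplx3_ob (mod0 hR) K B (V' 0) i) with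
  Posz 0 => lid _ | Negz 0 => i2 | _ => 0 end.
have [i hi|i hi u du|c hc] := @ext_map k A V' W (-1) c0.
- case: i hi => [m|[|m]] hi; last by lia.
    have z : is_zero (cplx3_ob (mod0 hR) K B (V' 0) (Posz m + 1)) by rewrite -PoszD addn1; exact: hO.
    by rewrite [LHS](to_zero _ z) [RHS](to_zero _ z).
  by rewrite [RHS]lcomp1m; apply: b2.
- exact: (cplx3_qex hK hi).
have hc0 : c 0 = lid (V' 0) by rewrite hc.
(* The inclusion [i1] of [U' 0] starts a null homotopy of the composite. *)
have ce : kc c \oL b \oL e = 0.
  rewrite -[LHS]lcompm1 -a'a !lcompA -(lcompA _ e) -(lcompA _ b) (lcompA b) he' kcM.
  rewrite (_ : kc _ = 0) ?lcomp0m //; apply/kc_eq0.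
  apply: (@null_below k A all U' W (cmapM c e') i1 (fun=> I) zU (cplx3_qex hK)).
  apply: etrans b1 _; apply: esym; rewrite -[LHS]/(c 0 \oL e' 0) hc0; exact: lcomp1m.
have c_null : is_nullhtpy c.
  apply/kc_eq0; have := he W (heartA_cplx3 ba hK) _ ce => cb.
  by rewrite -[LHS]lcompm1 -bb' lcompA cb lcomp0m.
have [h hh] := c_null.
have s1 : lid (V' 0) = beta \oL h (Negz 0).
  rewrite -hc0 (hh (Negz 0)) [cd V' (Negz 0 + 1)]to_zero ?lcompm0 ?addr0 //; exact: zV.
have [f' hf'] := kcP (b \oL f).
have [|g' hg'] := stalk_lift hO (X := U') (u := p1 \oL h (Negz 0) \oL f' 0).
  by apply: to_zero; apply: zU.
exists (a' \oL kc g').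
have key : b \oL f = b \oL e \oL a' \oL kc g'.
  rewrite hf' he' kcM; apply/kc_eq/stalk_null; exists (p2 \oL h (Negz 0) \oL f' 0).
  have ef : f' 0 = e' 0 \oL (p1 \oL h (Negz 0) \oL f' 0) +
      (cd V' (Negz 0) : lhom _ (V' 0)) \oL (p2 \oL h (Negz 0) \oL f' 0).
    by rewrite -{1}[f' 0]lcomp1m s1 /beta !lcompDl !lcompA.
  rewrite -[RHS]/(f' 0 - e' 0 \oL g' 0) hg' [X in _ = X - _]ef; exact: esym (addKB _ _).
by rewrite -[f]lcomp1m -b'b -lcompA key !lcompA b'b lcomp1m.
Qed.

(** The map [t] is the identity in degrees [-1] and [0]. Maps from stalks see only these two
    degrees, and maps into an object of the heart of [T_A] are determined there up to homotopy. *)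
Lemma tau_exists Y : (forall i : int, 0 < i -> is_zero (Y i)) ->
  exists (T : Kminus A) (t : lhom Y T), [/\ heartA T,
    forall M (x : lhom (P_ M) Y), t \oL x = 0 -> x = 0,
    forall M (x : lhom (P_ M) T), exists y, t \oL y = x &
    forall X (g : lhom Y X), heartA X -> exists g', g' \oL t = g].
Proof.
move=> zY.
have [K [kap hK]] := modR_kernels hE (cd Y (Negz 0) : lhom (Y (Negz 0)) (Y 0)).
have ba : (cd Y (Negz 0) : lhom (Y (Negz 0)) (Y 0)) \oL kap = 0 by case: hK.
pose T := cplx3 hO ba.
pose t0 i : lhom (Y i) (T i) := match i return lhom (Y i) (cplx3_ob (mod0 hR) K (Y (Negz 0)) (Y 0) i) with
  Posz 0 => lid _ | Negz 0 => lid _ | _ => 0 end.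
have [i hi|i hi u du|t ht] := @ext_map k A Y T (-1) t0.
- case: i hi => [m|[|m]] hi; last by lia.
    have z : is_zero (cplx3_ob (mod0 hR) K (Y (Negz 0)) (Y 0) (Posz m + 1)).
      by rewrite -PoszD addn1; exact: hO.
    by rewrite [LHS](to_zero _ z) [RHS](to_zero _ z).
  by rewrite [RHS]lcomp1m [LHS]lcompm1.
- exact: (cplx3_qex hK hi).
have t_0 : t 0 = lid (Y 0) by rewrite ht.
have t_1 : t (Negz 0) = lid (Y (Negz 0)) by rewrite ht.
exists T, (kc t); split=> [|M x|M x|X g hX].
- exact: heartA_cplx3.
- have [x' ->] := kcP x; rewrite kcM => /kc_eq0/stalk_null[v hv].
  apply/kc_eq0/stalk_null; exists v; apply: etrans hv _.
  by rewrite -[LHS]/(t 0 \oL x' 0) t_0; exact: lcomp1m.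
- have [x' ->] := kcP x; have [|y hy] := stalk_lift hO (X := Y) (u := x' 0).
    by apply: to_zero; apply: zY.
  exists (kc y); rewrite kcM; apply/kc_eq/stalk_null; exists 0.
  rewrite lcompm0 -[RHS]/(t 0 \oL y 0 - x' 0) t_0 hy.
  by apply: esym; apply/eqP; rewrite subr_eq0; apply/eqP; exact: lcomp1m.
have [X' [[a /lisoP[a' [a'a aa']]] zX eX]] := heartA_rep hX.
have [g' hg'] := kcP (a \oL g).
pose h0 i : lhom (T i) (X' i) := match i return lhom (cplx3_ob (mod0 hR) K (Y (Negz 0)) (Y 0) i) (X' i) with
  Posz 0 => g' 0 | Negz 0 => g' (Negz 0) | _ => 0 end.
have [i hi|i hi u du|h hh] := @ext_map k A T X' (-1) h0.
- case: i hi => [m|[|m]] hi; last by lia.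
    by apply: etrans (to_zero _ _) (esym (to_zero _ _)); apply: zX; lia.
  exact: (cfunP g' (Negz 0)).
- exact: (eX i hi _ I u du).
exists (a' \oL kc h); rewrite -[RHS]lcomp1m -a'a -lcompA -[RHS]lcompA hg' kcM; congr (a' \oL _).
apply/kc_eq/(@null_lift0 k A Y X' _ (-1)) => [i hi|i hi u]; last exact: (eX i hi _ I).
case: i hi => [[|m]|m] hi; [|by apply: from_zero; apply: zY|lia].
rewrite -[LHS]/(h 0 \oL t 0 - g' 0) t_0 hh //.
by apply/eqP; rewrite subr_eq0; apply/eqP; exact: lcompm1.
Qed.
End HeartA.

(** * Fully faithful functors *)

Definition fully_faithful (A B : Defs.cat) (F : functor A B) : Prop := forall X Y : A,
  (forall f g : hom X Y, fmap F f = fmap F g -> f = g) /\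
  (forall h : hom (F X) (F Y), exists f, fmap F f = h).

Lemma ff_factor (A B D : Defs.cat) (I : functor B D) (F : functor A D) : fully_faithful I ->
  (forall X : A, exists Y : B, isomorphic (I Y) (F X)) ->
  exists G : functor A B, inhabited (natiso (fcomp I G) F).
Proof.
move=> ff es; have inj X Y := proj1 (ff X Y).
pose G0 X := projT1 (cid (es X)).
pose j X : hom (I (G0 X)) (F X) := projT1 (cid (projT2 (cid (es X)))).
have j_iso X : is_iso (j X) := projT2 (cid (projT2 (cid (es X)))).
pose i X := projT1 (cid (j_iso X)).
have ij X : comp (i X) (j X) = idm _ by rewrite /i; case: cid => ? [].
have ji X : comp (j X) (i X) = idm _ by rewrite /i; case: cid => ? [].
pose G1 X Y (f : hom X Y) : hom (G0 X) (G0 Y) :=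
  projT1 (cid (proj2 (ff (G0 X) (G0 Y)) (comp (i Y) (comp (fmap F f) (j X))))).
have G1E X Y (f : hom X Y) : fmap I (G1 X Y f) = comp (i Y) (comp (fmap F f) (j X)).
  by rewrite /G1; case: cid.
have G1nat X Y (f : hom X Y) : comp (j Y) (fmap I (G1 X Y f)) = comp (fmap F f) (j X).
  by rewrite G1E compA ji comp1m.
have G11 X : G1 X X (idm X) = idm _ by apply: inj; rewrite G1E !fmap1 comp1m ij.
have G1M X Y Z (g : hom Y Z) (f : hom X Y) : G1 X Z (comp g f) = comp (G1 Y Z g) (G1 X Y f).
  by apply: inj; rewrite !fmapM !G1E fmapM -!compA (compA (j Y)) ji comp1m.
pose G := @Functor A B G0 G1 G11 G1M.
by exists G; constructor; exact: (@NatIso A D (fcomp I G) F j G1nat j_iso).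
Qed.

Lemma ff_equivalence (A B : Defs.cat) (F : functor A B) : fully_faithful F ->
  (forall Y : B, exists X : A, isomorphic (F X) Y) -> is_equivalence F.
Proof.
move=> ff es; have inj X Y := proj1 (ff X Y).
have [G [e]] := @ff_factor B A B F (fid B) ff es.
exists G; split; constructor=> //.
pose t X : hom (G (F X)) X := projT1 (cid (proj2 (ff (G (F X)) X) (e (F X)))).
have tE X : fmap F (t X) = e (F X) by rewrite /t; case: cid.
have t_nat X Y (f : hom X Y) : comp (t Y) (fmap (fcomp G F) f) = comp (fmap (fid A) f) (t X).
  by apply: inj; rewrite !fmapM !tE; exact: (nt_nat e (fmap F f)).
refine (@NatIso A A (fcomp G F) (fid A) t t_nat _) => X.
have [i [ie ei]] := nt_iso e (F X); have [s hs] := proj2 (ff X (G (F X))) i.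
exists s; split; apply: inj; rewrite fmapM hs tE fmap1; [exact: ie|exact: ei].
Qed.

(** The idempotent [s r] of [F P] comes from an idempotent of [P]; the image under [F] of a
    splitting of the latter is [X]. *)
Lemma retract_ff (k : comPzRingType) (A B : lincat k) (F : linfunctor A B) (P : A) (X : B)
    (s : lhom X (F P)) (r : lhom (F P) X) :
  fully_faithful F -> r \oL s = lid X ->
  (forall e : lhom P P, e \oL e = e -> exists Q (j : lhom Q P) (q : lhom P Q),
    q \oL j = lid Q /\ j \oL q = e) ->
  exists Q, lisomorphic (F Q) X.
Proof.
move=> ff rs split.
have [e he] := proj2 (ff P P) (s \oL r); rewrite -[LHS]/(lmap F (e : lhom P P)) in he.
have ee : (e : lhom P P) \oL e = e.
  apply: (proj1 (ff P P)); rewrite -[LHS]/(lmap F (_ \oL _)) -[RHS]/(lmap F (e : lhom P P)).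
  by rewrite lmapM he -lcompA (lcompA r) rs lcomp1m.
have [Q [j [q [qj jq]]]] := split e ee.
exists Q; exists (r \oL lmap F j), (lmap F q \oL s).
split; rewrite -[LHS]/(_ \oL _).
  by rewrite -lcompA (lcompA s) -he -lmapM -lmapM -jq -(lcompA j) qj lcompm1 qj lmap1.
by rewrite -lcompA (lcompA (lmap F j)) -lmapM jq he -(lcompA s) rs lcompm1.
Qed.

(** * Serre duality on the heart *)

Section PerfectPairing.
Variables (k : comPzRingType) (E : lmodType k).
Hypothesis hE : injective_hull (quotmod (jacobson k)) E.
Hypothesis hk : artinian k.
Variables (K : lincat k) (H : K -> Prop).

Fact postcomp_linear (P U V : K) (f : lhom U V) : linear (fun u : lhom P U => f \oL u).
Proof. by move=> a x y; apply: lcompPr. Qed.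
Definition postcomp (P U V : K) (f : lhom U V) : {linear lhom P U -> lhom P V} :=
  @mklin k (lhom P U) (lhom P V) _ (postcomp_linear f).

(* The pairing [(g, u) |-> et (g u)] identifies [Hom(X, S)] with the dual of
   [Hom(P, X)], for [X] in [H]. *)
Definition perfect (P S : K) (et : {linear lhom P S -> E}) : Prop :=
  (forall X (g : lhom X S), H X -> (forall u, et (g \oL u) = 0) -> g = 0) /\
  (forall X (l : {linear lhom P X -> E}), H X -> exists g : lhom X S, forall u, et (g \oL u) = l u).

Variables (P S : K) (et : {linear lhom P S -> E}).
Hypothesis hp : perfect et.

Lemma perfect_eq X (g g' : lhom X S) : H X -> (forall u, et (g \oL u) = et (g' \oL u)) -> g = g'.
Proof.
move=> HX h; apply/eqP; rewrite -subr_eq0; apply/eqP; apply: (proj1 hp) => // u.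
rewrite lcompBl; apply: etrans (raddfB et _ _) _; apply/eqP; rewrite subr_eq0; apply/eqP; exact: h.
Qed.

(** Through the pairing, extending [f] along [m] becomes extending a form from [Hom(P, U)] to
    [Hom(P, V)]. Here [m] is arbitrary, as required in [KS_null], where it is a differential. *)
Lemma perfect_extend U V (m : lhom U V) (f : lhom U S) : H U -> H V ->
  (forall u : lhom P U, m \oL u = 0 -> et (f \oL u) = 0) -> exists g, g \oL m = f.
Proof.
move=> HU HV hm; have [l hl] := extend hE (m := postcomp P m) (f := et \o postcomp P f) hm.
have [g hg] := proj2 hp V l HV; exists g; apply: perfect_eq => // u.
by rewrite -lcompA hg; apply: hl.
Qed.

Lemma perfect_inj : H P -> H S -> Inj H S.
Proof.
move=> HP HS; apply/InjP; split=> // U V m f HU HV hm; apply: perfect_extend => // u mu.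
by rewrite (hm P HP u mu) lcompm0 linear0.
Qed.

(** A form on [Hom(P, V)] that kills the image of [b] is given by a map [V -> S] that kills [b];
    this map factors through [q] and so kills [u]. Then [farkas] applies. *)
Lemma perfect_exact U V W (b : lhom U V) (q : lhom V W) (u : lhom P V) : H V -> H S ->
  (forall g : lhom V S, g \oL b = 0 -> exists g', g' \oL q = g) -> H U ->
  q \oL u = 0 -> exists v, b \oL v = u.
Proof.
move=> HV HS hq HU qu; apply: (farkas hE hk (f := postcomp P b)) => t ht.
have [g hg] := proj2 hp V t HV; rewrite -hg.
have [|g' <-] := hq g; last by rewrite -lcompA qu lcompm0 linear0.
by apply: (proj1 hp) => // v; rewrite -lcompA hg; apply: ht.
Qed.

Lemma perfect_proj : H P -> H S -> Proj H P.
Proof.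
move=> HP HS; apply/ProjP; split=> // U V e f HU HV he.
(* Exactness at [V] with [q = 0]: a map into [S] that kills the epimorphism [e] is zero. *)
apply: (@perfect_exact U V V e 0 f HV HS _ HU); last by rewrite lcomp0m.
by move=> g ge; exists 0; rewrite lcompm0; apply: esym; apply: (he S).
Qed.
End PerfectPairing.

Section PairingFullyFaithful.
Variables (k : comPzRingType) (E : lmodType k).
Hypothesis hE : injective_hull (quotmod (jacobson k)) E.
Hypothesis hk : artinian k.
Variables (K : lincat k) (H : K -> Prop).

(* The pairings determine the maps [S f], and reflexivity makes [S] fully
   faithful. *)
Lemma perfect_ff (X Y : K) (SX SY : K) (eX : {linear lhom X SX -> E}) (eY : {linear lhom Y SY -> E})
    (Sf : lhom X Y -> lhom SX SY) :
  perfect H eX -> perfect H eY -> H X -> H Y -> H SX -> H SY -> dcc (lhom X Y) ->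
  linear Sf ->
  (forall f (v : lhom Y SX), eY (Sf f \oL v) = eX (v \oL f)) ->
  (forall f g, Sf f = Sf g -> f = g) /\ (forall h, exists f, Sf f = h).
Proof.
move=> pX pY HX HY HSX HSY dXY Slin adj; split=> [f g fg|h].
  apply/eqP; rewrite -subr_eq0; apply/eqP; apply: (reflexive_inj hE hk) => l.
  have [v hv] := proj2 pX Y l HY; rewrite -hv lcompBr.
  apply: etrans (raddfB eX _ _) _; apply/eqP; rewrite subr_eq0; apply/eqP.
  by apply: etrans (esym (adj _ _)) (etrans _ (adj _ _)); rewrite fg.
(* [v l] represents the form [l], so [l |-> eY (h (v l))] is a functional on the dual of
   [Hom(X, Y)]. By reflexivity it is evaluation at some [f], the preimage of [h]. *)
pose v (l : {linear lhom X Y -> E}) : lhom Y SX := projT1 (cid (proj2 pX Y l HY)).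
have vE l u : eX (v l \oL u) = l u by rewrite /v; case: cid.
have [|f hf] := @dcc_reflexive k E hE hk _ dXY (fun l => eY (h \oL v l)).
  move=> a l l' l'' hl; rewrite -linearP -lcompPr; congr (eY (h \oL _)).
  by apply: (perfect_eq pX) => // u; rewrite vE hl lcompPl linearP !vE.
exists f; apply: (perfect_eq pY) => // u; rewrite adj.
pose l := (eX \o mklin (fun a x y => lcompPr u a x y : _ = _) : {linear lhom X Y -> E}).
have -> : eX (u \oL f) = l f by [].
rewrite -hf; congr (eY (h \oL _)); apply: (perfect_eq pX) => // x; exact: vE.
Qed.
End PairingFullyFaithful.

(** * The pairings that define the functor S_C *)

Section SerrePairingOnHeart.
Variables (k : comPzRingType) (R : pzRingType) (iota : {rmorphism k -> R}).
Hypothesis hR : is_artin_algebra iota.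
Variable E : lmodType k.
Hypothesis hE : injective_hull (quotmod (jacobson k)) E.
Local Notation A := (modR hR).
Variable C : A -> Prop.
Hypotheses (Cadd : additive_sub C) (Cfull : strictly_full C) (Ckar : karoubi_closed C).
Local Notation O := (mod0 hR).
Local Notation hO := (mod0_zero hR).
Local Notation hk := (center_artinian hR).
Local Notation P_ M := (stalk hO M : Kminus A).
Local Notation obj P := (proj1_sig P).
Implicit Types X Y Z : Kminus A.

Lemma C_zero : C O.
Proof.
by case: (proj1 Cadd) => Z [zZ CZ]; apply: Cfull CZ; apply: zero_iso => //; exact: hO.
Qed.

Lemma C_split : idem_split C.
Proof.
move=> M CM e ee; have [N [s [r [_ rs sr]]]] := modR_split hE I ee.
have ee' : (lid M - e) \oL (lid M - e) = lid M - e.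
  by rewrite lcompBl lcomp1m lcompBr lcompm1 ee subrr subr0.
have [N' [s' [r' [_ rs' sr']]]] := modR_split hE I ee'.
exists N, s, r; split=> //; apply: (Ckar (Z := M) (Y := N') (iX := s) (iY := s') (pX := r) (pY := r')) => //.
have es' : e \oL s' = 0.
  by rewrite -[s']lcompm1 -rs' lcompA -lcompA (lcompA s') sr' lcompA lcompBr lcompm1 ee subrr lcomp0m.
have es : (lid M - e) \oL s = 0 by rewrite lcompBl lcomp1m -sr -lcompA rs lcompm1 subrr.
split=> //.
- by rewrite -[r]lcomp1m -rs -!lcompA (lcompA s) sr es' lcompm0.
- by rewrite -[r']lcomp1m -rs' -!lcompA (lcompA s') sr' es lcompm0.
by rewrite sr sr' subKD.
Qed.

(** The approximation is the degree [0] component of an approximation of the stalk complex of [M]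
    over the opposite category. *)
Lemma left_approx : @approximating k (op A) C -> forall M : A,
  exists (N : A) (l : lhom M N), C N /\
    forall N', C N' -> forall u : lhom M N', exists v, u = v \oL l.
Proof.
move=> Cop M; pose X : Kminus (op A) := @stalk k (op A) O hO M.
have [Y [f hf]] := Cop X; have [f' ef] := kcP f.
exists (Y 0), (f' 0); split; first exact: (approx_in hf).
move=> N' CN' u.
pose S : Kminus (op A) := @stalk k (op A) O hO N'.
have [h [hh _]] := approx_hom hf (Z := S) (@inT_stalk k (op A) O hO C C_zero N' CN')
  (lmap (@stalk k (op A) O hO) (u : @lhom k (op A) N' M)).
have [h' eh] := kcP h; exists (h' 0).
move: hh; rewrite ef eh kcM => /kc_eq/stalk_null[v].
by rewrite lcomp0m => /esym/eqP; rewrite subr_eq0 => /eqP.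
Qed.

Lemma hsub_exists : heart_proj_sub C.
Proof.
move=> X pX; have [M [CM XM]] := proj_heart hO C_zero C_split pX.
have MX := isomorphic_sym XM.
apply: (Proj_iso MX); last exact: stalk_proj_heartA hE _.
by apply: heartA_iso MX _; apply: heartA_stalk.
Qed.

Variable piC : linfunctor (Kminus A) (Tcat C).
Variable e : forall X, lhom (obj (piC X)) X.
Hypothesis eapp : forall X, is_approximation C (e X).
Hypothesis enat : forall X Y (f : lhom X Y),
  f \oL e X = e Y \oL (lmap piC f : lhom (obj (piC X)) (obj (piC Y))).
Variable SA : linfunctor (fullsub (Proj (@heartA k A))) (fullsub (Inj (@heartA k A))).
Variable eta : forall P, {linear lhom (obj P) (obj (SA P)) -> E}.
Hypothesis eta_inj : forall P X (g : lhom X (obj (SA P))), heartA X ->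
        (forall u : lhom (obj P) X, eta P (g \oL u) = 0) -> g = 0.
Hypothesis eta_surj : forall P X (l : {linear lhom (obj P) X -> E}), heartA X ->
        exists g : lhom X (obj (SA P)), forall u, eta P (g \oL u) = l u.
Hypothesis eta_adj : forall P P' (f : lhom (obj P) (obj P')) (v : lhom (obj P') (obj (SA P))),
        eta P' ((@lmap k _ _ SA P P' f : lhom (obj (SA P)) (obj (SA P'))) \oL v) = eta P (v \oL f).

Local Notation S0 P := (obj (piC (obj (SA P)))).

(** Maps into [piC X] from a complex of [C] concentrated in one degree correspond to maps into [X],
    and those vanish outside degree [0] because [X] lies in the heart of [T_A]. *)
Lemma pi_heart X : heartA X -> heart C (obj (piC X)).
Proof.
move=> hX; apply/(heartP hO C_zero C_split); split; first exact: approx_in (eapp X).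
have [X' [XX' zX eX]] := heartA_rep hX.
move=> i ni N CN u du.
have [S [Sn Sc SQ]] := concentrated_exists hO N (i + 1).
have CS : inT C S by move=> j; case: (SQ j) => -> //; exact: C_zero.
case: _ / Sn {SQ CN} in u du *.
have [f fu] := conc_map (X := obj (piC X)) Sc du.
suff /kc_eq0/(conc_null _ Sc)[v hv] : kc f = 0 by exists v; rewrite hv.
have [h [_ huniq]] := approx_hom (eapp X) CS (0 : lhom S X).
suff z : e X \oL kc f = 0 by rewrite -(huniq _ z); apply: huniq; rewrite lcompm0.
have [a /lisoP[b [ba ab]]] := XX'.
have [g hg] := kcP (a \oL e X \oL kc f).
suff z : kc g = 0 by rewrite -[LHS]lcomp1m -ba -lcompA (lcompA a) hg z lcompm0.
apply/kc_eq0/(conc_null _ Sc).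
have dg : cd X' (i + 1) \oL g (i + 1) = 0.
  by rewrite cfunP [cd S (i + 1)]to_zero ?lcompm0 //; apply: Sc; lia.
have [i0|i0] := leP 0 i.
  exists 0; rewrite lcompm0; apply: esym; apply: to_zero; apply: zX; lia.
have i1 : i < -1 by lia.
exact: (eX i i1 _ I (g (i + 1)) dg).
Qed.

Section Pairing.
Variables (P : fullsub (Proj (@heartA k A))) (M : A).
Hypothesis PM : lisomorphic (obj P) (P_ M).

Lemma eta_inj_le Y (g : lhom Y (obj (SA P))) : le0 C Y ->
  (forall u : lhom (obj P) Y, eta P (g \oL u) = 0) -> g = 0.
Proof.
case=> CY [Y' [_ zY [a /lisoP[b [ba ab]]]]] hg.
have [T [t [hT tinj tsurj tfac]]] := tau_exists hE zY.
have [c /lisoP[d [dc cd']]] := PM.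
have [g' hg'] := tfac _ (g \oL b) (Inj_sub (proj2_sig (SA P))).
suff z : g' = 0 by rewrite -[g]lcompm1 -ba lcompA -hg' z !lcomp0m.
apply: eta_inj => // u; have [y hy] := tsurj M (u \oL d).
have -> : u = t \oL (y \oL c) by rewrite lcompA hy -lcompA dc lcompm1.
by rewrite lcompA hg' -lcompA; apply: hg.
Qed.

Lemma eta_surj_le Y (l : {linear lhom (obj P) Y -> E}) : le0 C Y ->
  exists g : lhom Y (obj (SA P)), forall u, eta P (g \oL u) = l u.
Proof.
case=> CY [Y' [_ zY [a /lisoP[b [ba ab]]]]].
have [T [t [hT tinj tsurj tfac]]] := tau_exists hE zY.
have [c /lisoP[d [dc cd']]] := PM.
pose y (u : lhom (obj P) T) := projT1 (cid (tsurj M (u \oL d))).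
have hy u : t \oL y u = u \oL d by rewrite /y; case: cid.
have t_inj (x x' : lhom (P_ M) Y') : t \oL x = t \oL x' -> x = x'.
  by move=> h; apply/eqP; rewrite -subr_eq0; apply/eqP/tinj; rewrite lcompBr h subrr.
have llin : linear (fun u : lhom (obj P) T => l (b \oL (y u \oL c))).
  move=> r u u'; rewrite -linearP -lcompPr -lcompPl; congr (l (b \oL (_ \oL c))).
  by apply: t_inj; rewrite lcompPr !hy lcompPl.
have [g hg] := eta_surj (mklin llin) hT.
exists (g \oL t \oL a) => u; rewrite -!lcompA; apply: etrans (hg _) _.
rewrite -[LHS]/(l (b \oL (y (t \oL (a \oL u)) \oL c))); congr (l _).
have -> : y (t \oL (a \oL u)) = a \oL u \oL d by apply: t_inj; rewrite hy !lcompA.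
by rewrite -!lcompA dc lcompm1 lcompA ba lcomp1m.
Qed.

Lemma etaC_perfect :
  perfect (le0 C) (eta P \o postcomp (obj P) (e (obj (SA P))) : {linear lhom (obj P) (S0 P) -> E}).
Proof.
split=> [X g HX hg|X l HX].
  have [h [_ huniq]] := approx_hom (eapp (obj (SA P))) (proj1 HX) 0.
  rewrite -(huniq g); first by apply: huniq; rewrite lcompm0.
  by apply: eta_inj_le => // u; rewrite -lcompA; apply: hg.
have [g hg] := eta_surj_le l HX.
have [h [hh _]] := approx_hom (eapp (obj (SA P))) (proj1 HX) g.
by exists h => u; rewrite -hg -hh -lcompA.
Qed.
End Pairing.

(** Projectivity in the heart of [T_C] is read off from the duality by [perfect_proj], since
    [S_C P_M] lies in that heart. *)
Lemma hstalk_exists (M : fullsub C) : Proj (heart C) (P_ (proj1_sig M)).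
Proof.
have hM := stalk_proj_heartA hE (proj1_sig M).
pose P : fullsub (Proj (@heartA k A)) := exist _ _ hM.
have hp := etaC_perfect (P := P) (isomorphic_refl _).
have hp' : perfect (heart C) (eta P \o postcomp (obj P) (e (obj (SA P))) : {linear lhom (obj P) (S0 P) -> E}).
  by split=> X g [lX _]; [apply: (proj1 hp)|apply: (proj2 hp)].
apply: (perfect_proj hE hk hp'); first exact: (heart_stalk hO C_zero C_split (proj2_sig M)).
by apply: pi_heart; apply: Inj_sub (proj2_sig (SA P)).
Qed.

Variable hsub : heart_proj_sub C.
Local Notation PA P := (subincl hsub P : fullsub (Proj (@heartA k A))).
Local Notation SCo P := (obj (preSC piC SA hsub P)).

Definition etC (P : fullsub (Proj (heart C))) : {linear lhom (obj P) (SCo P) -> E} :=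
  eta (PA P) \o postcomp (obj P) (e (obj (SA (PA P)))).

Lemma etC_perfect P : perfect (le0 C) (etC P).
Proof.
have [M [_ PM]] := proj_heart hO C_zero C_split (proj2_sig P).
exact: (@etaC_perfect (PA P) M PM).
Qed.

Lemma etC_heart P : heart C (SCo P).
Proof. by apply: pi_heart; apply: Inj_sub (proj2_sig (SA (PA P))). Qed.

Lemma etC_perfect_heart P : perfect (heart C) (etC P).
Proof. by have [h1 h2] := etC_perfect P; split=> X g [lX _]; [exact: h1|exact: h2]. Qed.

Lemma SC_inj P : Inj (heart C) (SCo P).
Proof.
by apply: (perfect_inj hE (etC_perfect_heart P)); [exact: Proj_sub (proj2_sig P)|exact: etC_heart].
Qed.

Lemma etC_adj P P' (f : lhom (obj P) (obj P')) (v : lhom (obj P') (SCo P)) :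
  etC P' ((@lmap k _ _ (preSC piC SA hsub) P P' f : lhom (SCo P) (SCo P')) \oL v) = etC P (v \oL f).
Proof.
pose Sf : lhom (obj (SA (PA P))) (obj (SA (PA P'))) := @lmap k _ _ SA (PA P) (PA P') f.
rewrite -[LHS]/(eta (PA P') (e _ \oL ((lmap piC Sf : lhom (SCo P) (SCo P')) \oL v))).
rewrite lcompA -enat -lcompA (eta_adj (P := PA P) (P' := PA P') f).
by rewrite -lcompA.
Qed.
End SerrePairingOnHeart.

(** * S_C is an equivalence onto the injective objects *)

Section SerreEquivalence.
Variables (k : comPzRingType) (R : pzRingType) (iota : {rmorphism k -> R}).
Hypothesis hR : is_artin_algebra iota.
Variable E : lmodType k.
Hypothesis hE : injective_hull (quotmod (jacobson k)) E.
Local Notation A := (modR hR).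
Variable C : A -> Prop.
Local Notation hO := (mod0_zero hR).
Local Notation hk := (center_artinian hR).
Local Notation P_ M := (stalk hO M : Kminus A).
Local Notation obj P := (proj1_sig P).
Hypotheses (CO : C (mod0 hR)) (Csplit : idem_split C).
Hypothesis lapp : forall M : A, exists (N : A) (l : lhom M N), C N /\
  forall N', C N' -> forall u : lhom M N', exists v, u = v \oL l.
Hypothesis hstalk : forall M : fullsub C, Proj (heart C) (P_ (obj M)).
Variable S : linfunctor (fullsub (Proj (heart C))) (fullsub (Inj (heart C))).
Variable et : forall P, {linear lhom (obj P) (obj (S P)) -> E}.
Hypothesis et_perfect : forall P, perfect (heart C) (et P).
Hypothesis et_adj : forall P P' (f : lhom (obj P) (obj P')) (v : lhom (obj P') (obj (S P))),
  et P' ((@lmap k _ _ S P P' f : lhom (obj (S P)) (obj (S P'))) \oL v) = et P (v \oL f).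
Implicit Types X Y Z : Kminus A.

Definition stalkP M (CM : C M) : fullsub (Proj (heart C)) :=
  exist _ _ (hstalk (exist _ M CM)).

Lemma dcc_proj X Y : Proj (heart C) X -> Proj (heart C) Y -> dcc (lhom X Y).
Proof.
move=> /(proj_heart hO CO Csplit)[M [_ [a /lisoP[a' [a'a aa']]]]].
move=> /(proj_heart hO CO Csplit)[N [_ [b /lisoP[b' [b'b bb']]]]].
have flin : linear (fun f : lhom M N => b' \oL (lmap (stalk hO) f \oL a)).
  by move=> r f g; rewrite lmap_linear lcompPl lcompPr.
refine (@dcc_surj k (lhom M N) (lhom X Y) (mklin flin) _ (@dcc_hom _ _ _ hR M N)) => w.
have [f hf] := stalk_full (b \oL w \oL a').
exists f; apply: etrans (_ : b' \oL (lmap (stalk hO) f \oL a) = _); first by [].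
by rewrite -hf -!lcompA a'a lcompm1 lcompA b'b lcomp1m.
Qed.

Lemma S_heart P : heart C (obj (S P)).
Proof. exact: Inj_sub (proj2_sig (S P)). Qed.

Lemma S_ff : fully_faithful S.
Proof.
move=> P P'.
have hP := Proj_sub (proj2_sig P); have hP' := Proj_sub (proj2_sig P').
exact: (perfect_ff hE hk (et_perfect P) (et_perfect P') hP hP' (S_heart P) (S_heart P')
  (dcc_proj (proj2_sig P) (proj2_sig P')) (lmap_linear S (X := P) (Y := P')) (@et_adj P P')).
Qed.

(** [enough_injectives] for the differential [X^-1 -> X^0] gives [M0] and [lam], and the
    approximation [M0 -> M] turns [lam] into a form on [Hom(P_M, X)], hence into a map from [X] to
    [S_C P_M]. It is a monomorphism because stalks cover the objects of the heart and [lam] detects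
    the maps into [X^0] that are not boundaries. *)
Lemma heart_embed X : heart C X -> exists M (CM : C M) (m : lhom X (obj (S (stalkP CM)))),
  mono_in (heart C) m.
Proof.
move=> hX; have [X' [hX' zX [a /lisoP[b [ba ab]]]]] := heart_rep hO CO Csplit hX.
have [M0 [lam [lam0 lams]]] := enough_injectives hE (cd X' (Negz 0) : lhom (X' (Negz 0)) (X' 0)).
have [M [l [CM hl]]] := lapp M0.
(* Defined on a representative: a null homotopy changes the degree [0] component by a boundary,
   which [lam] kills. *)
pose phi (u : lhom (P_ M) X') := lam ((krepr u : cmap (P_ M) X') 0 \oL l).
have phiE (f : cmap (P_ M) X') : phi (kc f) = lam (f 0 \oL l).
  have /stalk_null[v hv] : is_nullhtpy (krepr (kc f) - f).
    by apply/kclassP; rewrite kreprK.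
  apply/eqP; rewrite -subr_eq0; apply/eqP; apply: etrans (esym (raddfB lam _ _)) _.
  rewrite -lcompBl; rewrite -[X in X \oL l]/((krepr (kc f) - f) 0 : lhom M (X' 0)) -hv -lcompA.
  exact: lam0.
have phi_lin : linear phi.
  move=> r u u'; have [f ->] := kcP u; have [f' ->] := kcP u'.
  rewrite -[r *: _ + _]kclass_linear -[kclass _]/(kc _) !phiE -linearP -lcompPl; congr (lam (_ \oL _)).
have [g hg] := proj2 (et_perfect (stalkP CM)) X' (mklin phi_lin) hX'.
have {}hg (f : cmap (P_ M) X') : et (stalkP CM) (g \oL kc f) = lam (f 0 \oL l).
  by rewrite hg -phiE.
suff key N (CN : C N) (h : lhom (P_ N) X') : g \oL h = 0 -> h = 0.
  exists M, CM, (g \oL (a : lhom X X')) => Z hZ t.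
  have [Z' [hZ' zZ [c /lisoP[d [dc cd']]]]] := heart_rep hO CO Csplit hZ.
  have [p hp] := stalk_cover hO CO Csplit hZ' zZ => gat.
  have CZ : C (Z' 0) by case/(heartP hO CO Csplit): hZ'.
  have z : a \oL t \oL d = 0.
    by apply: (hp X') => //; apply: (key _ CZ); rewrite !lcompA gat !lcomp0m.
  by rewrite -[t]lcomp1m -ba -[LHS]lcompm1 -dc lcompA -(lcompA b) -(lcompA b) z lcompm0 lcomp0m.
have [h' ->] := kcP h => gh; apply/kc_eq0/stalk_null; apply: lams => w.
have [w' ->] := hl N CN w; rewrite lcompA.
rewrite -[h' 0 \oL w']/(cmapM h' (stalk_cmap hO w') 0) -hg -kcM lcompA gh lcomp0m.
exact: linear0.
Qed.

Lemma stalk_split M (CM : C M) (e : lhom (stalkP CM) (stalkP CM)) : e \oL e = e ->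
  exists Q (j : lhom Q (stalkP CM)) (q : lhom (stalkP CM) Q), q \oL j = lid Q /\ j \oL q = e.
Proof.
move=> ee; have [e' he] := stalk_full (e : lhom (P_ M) (P_ M)).
have ee' : e' \oL e' = e'.
  apply/eqP; rewrite -subr_eq0; apply/eqP/(stalk_faithful (hO := hO)).
  rewrite -[e' \oL e']scale1r -scaleN1r addrC lmap_linear scale1r scaleN1r lmapM -he.
  by apply: etrans (congr1 (fun z => - _ + z) ee) _; rewrite addNr.
have [N [j [q [CN qj jq]]]] := Csplit CM ee'.
exists (stalkP CN), (lmap (stalk hO) j), (lmap (stalk hO) q); split.
  by apply: etrans (esym (lmapM _ _ _)) _; rewrite qj lmap1.
by apply: etrans (esym (lmapM _ _ _)) _; rewrite jq he.
Qed.

Lemma S_inj X : Inj (heart C) X -> exists P, lisomorphic (obj (S P)) X.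
Proof.
move=> hX; have /InjP[hX' injX] := hX.
have [M [CM [m hm]]] := heart_embed hX'.
have [r hr] := injX _ _ m (lid X) hX' (S_heart _) hm.
have [Q [f [g [gf fg]]]] := @retract_ff k _ _ S (stalkP CM) (exist _ X hX) m r S_ff hr (@stalk_split M CM).
by exists Q, f, g; split.
Qed.

Lemma S_equivalence : is_equivalence S.
Proof.
apply: ff_equivalence S_ff _ => -[X hX].
by have [P [f [g [gf fg]]]] := S_inj hX; exists P, f, g; split.
Qed.
End SerreEquivalence.

Lemma lmapB (k : comPzRingType) (A B : lincat k) (F : linfunctor A B) (X Y : A) (f g : lhom X Y) :
  lmap F (f - g) = lmap F f - lmap F g.
Proof. by rewrite -scaleN1r addrC lmap_linear scaleN1r addrC. Qed.

Lemma Kmap_ff (k : comPzRingType) (A B : lincat k) (F : linfunctor A B) :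
  fully_faithful F -> fully_faithful (Kmap F).
Proof.
move=> ff X Y.
have inj U V (f g : lhom U V) : lmap F f = lmap F g -> f = g := proj1 (ff U V) f g.
split=> [f g|h].
  have [f' ->] := kcP (f : lhom (X : Kminus A) Y); have [g' ->] := kcP (g : lhom (X : Kminus A) Y).
  rewrite -[LHS]/(Kmap_map F (kclass f')) -[RHS]/(Kmap_map F (kclass g')) !Kmap_mapE.
  case/kclassP => h hh; apply/kc_eq.
  have [t ht] : exists t : forall i, lhom (X (i + 1)) (Y i), forall i, lmap F (t i) = h i.
    exists (fun i => projT1 (cid (proj2 (ff (X (i + 1)) (Y i)) (h i)))) => i; by case: cid.
  exists t => i; apply: inj; rewrite [RHS]lmapD !lmapM !ht.
  have E : lmap F ((f' - g') (i + 1)) = lmap F (f' (i + 1)) - lmap F (g' (i + 1)).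
    exact: lmapB.
  by apply: etrans E _; exact: hh.
have [h' ->] := kcP (h : lhom (Kmap F X) (Kmap F Y)).
have [t ht] : exists t : forall i, lhom (X i) (Y i), forall i, lmap F (t i) = h' i.
  exists (fun i => projT1 (cid (proj2 (ff (X i) (Y i)) (h' i)))) => i; by case: cid.
have tP i : cd Y i \oL t i = t (i + 1) \oL cd X i.
  by apply: inj; rewrite !lmapM !ht; exact: (cfunP h' i).
exists (kclass (Cmap tP)); apply: etrans (Kmap_mapE _ _) _.
by congr kclass; apply: cmap_ext => i; exact: ht.
Qed.

Lemma ff_comp (A B D : Defs.cat) (G : functor B D) (F : functor A B) :
  fully_faithful G -> fully_faithful F -> fully_faithful (fcomp G F).
Proof.
move=> hG hF X Y; split=> [f g fg|h]; first by apply: (proj1 (hF X Y)); apply: (proj1 (hG _ _)).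
have [g hg] := proj2 (hG _ _) h; have [f hf] := proj2 (hF _ _) g.
by exists f; rewrite /= hf.
Qed.

Lemma kc0 (k : comPzRingType) (A : lincat k) (X Y : Kminus A) : kc (0 : cmap X Y) = 0.
Proof. by apply/kc_eq0; exact: nullhtpy0. Qed.

Section Subcategories.
Variables (k : comPzRingType) (A : lincat k) (C : A -> Prop).

Lemma toK_ff : fully_faithful (toK C).
Proof.
move=> X Y; split=> [f g|h].
  have [f' ->] := kcP (f : lhom (proj1_sig X) (proj1_sig Y)).
  have [g' ->] := kcP (g : lhom (proj1_sig X) (proj1_sig Y)).
  rewrite -[LHS]/(toK_map (kclass f')) -[RHS]/(toK_map (kclass g')) !toK_mapE.
  by case/kclassP => h hh; apply/kc_eq; exists h.
have [h' ->] := kcP (h : lhom (toK_ob X : Kminus (fullsub C)) (toK_ob Y)).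
exists (kclass (@Cmap k A (proj1_sig X) (proj1_sig Y) h' (cfunP h'))).
by apply: etrans (toK_mapE _) _; congr kclass; apply: cmap_ext.
Qed.

Lemma subincl_ff (P Q : A -> Prop) (h : forall X, P X -> Q X) : fully_faithful (subincl h).
Proof. by move=> X Y; split=> [//|f]; exists f. Qed.
End Subcategories.

(** * The extension to complexes *)

Section LocalObjects.
Variables (A : Defs.cat) (W : forall X Y : A, hom X Y -> Prop).

Definition hom_bij (P X Y : A) (w : hom X Y) : Prop :=
  (forall c c' : hom P X, comp w c = comp w c' -> c = c') /\
  (forall b : hom P Y, exists c, comp w c = b).

Variable P : A.
Hypothesis hP : forall X Y (w : hom X Y), W w -> hom_bij P w.

Definition div_map X Y (w : hom X Y) (hw : W w) (b : hom P Y) : hom P X :=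
  projT1 (cid (proj2 (hP hw) b)).

Lemma div_mapK X Y (w : hom X Y) (hw : W w) b : comp w (div_map hw b) = b.
Proof. by rewrite /div_map; case: cid. Qed.

(** [Hom(P, -)] inverts the morphisms of [W], so zigzags act on it, formal inverses by unique
    division. As in the Yoneda lemma, a zigzag that starts at [P] is recovered from its value at the
    identity. *)
Fixpoint zz_eval X Y (a : zigzag W X Y) : hom P X -> hom P Y :=
  match a with
  | zz_map _ _ f => fun b => comp f b
  | zz_inv _ _ _ hw => fun b => div_map hw b
  | zz_comp _ _ _ a a' => fun b => zz_eval a (zz_eval a' b)
  end.

Lemma zz_eval_eq X Y (a b : zigzag W X Y) : zzeq a b -> forall x, zz_eval a x = zz_eval b x.
Proof.
elim=> {X Y a b} //=.
- by move=> X Y a b c _ h _ h' x; rewrite h.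
- by move=> X Y Z a a' b b' _ h _ h' x; rewrite h' h.
- by move=> X Y a x; rewrite comp1m.
- by move=> X Y a x; rewrite comp1m.
- by move=> X Y Z g f x; rewrite compA.
- by move=> X Y w hw x; rewrite comp1m; apply: (proj1 (hP hw)); rewrite div_mapK.
- by move=> X Y w hw x; rewrite div_mapK comp1m.
Qed.

Lemma zz_eval_map X Y (a : zigzag W X Y) (b : hom P X) :
  zzeq (zz_comp a (zz_map W b)) (zz_map W (zz_eval a b)).
Proof.
elim: a b => {X Y} [X Y f|X Y w hw|X Y Z a iha a' iha'] b /=.
- exact/zz_sym/zz_mapM.
- apply: (zz_trans (zz_congr (zz_refl _) (b' := zz_comp (zz_map W w) (zz_map W (div_map hw b))) _)).
    by rewrite -{1}(div_mapK hw b); apply: zz_mapM.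
  apply: zz_trans (zz_assoc _ _ _) _; apply: zz_trans (zz_congr (zz_invl hw) (zz_refl _)) _.
  exact: zz_1l.
apply: zz_trans (zz_sym (zz_assoc _ _ _)) _.
by apply: zz_trans (zz_congr (zz_refl _) (iha' b)) _; apply: iha.
Qed.

Lemma loc_faithful X (f g : hom P X) :
  fmap (loc_functor W) f = fmap (loc_functor W) g -> f = g.
Proof. by move/loc_classP/zz_eval_eq/(_ (idm P)); rewrite /= !compm1. Qed.

Lemma loc_full X (h : @hom (localization W) P X) : exists f : hom P X, fmap (loc_functor W) f = h.
Proof.
exists (zz_eval (loc_repr h) (idm P)); rewrite -[RHS]loc_reprK; apply/loc_classP.
exact: zz_trans (zz_sym (zz_eval_map _ _)) (zz_1r _).
Qed.

Lemma loc_iso_bij X Y (f : hom X Y) : is_iso (fmap (loc_functor W) f) -> hom_bij P f.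
Proof.
case=> g [gf fg]; pose a := loc_repr g.
have /loc_classP {}gf : loc_class (zz_comp a (loc_repr (loc_class (zz_map W f)))) =
  loc_class (zz_map W (idm X)) := gf.
have /loc_classP {}fg : loc_class (zz_comp (loc_repr (loc_class (zz_map W f))) a) =
  loc_class (zz_map W (idm Y)) := fg.
have {}gf := zz_trans (zz_congr (zz_refl _) (zz_sym (loc_repr_class _))) gf.
have {}fg := zz_trans (zz_congr (zz_sym (loc_repr_class _)) (zz_refl _)) fg.
split=> [c c' fc|b].
  by have /= := zz_eval_eq gf c; have /= := zz_eval_eq gf c'; rewrite !comp1m fc => -> ->.
by exists (zz_eval a b); have /= := zz_eval_eq fg b; rewrite comp1m.
Qed.
End LocalObjects.

Section QuasiIsomorphisms.
Variables (k : comPzRingType) (B : lincat k) (Q : B -> Prop).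
Hypothesis Qepi : forall N X Y (e : lhom X Y) (f : lhom N Y), Q N -> epi e ->
  exists g, e \oL g = f.
Hypothesis Qcoker : forall N X Y Z (b : lhom X Y) (q : lhom Y Z) (u : lhom N Y), Q N ->
  is_cokernel q b -> q \oL u = 0 -> exists v, b \oL v = u.

(** [Qepi] and [Qcoker] are the exactness properties of [Hom(N, -)] for a projective [N]; with them
    [Hom(N, -)] commutes with forming cycles modulo boundaries. *)
Lemma qis_weq (X Y : Kminus B) (f : cmap X Y) : qis_cmap f -> weq Q f.
Proof.
move=> hf i N QN.
have [Z [H [Z' [H' [z [q [z' [q' [u [v]]]]]]]]]] := hf i.
move=> [[hz [b [zb hq]]] [hz' [b' [zb' hq']]] fz vq [v' [v'v vv']]].
have {}v'v : (v' : lhom H' H) \oL v = lid H := v'v.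
have {}vv' : (v : lhom H H') \oL v' = lid H' := vv'.
have qepi : epi q.
  move=> T g h gh; have [|c [_ hc]] := proj2 hq T (g \oL q).
    by rewrite -lcompA (proj1 hq) lcompm0.
  by rewrite -(hc g erefl) -(hc h (esym gh)).
have {}vq : (v : lhom H H') \oL q = q' \oL u := vq.
split=> [x dx [y hy]|y dy].
  have [x0 [hx0 _]] := proj2 hz N x dx.
  have ux0 : u \oL x0 = b' \oL y.
    by apply: (kernel_mono hz'); rewrite !lcompA -fz zb' hy -lcompA hx0.
  have qx0 : q \oL x0 = 0.
    rewrite -[q]lcomp1m -v'v -(lcompA v') vq -!lcompA ux0 (lcompA q') (proj1 hq').
    by rewrite lcomp0m lcompm0.
  have [x' hx'] := Qcoker QN hq qx0; exists x'; by rewrite -zb -lcompA hx'.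
have [y0 [hy0 _]] := proj2 hz' N y dy.
have [x0 hx0] := Qepi (v' \oL (q' \oL y0)) QN qepi.
have qd : q' \oL (y0 - u \oL x0) = 0.
  by rewrite lcompBr lcompA -vq -lcompA hx0 lcompA vv' lcomp1m subrr.
have [y' hy'] := Qcoker QN hq' qd.
exists (z \oL x0), y'; split; first by rewrite lcompA (proj1 hz) lcomp0m.
by rewrite lcompA fz -zb' -!lcompA hy' -lcompDr subKD.
Qed.
End QuasiIsomorphisms.

Section ComplexFunctor.
Variables (k : comPzRingType) (A : lincat k) (C : A -> Prop).
Variables (B : lincat k) (F : linfunctor (fullsub C) B).
Local Notation obj P := (proj1_sig P).

Definition T_shift : linfunctor (Tcat C) (Tcat C) :=
  @corestr k (Kminus A) (inT C) (Tcat C) (lfcomp (shift A) (fincl (inT C)))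
    (fun X i => proj2_sig X (i + 1)).

Definition Kfun : linfunctor (Tcat C) (Kminus B) := lfcomp (Kmap F) (toK C).

Lemma Kfun_ff : fully_faithful F -> fully_faithful Kfun.
Proof. by move=> ff; apply: ff_comp; [exact: Kmap_ff|exact: toK_ff]. Qed.

Definition cmapF (X Y : Tcat C) (f : cmap (obj X) (obj Y)) : cmap (Kfun X) (Kfun Y) :=
  @Kmap_cmap k (fullsub C) B F (toK_ob X) (toK_ob Y) (toK_cmap f).

Lemma KfunE (X Y : Tcat C) (f : cmap (obj X) (obj Y)) : lmap Kfun (kc f : lhom X Y) = kc (cmapF f).
Proof.
rewrite -[LHS]/(Kmap_map F (toK_map (kclass f))) toK_mapE; exact: Kmap_mapE.
Qed.

Lemma lmapN (X Y : fullsub C) (f : lhom X Y) : lmap F (- f) = - lmap F f.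
Proof. by rewrite -sub0r lmapB lmap0 sub0r. Qed.

Fact Kfun_shiftP (X : Tcat C) i : cd (cshift (Kfun X)) i \oL lid (Kfun (T_shift X) i) =
  lid (Kfun (T_shift X) (i + 1)) \oL cd (Kfun (T_shift X)) i.
Proof. by rewrite lcompm1 lcomp1m; apply: esym; exact: lmapN. Qed.

Fact Kfun_unshiftP (X : Tcat C) i : cd (Kfun (T_shift X)) i \oL lid (cshift (Kfun X) i) =
  lid (cshift (Kfun X) (i + 1)) \oL cd (cshift (Kfun X)) i.
Proof. by rewrite lcompm1 lcomp1m; exact: lmapN. Qed.

(* The components of [Kfun X[1]] and [(Kfun X)[1]] agree; their differentials
   are only propositionally equal. *)
Definition Kfun_shift (X : Tcat C) : lhom (Kfun (T_shift X)) (shift B (Kfun X)) :=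
  kc (@Cmap k B (Kfun (T_shift X)) (cshift (Kfun X)) _ (@Kfun_shiftP X)).

Lemma Kfun_shift_iso X : liso (Kfun_shift X).
Proof.
apply: (@strict_iso k B (Kfun (T_shift X)) (cshift (Kfun X)) _ (Cmap (@Kfun_unshiftP X))) => i; exact: lcomp1m.
Qed.

Lemma Kfun_shift_nat (X Y : Tcat C) (f : lhom X Y) :
  lmap (shift B) (lmap Kfun f) \oL Kfun_shift X = Kfun_shift Y \oL lmap Kfun (lmap T_shift f).
Proof.
have [f' ->] := kcP (f : lhom (obj X) (obj Y)).
rewrite KfunE kc_shift -[lmap T_shift _]/(lmap (shift A) (kc f')) kc_shift.
rewrite (KfunE (X := T_shift X) (Y := T_shift Y) (cmap_shift f')) !kcM.
by congr kc; apply: cmap_ext => i; rewrite /= lcomp1m lcompm1.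
Qed.

Lemma biprodF (Z X Y : fullsub C) (iX : lhom X Z) (iY : lhom Y Z) (pX : lhom Z X) (pY : lhom Z Y) :
  is_biprod iX iY pX pY -> is_biprod (lmap F iX) (lmap F iY) (lmap F pX) (lmap F pY).
Proof.
case=> h1 h2 h3 h4 h5; split; rewrite -!lmapM ?h1 ?h2 ?h3 ?h4 ?lmap1 ?lmap0 //.
by rewrite -lmapD h5 lmap1.
Qed.

Lemma Kfun_ctri (X Y Z : Tcat C) (u : lhom X Y) (v : lhom Y Z) (w : lhom Z (T_shift X)) :
  @ctri k A (obj X) (obj Y) (obj Z) u v w ->
  ctri (lmap Kfun u) (lmap Kfun v) (Kfun_shift X \oL lmap Kfun w).
Proof.
case=> f [g [h [-> -> -> [iX [pY [bi dZ]]]]]].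
rewrite (KfunE (Y := T_shift X) h) !KfunE /Kfun_shift kcM.
exists (cmapF f), (cmapF g); eexists; split; [by []|by []|by []|].
exists (fun i => @lmap k _ _ F (toK_ob X (i + 1)) (toK_ob Z i) (iX i)).
exists (fun i => @lmap k _ _ F (toK_ob Z i) (toK_ob Y i) (pY i)); split=> i.
  have := @biprodF (toK_ob Z i) (toK_ob X (i + 1)) (toK_ob Y i) (iX i) (g i) (h i) (pY i).
  rewrite /= lcomp1m; apply.
  by have [h1 h2 h3 h4 h5] := bi i; split.
rewrite /= lcomp1m -!lmapM -lmapD -!lmapM -lmapN -lmapD; congr (lmap F _); exact: dZ.
Qed.
End ComplexFunctor.

Lemma bijH_comp (k : comPzRingType) (A : lincat k) (W : Kminus A -> Prop) (X Y Z : Kminus A)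
    (b : lhom Y Z) (a : lhom X Y) : bijH W b -> bijH W a -> bijH W (b \oL a).
Proof.
move=> hb ha P hP; have [ib sb] := hb P hP; have [ia sa] := ha P hP; split=> c.
  by rewrite -lcompA => /ib/ia.
by have [d <-] := sb c; have [d' <-] := sa d; exists d'; rewrite lcompA.
Qed.

Lemma ff_isomorphic (A B : Defs.cat) (F : functor A B) (X Y : A) : fully_faithful F ->
  isomorphic (F X) (F Y) -> isomorphic X Y.
Proof.
move=> ff [a [b [ba ab]]].
have [f hf] := proj2 (ff _ _) a; have [g hg] := proj2 (ff _ _) b.
exists f, g; split; apply: (proj1 (ff _ _)); rewrite fmapM fmap1 hf hg; [exact: ba|exact: ab].
Qed.

Section ConcentratedTests.
Variables (k : comPzRingType) (A : lincat k) (O : A) (hO : is_zero O).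
Variable C : A -> Prop.
Hypothesis CO : C O.
Implicit Types X Y Z : Kminus A.

Lemma qex_conc X i : qex C X i <->
  forall T, concentrated T (i + 1) -> inT C T -> forall f : lhom T X, f = 0.
Proof.
split=> [eX T Tc CT f|h N CN u du].
  have [f' ->] := kcP f; apply/kc_eq0/(conc_null _ Tc); apply: eX; first exact: CT.
  by rewrite cfunP [cd T _]to_zero ?lcompm0 //; apply: Tc; lia.
have [T [Tn Tc TQ]] := concentrated_exists hO N (i + 1).
have CT : inT C T by move=> j; case: (TQ j) => ->.
case: _ / Tn {TQ CN} in u du *.
have [f fu] := conc_map Tc du.
have /kc_eq0/(conc_null _ Tc)[v hv] := h T Tc CT (kc f).
by exists v; rewrite hv.
Qed.

Lemma unshift_conc T i : concentrated T i -> inT C T -> exists T',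
  [/\ concentrated T' (i + 1), inT C T' & lisomorphic (shift A T') T].
Proof.
move=> Tc CT; have [T' [eT iso]] := unshift_exists T; exists T'; split=> // j.
  by have [l ->] := int_pred j => hl; rewrite eT; apply: Tc; lia.
by have [l ->] := int_pred j; rewrite eT; apply: CT.
Qed.

Lemma cone_qex_at X Y Z (u : lhom X Y) (v : lhom Y Z) (w : lhom Z (shift A X)) i :
  ctri u v w -> qex C X (i + 1) -> qex C Y i -> qex C Z i.
Proof.
move=> t eX eY; apply/qex_conc => T Tc CT f.
have wf : w \oL f = 0 by apply: (qex_conc (shift A X) i).1 => //; apply/qex_shift.
have [b <-] := tri_exact3 t wf.
by rewrite ((qex_conc Y i).1 eY T Tc CT b) lcompm0.
Qed.

Hypothesis Csplit : idem_split C.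

(** The cone of a monomorphism of the heart is its cokernel. Beyond the long exact sequence only
    degree [-1], of index [-2], needs an argument: a class there is sent by [w] to the shift of a
    map from an object of the heart to [X] which [u] kills. *)
Lemma heart_cone X Y Z (u : lhom X Y) (v : lhom Y Z) (w : lhom Z (shift A X)) :
  ctri u v w -> mono_in (heart C) u -> heart C X -> heart C Y -> inT C Z -> heart C Z.
Proof.
move=> t hu /(heartP hO CO Csplit)[CX eX] /(heartP hO CO Csplit)[CY eY] CZ.
apply/(heartP hO CO Csplit); split=> // i ni.
have [ei|ni2] := eqVneq i (-2); last first.
  by apply: cone_qex_at t _ _; [apply: eX; lia|exact: eY].
subst i; apply/qex_conc => T Tc CT f.
have [T' [Tc' CT' [s /lisoP[s' [s's ss']]]]] := unshift_conc Tc CT.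
have [h hh] := kshift_full (w \oL f \oL s).
have hT' : heart C T'.
  apply/(heartP hO CO Csplit); split=> // j nj; apply: qex_zero; apply: Tc'; lia.
have uh : u \oL h = 0.
  by apply: kshift_inj; rewrite lmapM hh !lcompA (tri_uw0 t) !lcomp0m lmap0.
have wf : w \oL f = 0.
  by rewrite -[LHS]lcompm1 -ss' lcompA -hh (hu T' hT' h uh) lmap0 lcomp0m.
have [b <-] := tri_exact3 t wf.
by rewrite ((qex_conc Y (-2)).1 (eY (-2) ni) T Tc CT b) lcompm0.
Qed.
End ConcentratedTests.

Lemma weq_sub (k : comPzRingType) (B : lincat k) (Q Q' : B -> Prop) (X Y : Kminus B) (f : cmap X Y) :
  (forall N, Q N -> exists2 N', Q' N' & lisomorphic N N') -> weq Q' f -> weq Q f.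
Proof.
move=> hQ hf i N /hQ[N' QN' [a /lisoP[b [ba ab]]]]; have [h1 h2] := hf i N' QN'.
split=> [x dx [y hy]|y dy].
  have [||x' hx'] := h1 (x \oL b); first by rewrite lcompA dx lcomp0m.
    by exists (y \oL b); rewrite !lcompA hy.
  by exists (x' \oL a); rewrite lcompA hx' -lcompA ba lcompm1.
have [|x [y' [dx hy']]] := h2 (y \oL b); first by rewrite lcompA dy lcomp0m.
exists (x \oL a), (y' \oL a); split; first by rewrite lcompA dx lcomp0m.
by rewrite !lcompA -lcompDl -hy' -lcompA ba lcompm1.
Qed.

Section KmapComposition.
Variables (k : comPzRingType) (A B D : lincat k) (G : linfunctor B D) (F : linfunctor A B).
Implicit Types X Y : Kminus A.

Fact Kmap_compP X i : cd (Kmap (lfcomp G F) X) i \oL lid (Kmap (lfcomp G F) X i) =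
  lid (Kmap (lfcomp G F) X (i + 1)) \oL cd (Kmap G (Kmap F X)) i.
Proof. by rewrite lcompm1 lcomp1m. Qed.

(** The two complexes have the same terms and differentials, with different proofs that these form a
    complex. *)
Definition Kmap_comp X : lhom (Kmap G (Kmap F X)) (Kmap (lfcomp G F) X) :=
  kc (@Cmap k D (Kmap G (Kmap F X)) (Kmap (lfcomp G F) X) _ (Kmap_compP X)).

Lemma Kmap_comp_iso X : liso (Kmap_comp X).
Proof.
have hP i : cd (Kmap G (Kmap F X)) i \oL lid (Kmap (lfcomp G F) X i) =
    lid (Kmap (lfcomp G F) X (i + 1)) \oL cd (Kmap (lfcomp G F) X) i.
  by rewrite lcompm1 lcomp1m.
apply: (@strict_iso k D (Kmap G (Kmap F X)) (Kmap (lfcomp G F) X) _ (Cmap hP)) => i; exact: lcomp1m.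
Qed.

Lemma Kmap_comp_nat X Y (f : lhom X Y) :
  Kmap_comp Y \oL lmap (Kmap G) (lmap (Kmap F) f) = lmap (Kmap (lfcomp G F)) f \oL Kmap_comp X.
Proof.
have [f' ->] := kcP f.
rewrite -[lmap (Kmap F) _]/(Kmap_map F (kclass f')) Kmap_mapE.
rewrite -[lmap (Kmap G) _]/(Kmap_map G (kclass _)) Kmap_mapE.
rewrite -[lmap (Kmap (lfcomp G F)) _]/(Kmap_map (lfcomp G F) (kclass f')) Kmap_mapE.
rewrite -2![kclass _]/(kc _) !kcM; congr kc; apply: cmap_ext => i.
by rewrite /= lcompm1 lcomp1m.
Qed.
End KmapComposition.

Lemma bijH_eq (k : comPzRingType) (A : lincat k) (W : Kminus A -> Prop) (X Y P : Kminus A)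
    (a : lhom X Y) (c c' : lhom P X) : bijH W a -> W P -> a \oL c = a \oL c' -> c = c'.
Proof.
move=> ha hP h; apply/eqP; rewrite -subr_eq0; apply/eqP/(proj1 (ha P hP)).
by rewrite lcompBr h subrr.
Qed.

Section BoundedShift.
Variables (k : comPzRingType) (A : lincat k) (C : A -> Prop).
Variables (B : lincat k) (G : linfunctor (fullsub C) B).
Local Notation obj P := (proj1_sig P).
Local Notation inc X := (subincl (@inTbT k A C) X : Tcat C).
Local Notation Tb_sh := (Tb_shift C).

(* [Tb_shift] and [T_shift] produce the same complex with different membership
   proofs. *)
Definition shift_inc (X : Tbcat C) : lhom (inc (Tb_sh X)) (T_shift C (inc X)) :=
  lid (shift A (obj X) : Kminus A).

Definition Kb_shift (X : Tbcat C) : lhom (Kfun G (inc (Tb_sh X))) (shift B (Kfun G (inc X))) :=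
  Kfun_shift G (inc X) \oL lmap (Kfun G) (shift_inc X).

Lemma Kb_shift_iso X : liso (Kb_shift X).
Proof.
apply: is_isoM (Kfun_shift_iso G (inc X)); apply: (fmap_iso (Kfun G)).
by exists (lid (shift A (obj X) : Kminus A)); split; exact: lcomp1m.
Qed.

Lemma Kb_shift_nat (X Y : Tbcat C) (f : lhom X Y) :
  lmap (shift B) (lmap (Kfun G) (f : lhom (inc X) (inc Y))) \oL Kb_shift X =
  Kb_shift Y \oL lmap (Kfun G) (lmap Tb_sh f : lhom (inc (Tb_sh X)) (inc (Tb_sh Y))).
Proof.
rewrite /Kb_shift lcompA Kfun_shift_nat -!lcompA -!lmapM; congr (_ \oL lmap _ _).
exact: etrans (lcompm1 _) (esym (lcomp1m _)).
Qed.

Lemma Kb_ctri (X Y Z : Tbcat C) (u : lhom X Y) (v : lhom Y Z) (w : lhom Z (Tb_sh X)) :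
  @ctri k A (obj X) (obj Y) (obj Z) u v w ->
  ctri (lmap (Kfun G) (u : lhom (inc X) (inc Y))) (lmap (Kfun G) (v : lhom (inc Y) (inc Z)))
    (Kb_shift X \oL lmap (Kfun G) (w : lhom (inc Z) (inc (Tb_sh X)))).
Proof.
move=> t; rewrite /Kb_shift -lcompA -lmapM.
have -> : shift_inc X \oL (w : lhom (inc Z) (inc (Tb_sh X))) = w by exact: lcomp1m.
exact: (@Kfun_ctri k A C B G (inc X) (inc Y) (inc Z) u v w t).
Qed.
End BoundedShift.

(** * Complexes over the heart and their resolutions *)

Section SerreFunctor.
Variables (k : comPzRingType) (E : lmodType k).
Hypothesis hE : injective_hull (quotmod (jacobson k)) E.
Hypothesis hk : artinian k.
Variables (A : lincat k) (O : A) (hO : is_zero O).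
Variable C : A -> Prop.
Hypothesis (CO : C O) (Csplit : idem_split C).
Hypothesis Cadd : forall X Y, C X -> C Y ->
  exists Z iX iY pX pY, @is_biprod k A Z X Y iX iY pX pY /\ C Z.
Local Notation obj P := (proj1_sig P).
Local Notation P_ M := (stalk hO M : Kminus A).
Local Notation H := (fullsub (heart C)).
Local Notation IP := (subincl (@Proj_sub k _ (heart C))).
Local Notation II := (subincl (@Inj_sub k _ (heart C))).
Local Notation inc X := (subincl (@inTbT k A C) X : Tcat C).
Local Notation Tb_sh := (Tb_shift C).
Local Notation sh := (lmap (shift H)).

Definition heart0 : H := exist _ _ (heart_stalk hO CO Csplit CO).

Lemma heart0_zero : is_zero heart0.
Proof. exact: (lmap_zero (stalk hO) hO). Qed.

(** The biproduct of [X] and [Y] is the cone of the zero map [X[-1] -> Y], whose terms are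
    biproducts chosen in [C]. *)
Lemma heart_biprods : has_biprods H.
Proof.
move=> [X hX] [Y hY].
have [CX eX] := (heartP hO CO Csplit X).1 hX; have [CY eY] := (heartP hO CO Csplit Y).1 hY.
have [X' [eX' isoX]] := unshift_exists X.
have CX' : inT C X' by move=> j; have [i ->] := int_pred j; rewrite eX'.
have [Z [v [w [[iX [pY [bi dZ]]] CZ]]]] := cone_exists Cadd (0 : cmap X' Y) CX' CY.
have iXP i : cd Z i \oL iX i = iX (i + 1) \oL cd (shift A X') i.
  rewrite dZ /= !lcompE (lcompK _ (biprodYX (bi i))) (lcompK _ (biprodXX (bi i))) !lcompE.
  by rewrite !addr0.
have pYP i : cd Y i \oL pY i = pY (i + 1) \oL cd Z i.
  by rewrite dZ /= !lcompE (biprodYX (bi _)) (biprodYY (bi _)) !lcompE oppr0 !add0r.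
pose i' := @Cmap k A (cshift X') Z iX iXP; pose p' := @Cmap k A Z Y pY pYP.
have [a /lisoP[b [ba ab]]] := isoX.
have Zq i : i != -1 -> qex C Z i.
  move=> ni N CN u du.
  have [|s hs] := (qex_isomorphic C i isoX).2 (eX i ni) N CN (w (i + 1) \oL u).
    by rewrite lcompA (cfunP w) -lcompA du lcompm0.
  have [|t ht] := eY i ni N CN (pY (i + 1) \oL u).
    by rewrite lcompA (cfunP p') -lcompA du lcompm0.
  exists (iX i \oL s + v i \oL t).
  rewrite lcompDr !lcompA (cfunP i') (cfunP v) -!lcompA hs ht !lcompA -lcompDl (biprod1 (bi (i + 1))).
  exact: lcomp1m.
have hZ := (heartP hO CO Csplit Z).2 (conj CZ Zq).
exists (exist _ Z hZ), (kc i' \oL b), (kc v), (a \oL kc w), (kc p').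
split.
- rewrite -[LHS]/((a \oL kc w) \oL (kc i' \oL b)) -lcompA (lcompA (kc w)).
  have -> : kc w \oL kc i' = lid _ by rewrite kcM; congr kc; apply: cmap_ext => i; exact: (biprodXX (bi i)).
  by rewrite lcomp1m.
- by apply: etrans (kcM _ _) _; congr kc; apply: cmap_ext => i; exact: (biprodYY (bi i)).
- rewrite -[LHS]/((a \oL kc w) \oL kc v) -lcompA kcM (_ : cmapM w v = 0).
    by rewrite kc0 lcompm0.
  by apply: cmap_ext => i; exact: (biprodXY (bi i)).
- rewrite -[LHS]/(kc p' \oL (kc i' \oL b)) lcompA kcM (_ : cmapM p' i' = 0).
    by rewrite kc0 lcomp0m.
  by apply: cmap_ext => i; exact: (biprodYX (bi i)).
rewrite -[LHS]/((kc i' \oL b) \oL (a \oL kc w) + kc v \oL kc p').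
rewrite -lcompA (lcompA b) ba lcomp1m !kcM -kcD; congr kc; apply: cmap_ext => i; exact: (biprod1 (bi i)).
Qed.

Hypothesis hstalk : forall M : fullsub C, Proj (heart C) (P_ (obj M)).
Variable S : linfunctor (fullsub (Proj (heart C))) (fullsub (Inj (heart C))).
Variable et : forall P, {linear lhom (obj P) (obj (S P)) -> E}.
Hypothesis et_perfect : forall P, perfect (heart C) (et P).
Hypothesis S_ff : fully_faithful S.

Definition projH (N : H) : Prop := Proj (heart C) (obj N).
Definition projK (X : Kminus H) : Prop := forall i, projH (X i).

Lemma projH_epi (N X Y : H) (e : lhom X Y) (f : lhom N Y) : projH N -> epi e ->
  exists g, e \oL g = f.
Proof.
move=> hN; have /ProjP[_ pN] := hN; move/fullsub_epi => he.
exact: (pN (obj X) (obj Y) e f (proj2_sig X) (proj2_sig Y) he).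
Qed.

(** Exactness comes from the pairing with [S N]: the universal property of the cokernel is applied
    to maps into this one object. *)
Lemma projH_coker (N X Y Z : H) (b : lhom X Y) (q : lhom Y Z) (u : lhom N Y) : projH N ->
  is_cokernel q b -> q \oL u = 0 -> exists v, b \oL v = u.
Proof.
move=> hN hq qu; pose P : fullsub (Proj (heart C)) := exist _ (obj N) hN.
have hS : heart C (obj (S P)) := Inj_sub (proj2_sig (S P)).
have [|v hv] := perfect_exact hE hk (et_perfect P) (proj2_sig Y) hS (b := b) (q := q) (u := u) _ (proj2_sig X) qu.
  move=> g gb; have [g' [hg' _]] := proj2 hq (exist _ _ hS) g gb; by exists g'.
by exists v.
Qed.

Lemma qis_bij (P X Y : Kminus H) (w : @hom (Kminus H) X Y) : projK P -> qis w -> hom_bij P w.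
Proof.
move=> hP [f -> /(qis_weq projH_epi projH_coker) hf].
have [inj sur] := weq_bijH (heart_biprods) hf hP; split=> // c c' fc.
apply/eqP; rewrite -subr_eq0; apply/eqP/inj; rewrite lcompBr; apply/eqP; rewrite subr_eq0; exact/eqP.
Qed.

Lemma Diso_bijH (X Y : Kminus H) (f : lhom X Y) :
  is_iso (fmap (Dfun H) f) -> bijH projK f.
Proof.
move=> hf P hP; have [inj sur] := loc_iso_bij (fun X Y w => @qis_bij P X Y w hP) hf.
by split=> // b fb; apply: inj; apply: etrans fb (esym (lcompm0 _ _)).
Qed.

Definition stalkH : linfunctor (fullsub C) H :=
  lfcomp (subincl (@Proj_sub k _ (heart C))) (stalkC hstalk).
Definition serreH : linfunctor (fullsub C) H :=
  lfcomp (subincl (@Inj_sub k _ (heart C))) (lfcomp S (stalkC hstalk)).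
Local Notation TK := (Kfun stalkH).
Local Notation KS := (Kfun serreH).
Local Notation W := projK.

Lemma stalkH_ff : fully_faithful stalkH.
Proof.
move=> M N; split=> [f g fg|h].
  apply/eqP; rewrite -subr_eq0; apply/eqP/(stalk_faithful (hO := hO)).
  by rewrite lmapB; apply/eqP; rewrite subr_eq0; apply/eqP.
by have [f hf] := stalk_full (h : lhom (P_ (obj M)) (P_ (obj N))); exists f; rewrite [RHS]hf.
Qed.

Lemma stalkC_ff : fully_faithful (stalkC hstalk).
Proof. exact: stalkH_ff. Qed.

Lemma serreH_ff : fully_faithful serreH.
Proof. by apply: ff_comp; [exact: subincl_ff|apply: ff_comp S_ff stalkC_ff]. Qed.

Lemma TK_ff : fully_faithful TK. Proof. exact: Kfun_ff stalkH_ff. Qed.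
Lemma KS_ff : fully_faithful KS. Proof. exact: Kfun_ff serreH_ff. Qed.

Lemma TK_proj (X : Tcat C) : W (TK X).
Proof. by move=> i; exact: hstalk. Qed.

Lemma W_shift X : W X -> W (shift H X).
Proof. by move=> h i; apply: h. Qed.

(* By [perfect_extend], a map [Z (i + 1) -> S P] killing the cycles that lift to
   [P] extends along the differential, even though [Z] need not be exact. *)
Lemma KS_null (X : Tcat C) (Z : Kminus H) (f : cmap Z (KS X)) :
  (exists n : int, forall i, i < n -> is_zero (obj X i)) ->
  (forall i (u : lhom (stalkH (toK_ob X (i + 1))) (Z (i + 1))), cd Z (i + 1) \oL u = 0 ->
    exists v, cd Z i \oL v = u) -> is_nullhtpy f.
Proof.
move=> [n hn] eZ; apply: (@null_ext _ _ Z (KS X) f (n - 1)) => [i hi|i hi u ud].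
  apply: to_zero; apply: (lmap_zero serreH); apply: hn; lia.
pose P := stalkC hstalk (toK_ob X (i + 1)).
have [t mt|v hv] := perfect_extend hE (et_perfect P) (m := cd Z (i + 1)) (f := u)
  (proj2_sig (Z (i + 1))) (proj2_sig (Z (i + 1 + 1))); last by exists v.
have [v hv] := eZ i t mt; rewrite -hv.
by apply: etrans (congr1 (et P) (lcompA _ _ _)) _; rewrite [X in X \oL _]ud lcomp0m linear0.
Qed.

(* [KS X] applies [S_C] to the terms of [X], and [e] is a projective resolution
   of it by [Y]: [Y] is the image of [X] under the extension of [S_C]. *)
Definition spair (X Y : Tcat C) : Prop := exists e : lhom (TK Y) (KS X), bijH W e.

Lemma spair_cone (X Y : Tcat C) (e : lhom (TK Y) (KS X)) : bijH W e ->
  exists (Z : Kminus H) (v : lhom (KS X) Z) (w : lhom Z (shift H (TK Y))), ctri e v w /\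
    forall i, qex projH Z i.
Proof.
have [e' ->] := kcP e => he.
have CT : forall U V : H, True -> True -> exists Z iX iY pX pY, @is_biprod k H Z U V iX iY pX pY /\ True.
  move=> U V _ _; have [Z [iX [iY [pX [pY b]]]]] := heart_biprods U V.
  by exists Z, iX, iY, pX, pY.
have [Z [v [w [hc _]]]] := cone_exists CT e' (fun=> I) (fun=> I).
exists Z, (kc v), (kc w); split; first by exists e', v, w.
move=> i; apply: cone_qex hc _.
exact: (bijH_weq (heart0_zero) (hstalk (exist _ O CO)) he).
Qed.

(** K-injectivity of [KS X']: the cone of [e] is acyclic, so it has no maps into [KS X'] or its
    shift, and composition with [e] is bijective. *)
Lemma spair_ext (X Y : Tcat C) (e : lhom (TK Y) (KS X)) (X' : Tcat C) : bijH W e ->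
  (exists n : int, forall i, i < n -> is_zero (obj X' i)) ->
  (forall a : lhom (KS X) (KS X'), a \oL e = 0 -> a = 0) /\
  (forall b : lhom (TK Y) (KS X'), exists a, a \oL e = b).
Proof.
move=> he hX'; have [Z [v [w [t eZ]]]] := spair_cone he.
have null (Z' : Kminus H) (f : lhom Z' (KS X')) : (forall i, qex projH Z' i) -> f = 0.
  have [f' ->] := kcP f => eZ'; apply/kc_eq0/KS_null => // i u; apply: eZ'; exact: hstalk.
split=> [a ae|b].
  by have [c <-] := tri_ext3 t ae; rewrite (null _ c eZ) lcomp0m.
apply: (tri_ext2 t); have /lisoP[s [s1 s2]] := Kfun_shift_iso serreH X'.
rewrite -[LHS]lcomp1m -s2 -lcompA.
have [g hg] := kcP (s \oL (lmap (shift H) b \oL w)).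
rewrite hg (_ : kc g = 0) ?lcompm0 //; apply/kc_eq0/(@KS_null (T_shift C X')).
  have [n hn] := hX'; exists (n - 1) => i hi; apply: hn; lia.
by move=> i u; apply: eZ; exact: hstalk.
Qed.

Lemma spair_unique X Y Y' : spair X Y -> spair X Y' -> lisomorphic Y Y'.
Proof.
move=> [e he] [e' he']; apply: (ff_isomorphic TK_ff).
have [c hc] := proj2 (he' _ (TK_proj Y)) e; have [d hd] := proj2 (he _ (TK_proj Y')) e'.
exists c, d; split.
  apply/eqP; rewrite -subr_eq0; apply/eqP/(proj1 (he _ (TK_proj Y))).
  by rewrite lcompBr lcompA hd hc lcompm1 subrr.
apply/eqP; rewrite -subr_eq0; apply/eqP/(proj1 (he' _ (TK_proj Y'))).
by rewrite lcompBr lcompA hc hd lcompm1 subrr.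
Qed.

Definition bounded (X : Tcat C) : Prop := exists n : int, forall i, i < n -> is_zero (obj X i).
(* [Y] is isomorphic to the image of a bounded complex. *)
Definition good (Y : Tcat C) : Prop := exists2 X, bounded X & spair X Y.

Lemma good_iso Y Y' : lisomorphic Y Y' -> good Y -> good Y'.
Proof.
move=> /isomorphic_sym/(fob_isomorphic TK)[a ha] [X bX [e he]]; exists X => //.
exists (e \oL (a : lhom (TK Y') (TK Y))); apply: bijH_comp he _; exact: iso_bijH ha.
Qed.

Lemma W_unshift : unshift_closed W.
Proof. exact: unshift_entries. Qed.

Lemma good_shift Y : good Y -> good (T_shift C Y).
Proof.
move=> [X [n hn] [e he]]; exists (T_shift C X).
  by exists (n - 1) => i hi; apply: hn; lia.
have /lisoP[s [s1 s2]] := Kfun_shift_iso serreH X.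
exists (s \oL (lmap (shift H) e \oL Kfun_shift stalkH Y)).
apply: bijH_comp; first by apply: iso_bijH; exists (Kfun_shift serreH X).
apply: bijH_comp; last exact: iso_bijH (Kfun_shift_iso _ _).
exact: bijH_shift W_unshift he.
Qed.

Lemma T_unshift (X : Tcat C) : exists X' : Tcat C,
  (forall i, obj X' (i + 1) = obj X i :> A) /\ lisomorphic (T_shift C X') X.
Proof.
have [X' [eX [a [b [ba ab]]]]] := unshift_exists (obj X).
have hX' : inT C X' by move=> j; have [i ->] := int_pred j; rewrite eX; exact: (proj2_sig X).
by exists (exist _ X' hX'); split=> //; exists a, b.
Qed.

Lemma good_unshift Y : good (T_shift C Y) -> good Y.
Proof.
move=> [X [n hn] [e he]]; have [X' [eX isoX]] := T_unshift X.
have [a ha] := fob_isomorphic KS (isomorphic_sym isoX).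
have /lisoP[s [s1 s2]] := Kfun_shift_iso stalkH Y.
have [b hb] := kshift_full (Kfun_shift serreH X' \oL (a : lhom (KS X) _) \oL e \oL s).
exists X'; first by exists (n + 1) => j; have [i ->] := int_pred j => hi; rewrite eX; apply: hn; lia.
exists b => P hP.
have hb' : bijH W (lmap (shift H) b).
  rewrite hb; apply: bijH_comp; last by apply: iso_bijH; exists (Kfun_shift stalkH Y).
  apply: bijH_comp he; apply: bijH_comp; last exact: iso_bijH.
  exact: iso_bijH (Kfun_shift_iso _ _).
have [inj sur] := hb' _ (W_shift hP); split=> [c bc|c].
  by apply: kshift_inj; rewrite lmap0; apply: inj; rewrite -lmapM bc lmap0.
have [d hd] := sur (lmap (shift H) c); have [d' hd'] := kshift_full d.
by exists d'; apply: kshift_inj; rewrite lmapM hd'.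
Qed.

(** The map [Y1 -> Y2] extends to [KS X1 -> KS X2], which by full faithfulness comes from a map
    [X1 -> X2]; by [five], the image of its cone is [Y3]. *)
Lemma good_cone (Y1 Y2 Y3 : Tcat C) (u : lhom Y1 Y2) (v : lhom Y2 Y3) (w : lhom Y3 (T_shift C Y1)) :
  @ctri k A (obj Y1) (obj Y2) (obj Y3) u v w -> good Y1 -> good Y2 -> good Y3.
Proof.
move=> t [X1 [n1 b1] [e1 h1]] [X2 [n2 b2] [e2 h2]].
have [_ sur] := spair_ext h1 (ex_intro _ n2 b2).
have [a ha] := sur (e2 \oL lmap TK u).
have [f hf] := proj2 (KS_ff X1 X2) a.
have [f' ef] := kcP (f : lhom (obj X1) (obj X2)).
have [X3 [v' [w' [hc CX3]]]] := cone_exists Cadd f' (proj2_sig X1) (proj2_sig X2).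
pose X3' : Tcat C := exist _ X3 CX3.
have t' : @ctri k A (obj X1) (obj X2) (obj X3') f (kc v') (kc w').
  by exists f', v', w'.
have T := Kfun_ctri stalkH t; have T' := Kfun_ctri serreH (X := X1) (Y := X2) (Z := X3') t'.
have sq : e2 \oL lmap TK u = lmap KS f \oL e1 by rewrite -ha -hf.
have [c [cv wc]] := tri_map T T' sq.
exists X3'; last by exists c; apply: five W_unshift T T' sq cv wc h1 h2.
exists (Num.min (n1 - 1) n2) => i; rewrite lt_min => /andP[i1 i2].
case: hc => iX [pY [bi _]]; apply: (biprod_zero (bi i)); [apply: b1; lia|exact: b2].
Qed.

Lemma good_cocone (Y1 Y2 Y3 : Tcat C) (u : lhom Y1 Y2) (v : lhom Y2 Y3) (w : lhom Y3 (T_shift C Y1)) :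
  @ctri k A (obj Y1) (obj Y2) (obj Y3) u v w -> good Y2 -> good Y3 -> good Y1.
Proof.
case=> f [g [h [_ _ _ hc]]] g2 g3; apply: good_unshift.
have [Z [v' [w' [hc' CZ]]]] := cone_exists Cadd g (proj2_sig Y2) (proj2_sig Y3).
pose Z' : Tcat C := exist _ Z CZ.
apply: (@good_iso Z'); first by have [a [b ab]] := cone_rotate hc hc'; exists a, b.
by apply: (@good_cone Y2 Y3 Z' (kc g) (kc v') (kc w')) => //; exists g, v', w'.
Qed.

Hypothesis S_inj : forall X, Inj (heart C) X -> exists P, lisomorphic (obj (S P)) X.
Hypothesis S_embed : forall X, heart C X -> exists M (CM : C M)
  (m : lhom X (obj (S (stalkC hstalk (exist _ M CM))))), mono_in (heart C) m.

Definition stalkT M (CM : C M) : Tcat C := exist _ (P_ M) (inT_stalk hO CO CM).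

Lemma stalkT_bounded M (CM : C M) : bounded (stalkT CM).
Proof. by exists 0 => i hi; apply: stalk_conc; lia. Qed.

Lemma projH_stalk (N : H) : projH N ->
  exists2 N', (exists n : fullsub C, N' = stalkH n) & lisomorphic N N'.
Proof.
move=> /(proj_heart hO CO Csplit)[M [CM [a [b [ba ab]]]]].
by exists (stalkH (exist _ M CM)); [eexists|exists a, b].
Qed.

(** A complex [Y] in the heart is its own projective resolution: the stalks of its terms resolve
    [Y], with augmentation [P_(Y^0) -> Y], because [Hom(N, Y)] is exact outside degree [0].
    Composing with the isomorphism to [S_C P_M] gives the required map. *)
Lemma stalk_le0_spair M (CM : C M) (Y : Tcat C) : heart C (obj Y) ->
  (forall i : int, 0 < i -> is_zero (obj Y i)) ->
  lisomorphic (obj Y) (obj (serreH (exist _ M CM))) -> spair (stalkT CM) Y.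
Proof.
move=> hY zY iso.
(* The degree [0] term of [toK_ob (stalkT CM)] is [M] with another proof of membership in [C]. *)
have {iso} [a /lisoP[b [ba ab]]] : lisomorphic (obj Y) (obj (serreH (toK_ob (stalkT CM) 0))).
  suff h CM' : lisomorphic (obj Y) (obj (serreH (exist _ M CM'))) by exact: h.
  by rewrite (Prop_irrelevance CM' CM).
have [CY eY] := (heartP hO CO Csplit _).1 hY.
have [|p hp] := stalk_lift hO (X := obj Y) (u := lid (obj Y 0)).
  by apply: to_zero; apply: zY.
pose e0 : lhom (TK Y 0) (KS (stalkT CM) 0) := a \oL kc p.
pose e i : lhom (TK Y i) (KS (stalkT CM) i) :=
  match i return lhom (TK Y i) (KS (stalkT CM) i) with Posz 0 => e0 | _ => 0 end.
have ff := stalkH_ff.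
have inj (U V : fullsub C) (f g : lhom U V) :
  lmap stalkH f = lmap stalkH g -> f = g := proj1 (ff U V) f g.
have dKS i : cd (KS (stalkT CM)) i = 0 by apply: (lmap0 serreH).
(* The kernel of [Hom(P_n, p)] consists of the boundaries, by the description of null maps from a
   stalk. *)
have pst (n : A) (u : lhom n (obj Y 0)) :
  kc p \oL lmap (stalk hO) u = 0 <-> exists v, cd (obj Y) (Negz 0) \oL v = u.
  rewrite kcM; split=> [/kc_eq0/stalk_null[v hv]|[v hv]].
    by exists v; rewrite hv /= hp lcomp1m.
  by apply/kc_eq0/stalk_null; exists v; rewrite hv /= hp lcomp1m.
have eP i : cd (KS (stalkT CM)) i \oL e i = e (i + 1) \oL cd (TK Y) i.
  rewrite dKS lcomp0m; case: i => [m|[|m]].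
  - rewrite [e (Posz m + 1)]from_zero ?lcomp0m //.
    by apply: (lmap_zero stalkH); apply: zY; lia.
  - have z : kc p \oL lmap (stalk hO) (cd (obj Y) (Negz 0) : lhom (obj Y (Negz 0)) (obj Y 0)) = 0.
      by apply/pst; exists (lid _); rewrite lcompm1.
    rewrite -[RHS]/((a \oL kc p) \oL lmap (stalk hO) (cd (obj Y) (Negz 0) : lhom (obj Y (Negz 0)) (obj Y 0))).
    by rewrite -lcompA z lcompm0.
  by rewrite lcomp0m.
exists (kc (@Cmap k H (TK Y) (KS (stalkT CM)) e eP)); apply: (weq_bijH (heart_biprods)).
apply: weq_sub projH_stalk _ => i N [n ->] {N}; split=> [x dx [y hy]|y dy].
  have [x0 hx] := proj2 (ff n (toK_ob Y (i + 1))) x.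
  have [ei|ni] := eqVneq i (-1).
    subst i; have z : kc p \oL lmap (stalk hO) (x0 : lhom (obj n) (obj Y 0)) = 0.
      rewrite -[LHS]lcomp1m -ba -lcompA (lcompA a).
      have -> : (a \oL kc p) \oL lmap (stalk hO) (x0 : lhom (obj n) (obj Y 0)) = 0.
        by apply: etrans (_ : e0 \oL x = 0); [rewrite -hx|rewrite -[LHS]hy dKS lcomp0m].
      by rewrite lcompm0.
    have [v hv] := (pst _ _).1 z.
    by exists (lmap stalkH (v : lhom n (toK_ob Y (Negz 0)))); rewrite -hx -lmapM; congr (lmap _ _).
  have [|v hv] := eY i ni (obj n) (proj2_sig n) x0.
    apply: (inj n (toK_ob Y (i + 1 + 1)) (cd (obj Y) (i + 1) \oL x0) 0).
    by rewrite lmap0 -[RHS]dx -hx; exact: (lmapM stalkH (cd (toK_ob Y) (i + 1)) x0).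
  exists (lmap stalkH (v : lhom n (toK_ob Y i))).
  by rewrite -hx; apply: etrans (esym (lmapM stalkH (cd (toK_ob Y) i) _)) _; congr (lmap _ _).
have [ei|ni] := eqVneq i (-1); last first.
  exists 0, 0; rewrite !lcompm0 addr0; split=> //; apply: to_zero.
  by apply: (lmap_zero serreH); apply: stalk_conc; lia.
subst i; have [f hf] := kcP (b \oL (y : lhom (P_ (obj n)) _)).
exists (lmap stalkH (f 0 : lhom n (toK_ob Y 0))), 0; split.
  apply: etrans (esym (lmapM stalkH (cd (toK_ob Y) 0) _)) _.
  apply: etrans (lmap0 _ _ _); congr (lmap _ _); apply: to_zero; exact: zY.
rewrite lcompm0 addr0; apply: etrans (_ : a \oL (kc p \oL lmap (stalk hO) (f 0)) = _); last first.
  by rewrite lcompA.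
have -> : kc p \oL lmap (stalk hO) (f 0) = kc f.
  rewrite kcM; apply/kc_eq/stalk_null; exists 0.
  by rewrite lcompm0 -[RHS]/(p 0 \oL f 0 - f 0) hp lcomp1m; exact: esym (subrr _).
by rewrite -hf lcompA ab lcomp1m.
Qed.

Lemma serre_spair M (CM : C M) (Y : Tcat C) :
  lisomorphic (obj Y) (obj (serreH (exist _ M CM))) -> spair (stalkT CM) Y.
Proof.
move=> iso; have hY : heart C (obj Y).
  exact: (heart_iso hO CO Csplit (isomorphic_sym iso) (proj2_sig Y) (proj2_sig (serreH (exist _ M CM)))).
have [Y' [hY' zY' iso']] := heart_rep hO CO Csplit hY.
have CY' : inT C Y' := ((heartP hO CO Csplit Y').1 hY').1.
have [e he] := @stalk_le0_spair M CM (exist _ Y' CY') hY' zY'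
  (isomorphic_trans (isomorphic_sym iso') iso).
have {}iso' : lisomorphic Y (exist _ Y' CY' : Tcat C) by case: iso' => a [b ab]; exists a, b.
have [a ha] := fob_isomorphic TK iso'.
exists (e \oL (a : lhom (TK Y) _)); apply: bijH_comp he _; exact: iso_bijH ha.
Qed.

Lemma spair_null (X Y T : Tcat C) : spair X Y -> bounded X ->
  (forall i (u : lhom (obj X (i + 1)) (obj T (i + 1))), cd (obj T) (i + 1) \oL u = 0 ->
    exists v, cd (obj T) i \oL v = u) -> forall g : lhom T Y, g = 0.
Proof.
move=> [e he] bX eT g; apply: (proj1 (TK_ff T Y)).
apply: etrans (_ : lmap TK g = 0) (esym (lmap0 TK T Y)); apply: (proj1 (he _ (TK_proj T))).
have [f hf] := kcP (e \oL lmap TK g); rewrite hf; apply/kc_eq0; apply: (KS_null f bX) => i u du; have ff := stalkH_ff.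
have [u0 hu] := proj2 (ff (toK_ob X (i + 1)) (toK_ob T (i + 1))) u.
have [|v hv] := eT i u0.
  apply: (proj1 (ff (toK_ob X (i + 1)) (toK_ob T (i + 1 + 1))) (cd (obj T) (i + 1) \oL u0) 0).
  apply: etrans (lmapM stalkH (cd (toK_ob T) (i + 1)) u0) _.
  by apply: etrans (esym (lmap0 _ _ _)); apply: etrans du; rewrite -hu.
exists (lmap stalkH (v : lhom (toK_ob X (i + 1)) (toK_ob T i))); rewrite -hu.
by apply: etrans (esym (lmapM stalkH (cd (toK_ob T) i) _)) _; congr (lmap _ _).
Qed.

(* The vanishing of [Ext^(d+1)(-, Z)] on the heart. *)
Definition vanish (d : int) (Z : Kminus A) : Prop :=
  forall T, inT C T -> (forall i : int, i != d -> qex C T i) -> forall f : lhom T Z, f = 0.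

Lemma vanish_shift d Z T (f : lhom T (shift A Z)) : vanish (d + 1) Z -> inT C T ->
  (forall i : int, i != d -> qex C T i) -> f = 0.
Proof.
move=> hZ CT eT.
have [T' [e' isoT]] := unshift_exists T; have [s /lisoP[s' [s's ss']]] := isoT.
have [h hh] := kshift_full (f \oL s).
have CT' : inT C T' by move=> j; have [i ->] := int_pred j; rewrite e'.
rewrite -[f]lcompm1 -ss' lcompA -hh (hZ T' CT' _ h) ?lmap0 ?lcomp0m // => j nj.
have [i ej] := int_pred j; rewrite ej; apply/qex_shift/(qex_isomorphic C i isoT)/eT; lia.
Qed.

(** The obstruction to extending along a monomorphism is a map from its cokernel [Q] to [Z[1]], an
    element of [Ext^1(Q, Z)]. *)
Lemma vanish0_inj Z : heart C Z -> vanish 0 Z -> Inj (heart C) Z.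
Proof.
move=> hZ vZ; apply/InjP; split=> // U V m f hU hV hm.
have [m' em] := kcP m; have CU := ((heartP hO CO Csplit U).1 hU).1.
have [Q [v [w [hc CQ]]]] := cone_exists Cadd m' CU ((heartP hO CO Csplit V).1 hV).1.
have t : ctri m (kc v) (kc w) by exists m', v, w.
have hQ := heart_cone hO CO Csplit t hm hU hV CQ.
apply: (tri_ext2 t); apply: (@vanish_shift (-1)) => // i ni.
exact: ((heartP hO CO Csplit Q).1 hQ).2.
Qed.

(** Dimension shifting along an embedding of [Z] in some [S_C P_M] with cokernel [Q]. In the base
    case [Z] is injective, hence itself isomorphic to an [S_C P_M]. *)
Lemma vanish_good (d : nat) (Z : Tcat C) : heart C (obj Z) -> vanish d%:Z (obj Z) -> good Z.
Proof.
elim: d Z => [|d IHd] Z hZ vZ.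
  have [P PZ] := S_inj (vanish0_inj hZ vZ).
  have [M [CM [a [b [ba ab]]]]] := proj_heart hO CO Csplit (proj2_sig P).
  have PM : lisomorphic P (stalkC hstalk (exist _ M CM)) by exists a, b.
  have {PM} [c [c' [c'c cc']]] := fob_isomorphic S PM.
  exists (stalkT CM); first exact: stalkT_bounded.
  apply: serre_spair; apply: isomorphic_trans (isomorphic_sym PZ) _; by exists c, c'.
have [M [CM [m hm]]] := S_embed hZ.
pose I0 := serreH (exist _ M CM); have hI : heart C (obj I0) := proj2_sig I0.
have CI : inT C (obj I0) := ((heartP hO CO Csplit _).1 hI).1.
pose I : Tcat C := exist _ _ CI.
have sI : spair (stalkT CM) I by apply: serre_spair; exact: isomorphic_refl.
have [m' em] := kcP m.
have [Q [v [w [hc CQ]]]] := cone_exists Cadd m' (proj2_sig Z) CI.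
have t : ctri m (kc v) (kc w) by exists m', v, w.
have hQ := heart_cone hO CO Csplit t hm hZ hI CQ.
pose Q' : Tcat C := exist _ Q CQ.
apply: (good_cocone (Y1 := Z) (Y2 := I) (Y3 := Q') t).
  by exists (stalkT CM) => //; exact: stalkT_bounded.
apply: IHd => // T CT eT f.
have wf : kc w \oL f = 0.
  by apply: (@vanish_shift d%:Z (obj Z) T) => //; rewrite -PoszD addn1.
have [b <-] := tri_exact3 t wf.
(* [T] is exact outside degree [d + 1 > 0], in particular in degree [0], so it has no nonzero maps
   into [S_C P_M]. *)
rewrite (_ : b = 0) ?lcompm0 //.
apply: (@spair_null (stalkT CM) I (exist _ T CT) sI (stalkT_bounded CM)) => i u du.
have [ei|ni] := eqVneq i (-1); last first.
  by exists 0; rewrite lcompm0; apply: esym; apply: from_zero; apply: stalk_conc; lia.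
by subst i; apply: (eT (-1)) => //; exact: CM.
Qed.

(** * Every bounded complex is, up to isomorphism, the image of a bounded complex *)

Hypothesis hker : has_kernels A.
Variable N0 : nat.
Hypothesis hres : forall M, exists2 n, has_resolution C M n & (n <= N0)%N.

Lemma stalk_good M (CM : C M) : good (stalkT CM).
Proof.
apply: (@vanish_good (N0 + 2) (stalkT CM)); first exact: heart_stalk.
move=> T CT eT f.
(* [T] is exact outside degree [N0 + 3]. Exactness up to degree [N0 + 2] lets it be replaced by a
   complex in degrees [>= N0 + 3 - (N0 + 2) = 1], which has no nonzero maps to a stalk in degree
   [0]. *)
have [|Y [CY zY [a /lisoP[b [ba ab]]]]] := bounded_below (p := (N0 + 2)%:Z + 1) hker hres CT.
  by move=> i hi; apply: eT; lia.
have [g hg] := kcP (f \oL b).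
suff g0 : g = 0 by rewrite -[f]lcompm1 -ba lcompA hg g0 kc0 lcomp0m.
apply: cmap_ext => i; have [i0|i0] := ltP i 1; last by apply: to_zero; apply: stalk_conc; lia.
by apply: from_zero; apply: zY; lia.
Qed.

Section Truncation.
Variable Y : Tcat C.
Hypothesis zY : forall i : int, 0 < i -> is_zero (obj Y i).

(** The terms of the brutal truncation of [Y] to negative degrees. *)
Definition neg_ob (i : int) : A := if i is Negz n then obj Y (Negz n) else O.

Definition neg_d i : lhom (neg_ob i) (neg_ob (i + 1)) :=
  match i return lhom (neg_ob i) (neg_ob (i + 1)) with
  | Negz n.+1 => cd (obj Y) (Negz n.+1) | _ => 0 end.

Fact neg_dd i : neg_d (i + 1) \oL neg_d i = 0.
Proof.
case: i => [m|[|[|m]]]; rewrite /neg_d ?lcompm0 ?lcomp0m //; exact: (cdd (obj Y) (Negz m.+2)).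
Qed.

Fact neg_bd : exists n : int, forall i, n < i -> is_zero (neg_ob i).
Proof. by exists 0; case. Qed.

Definition neg_cplx : Kminus A := Cplx neg_dd neg_bd.

Fact neg_in : inT C neg_cplx.
Proof. by case=> [m|m]; [exact: CO|exact: (proj2_sig Y)]. Qed.

Definition negT : Tcat C := exist _ neg_cplx neg_in.

(** [Y] is a degreewise split extension of its brutal truncation by the stalk of [Y^0], so
    [split_cone] presents [Y[1]] as the cone of a map from the truncation to the shifted stalk. *)
Lemma stalk_neg_good : good negT -> good Y.
Proof.
move=> gT; have C0 : C (obj Y 0) := proj2_sig Y 0.
have [|v hv] := stalk_lift hO (X := obj Y) (u := lid (obj Y 0)); first by apply: to_zero; apply: zY.
pose w0 i : lhom (obj Y i) (neg_cplx i) := match i return lhom (obj Y i) (neg_ob i) with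
  | Negz n => lid _ | Posz n => 0 end.
pose iX i : lhom (neg_cplx i) (obj Y i) := match i return lhom (neg_ob i) (obj Y i) with
  | Negz n => lid _ | Posz n => 0 end.
pose pY i : lhom (obj Y i) (P_ (obj Y 0) i) := match i return lhom (obj Y i) (stalk_ob O (obj Y 0) i) with
  | Posz 0 => lid _ | _ => 0 end.
have wP i : cd neg_cplx i \oL w0 i = w0 (i + 1) \oL cd (obj Y) i.
  case: i => [m|[|m]]; last by rewrite [LHS]lcompm1 [RHS]lcomp1m.
    apply: etrans (to_zero _ _) (esym (to_zero _ _)); rewrite -PoszD addn1; exact: hO.
  by rewrite [LHS]lcomp0m [RHS]lcomp0m.
have bi i : is_biprod (iX i) (v i) (w0 i) (pY i).
  have [[ei|ni]|ni] : (i = 0 \/ 0 < i) \/ i < 0 by lia.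
  - subst i; split; rewrite ?hv ?lcompm0 ?lcomp0m ?lcompm1 ?add0r //.
  - case: i ni => [[|m]|m] // ni.
    have z := zY ni; split; try exact: (etrans (from_zero _ z) (esym (from_zero _ z)));
    exact: (etrans (from_zero _ hO) (esym (from_zero _ hO))).
  case: i ni => [m|m] // _; split; rewrite ?lcompm0 ?lcomp0m ?lcompm1 ?addr0 //.
  by rewrite [v _]from_zero ?lcompm0.
have [f [v' [w' hc]]] := @split_cone k A (P_ (obj Y 0)) (obj Y) neg_cplx v
  (@Cmap k A (obj Y) neg_cplx w0 wP) iX pY bi.
apply: good_unshift.
apply: (good_cone (Y1 := negT) (Y2 := T_shift C (stalkT C0))
  (Y3 := T_shift C Y) (u := kc f) (v := kc v') (w := kc w')) => //; first by exists f, v', w'.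
exact/good_shift/stalk_good.
Qed.
End Truncation.

(** Induction on the length: the truncation, once desuspended, lives again in degrees [<= 0] and is
    shorter by one. *)
Lemma le0_good (m : nat) (Y : Tcat C) : (forall i : int, 0 < i -> is_zero (obj Y i)) ->
  (forall i : int, i <= - m%:Z -> is_zero (obj Y i)) -> good Y.
Proof.
elim: m Y => [|m IHm] Y zY zm.
  have zY' i : is_zero (obj Y i) by have [?|?] := leP i 0; [apply: zm; lia|apply: zY].
  apply: good_iso (stalk_good CO); exists (kc 0 : lhom (P_ O) (obj Y)), (kc 0).
  have zO i : is_zero (stalk_ob O O i) by case: i => [[|j]|j].
  split; apply: etrans (kcM _ _) _; congr kc; apply: cmap_ext => i.
    exact: (etrans (from_zero _ (zO i)) (esym (from_zero _ (zO i)))).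
  exact: (etrans (from_zero _ (zY' i)) (esym (from_zero _ (zY' i)))).
apply: stalk_neg_good => //; have [T' [eT iso]] := T_unshift (negT Y).
apply: (good_iso iso); apply: good_shift; apply: IHm => j.
  have [i ->] := int_pred j => hi; rewrite eT; case: i hi => [n|n] hi; [exact: hO|by lia].
have [i ->] := int_pred j => hi; rewrite eT; case: i hi => [n|n] hi; [exact: hO|].
by apply: zm; lia.
Qed.

Lemma bounded_good (Y : Tcat C) : bounded Y -> good Y.
Proof.
move=> [n hn]; have [N hN] := cbd (obj Y).
have : forall i : int, `|N|%N%:Z < i -> is_zero (obj Y i) by move=> i hi; apply: hN; lia.
elim: `|N|%N Y n hn {hN} => [|m IHm] Y n hn zY.
  by apply: (@le0_good `|n|.+1 Y zY) => i hi; apply: hn; lia.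
apply: good_unshift; apply: (IHm _ (n - 1)) => i hi; [apply: hn; lia|apply: zY; lia].
Qed.

(** * The extension of S_C through the derived category *)

Section Extension.
Variable G1 : functor (Dminus H) (Kminus (fullsub (Proj (heart C)))).
Variable G2 : functor (Kminus (fullsub (Proj (heart C)))) (Tcat C).
Hypothesis hG1 : quasi_inverse (KProj_to_D C) G1.
Hypothesis hG2 : quasi_inverse (T_to_KProj hstalk) G2.
Local Notation F := (extension hstalk S G1 G2).

Definition TKT : linfunctor (Tcat C) (Kminus H) := lfcomp (Kmap IP) (T_to_KProj hstalk).
Definition KST : linfunctor (Tcat C) (Kminus H) :=
  lfcomp (Kmap II) (lfcomp (Kmap S) (T_to_KProj hstalk)).

Lemma TKT_proj (X : Tcat C) : W (TKT X).
Proof. by move=> i; exact: hstalk. Qed.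

(** The quasi-inverses make [TKT (F X)] isomorphic to [KST X] in the derived category. Complexes of
    projectives see quasi-isomorphisms as bijections, so these isomorphisms and their naturality
    lift to the homotopy category. *)
Lemma extension_TKT : exists e : forall X, lhom (TKT (F X)) (KST X),
  (forall X, bijH W (e X)) /\
  forall X Y (f : lhom X Y), e Y \oL lmap TKT (fmap F f) = lmap KST f \oL e X.
Proof.
case: hG1 => _ [q1]; case: hG2 => _ [q2].
pose Z X := G1 (Dfun H (KST X)).
pose t X : hom (TKT (F X)) (Kmap IP (Z X)) := fmap (Kmap IP) (q2 (Z X)).
pose del X : @hom (Dminus H) (TKT (F X)) (KST X) :=
  @comp (Dminus H) (TKT (F X)) (Kmap IP (Z X)) (KST X) (q1 (KST X)) (fmap (Dfun H) (t X)).
have delnat X Y (f : lhom X Y) : comp (del Y) (fmap (Dfun H) (fmap TKT (fmap F f))) =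
    comp (fmap (Dfun H) (fmap KST f)) (del X).
  pose g := fmap G1 (fmap (Dfun H) (fmap KST f)).
  have h2 := nt_nat q2 g; have h1 := nt_nat q1 (fmap (Dfun H) (fmap KST f)).
  have ht : comp (t Y) (fmap TKT (fmap F f)) = comp (fmap (Kmap IP) g) (t X).
    by apply: etrans (esym (fmapM (Kmap IP) _ _)) _; rewrite [X in fmap _ X]h2; exact: (fmapM (Kmap IP)).
  apply: etrans (esym (compA (c := Dminus H) _ _ _)) _.
  apply: etrans (congr1 (comp (q1 (KST Y))) (_ : _ = comp (fmap (Dfun H) (fmap (Kmap IP) g)) (fmap (Dfun H) (t X)))) _.
    by apply: etrans (esym (fmapM (Dfun H) _ _)) _; rewrite [X in fmap _ X]ht; exact: (fmapM (Dfun H)).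
  apply: etrans (compA (c := Dminus H) _ _ _) _.
  by apply: etrans (congr1 (fun z => @comp (Dminus H) _ _ _ z (fmap (Dfun H) (t X))) h1) _;
    exact: esym (compA (c := Dminus H) _ _ _).
have bij X : forall U V (w : @hom (Kminus H) U V), qis w -> hom_bij (TKT X) w.
  by move=> U V w; apply: (qis_bij); exact: TKT_proj.
have ex X : exists e : hom (TKT (F X)) (KST X), fmap (Dfun H) e = del X.
  exact: (loc_full (bij (F X)) (del X)).
pose e X := projT1 (cid (ex X)).
have eE X : fmap (Dfun H) (e X) = del X by rewrite /e; case: cid.
exists e; split=> [X|X Y f].
  apply: (Diso_bijH); rewrite eE.
  apply: is_isoM; last exact: (nt_iso q1).
  by apply: fmap_iso; rewrite /t; apply: (fmap_iso (Kmap IP)); exact: (nt_iso q2).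
apply: (loc_faithful (bij (F X))).
apply: etrans (fmapM (Dfun H) _ _) _; apply: etrans _ (esym (fmapM (Dfun H) _ _)).
by rewrite !eE; exact: delnat.
Qed.

Lemma extension_pairs : exists e : forall X, lhom (TK (F X)) (KS X),
  (forall X, bijH W (e X)) /\
  forall X Y (f : lhom X Y), e Y \oL lmap TK (fmap F f) = lmap KS f \oL e X.
Proof.
have [e [he enat]] := extension_TKT.
pose kT X := Kmap_comp IP (stalkC hstalk) (toK C X) : lhom (TKT X) (TK X).
pose kS X := Kmap_comp II (lfcomp S (stalkC hstalk)) (toK C X) \oL
  lmap (Kmap II) (Kmap_comp S (stalkC hstalk) (toK C X)) : lhom (KST X) (KS X).
have kT_iso X : liso (kT X) by exact: Kmap_comp_iso.
have kS_iso X : liso (kS X).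
  by apply: is_isoM; [apply: (fmap_iso (Kmap II)); exact: Kmap_comp_iso|exact: Kmap_comp_iso].
have kT_nat X Y (f : lhom X Y) : kT Y \oL lmap TKT f = lmap TK f \oL kT X.
  exact: (Kmap_comp_nat IP (stalkC hstalk) (lmap (toK C) f)).
have kS_nat X Y (f : lhom X Y) : kS Y \oL lmap KST f = lmap KS f \oL kS X.
  have h1 := Kmap_comp_nat S (stalkC hstalk) (lmap (toK C) f).
  have h2 := Kmap_comp_nat II (lfcomp S (stalkC hstalk)) (lmap (toK C) f).
  rewrite /kS lcompA -[lmap KS f]/(lmap (Kmap (lfcomp II (lfcomp S (stalkC hstalk)))) (lmap (toK C) f)).
  rewrite -h2 -!lcompA; congr (_ \oL _).
  apply: etrans (esym (lmapM (Kmap II) (Kmap_comp S (stalkC hstalk) (toK C Y))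
    (lmap (Kmap S) (lmap (Kmap (stalkC hstalk)) (lmap (toK C) f))))) _.
  by rewrite h1; exact: (lmapM (Kmap II)).
pose iT X := projT1 (cid (kT_iso X)).
have iTl X : iT X \oL kT X = lid _ by rewrite /iT; case: cid => ? [].
have iTr X : kT X \oL iT X = lid _ by rewrite /iT; case: cid => ? [].
exists (fun X => kS X \oL e X \oL iT (F X)); split=> [X|X Y f].
  apply: bijH_comp; last by apply: iso_bijH; exists (kT (F X)); split; [exact: iTr|exact: iTl].
  by apply: bijH_comp; [exact: iso_bijH|].
rewrite -(lcompA (kS Y \oL e Y)).
have -> : iT (F Y) \oL lmap TK (fmap F f) = lmap TKT (fmap F f) \oL iT (F X).
  rewrite -[LHS]lcompm1 -iTr lcompA -(lcompA (iT _)) -kT_nat !lcompA iTl lcomp1m //.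
by rewrite -(lcompA (kS Y)) (lcompA (e Y)) enat !lcompA kS_nat /kS !lcompA.
Qed.
End Extension.

(** * The restriction to bounded complexes *)

Section Restrictions.
Variable F : functor (Tcat C) (Tcat C).
Variable e : forall X, lhom (TK (F X)) (KS X).
Hypothesis e_bij : forall X, bijH W (e X).
Hypothesis e_nat : forall X Y (f : lhom X Y),
  e Y \oL lmap TK (fmap F f) = lmap KS f \oL e X.

Lemma inc_bounded (X : Tbcat C) : bounded (inc X).
Proof. exact: (proj2 (proj2_sig X)). Qed.

(** As [KS X] vanishes in low degrees, [Hom(N, Y)] is exact there, and the bounded [C]-resolutions
    provide a bounded representative of [Y]. *)
Lemma spair_bounded (X Y : Tcat C) : spair X Y -> bounded X ->
  exists Y' : Tbcat C, lisomorphic (inc Y') Y.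
Proof.
case=> a ha [n hn]; have [a' ea] := kcP a; rewrite ea in ha.
have hw := bijH_weq (heart0_zero) (hstalk (exist _ O CO)) ha.
have eY i : i + 1 < n -> qex C (obj Y) i.
  move=> hi N CN u du; have ff := stalkH_ff.
  pose n0 : fullsub C := exist _ N CN.
  have [h1 _] := hw i (stalkH n0) (hstalk n0).
  have [||x hx] := h1 (lmap stalkH (u : lhom n0 (toK_ob Y (i + 1)))).
  - apply: etrans (esym (lmapM stalkH (cd (toK_ob Y) (i + 1)) _)) _.
    by apply: etrans (lmap0 stalkH n0 (toK_ob Y (i + 1 + 1))); congr (lmap _ _).
  - exists 0; rewrite lcompm0; apply: esym; apply: to_zero.
    by apply: (lmap_zero serreH); apply: hn.
  have [v hv] := proj2 (ff n0 (toK_ob Y i)) x; exists v.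
  apply: (proj1 (ff n0 (toK_ob Y (i + 1))) (cd (toK_ob Y) i \oL v) u).
  by rewrite -[RHS]hx -hv; exact: (lmapM stalkH (cd (toK_ob Y) i)).
have [Y' [CY' zY' [b [c [cb bc]]]]] := bounded_below hker hres (proj2_sig Y) eY.
have bY' : inTb C Y' by split=> //; exists (n - (N0%:Z + 2)).
by exists (exist _ Y' bY'); exists c, b.
Qed.

Lemma restriction_exists : exists Sb : functor (Tbcat C) (Tbcat C), restricts_to F Sb.
Proof.
apply: (ff_factor (@subincl_ff k _ _ _ (@inTbT k A C)) (F := fcomp F (subincl (@inTbT k A C)))) => X.
exact: spair_bounded (ex_intro _ _ (e_bij (inc X))) (inc_bounded X).
Qed.

Section Restriction.
Variable Sb : functor (Tbcat C) (Tbcat C).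
Hypothesis hSb : restricts_to F Sb.

Lemma restriction_pairs : exists b : forall X, lhom (TK (inc (Sb X))) (KS (inc X)),
  (forall X, bijH W (b X)) /\
  forall X Y (f : lhom X Y),
    b Y \oL lmap TK (fmap Sb f : lhom (inc (Sb X)) (inc (Sb Y))) =
    lmap KS (f : lhom (inc X) (inc Y)) \oL b X.
Proof.
have [j] := hSb.
exists (fun X => e (inc X) \oL lmap TK (j X : lhom (inc (Sb X)) (F (inc X)))); split=> [X|X Y f].
  by apply: bijH_comp (e_bij _) _; apply: iso_bijH; apply: (fmap_iso TK); exact: (nt_iso j).
rewrite -lcompA -lmapM (_ : _ \oL _ =
    (fmap F (f : lhom (inc X) (inc Y)) : lhom (F (inc X)) (F (inc Y))) \oL (j X : lhom (inc (Sb X)) (F (inc X)))).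
  by rewrite lmapM lcompA e_nat lcompA.
exact: (nt_nat j f).
Qed.

Variable b : forall X, lhom (TK (inc (Sb X))) (KS (inc X)).
Hypothesis b_bij : forall X, bijH W (b X).
Hypothesis b_nat : forall X Y (f : lhom X Y),
    b Y \oL lmap TK (fmap Sb f : lhom (inc (Sb X)) (inc (Sb Y))) =
    lmap KS (f : lhom (inc X) (inc Y)) \oL b X.
Local Notation sgT := (Kb_shift stalkH).
Local Notation sgS := (Kb_shift serreH).

Lemma TK_inj (U V : Tcat C) (f g : lhom U V) : lmap TK f = lmap TK g -> f = g.
Proof. exact: (proj1 (TK_ff U V)). Qed.

Lemma pair_inj (Y P : Tcat C) Z (a : lhom (TK Y) Z) (f g : lhom P Y) : bijH W a ->
  a \oL lmap TK f = a \oL lmap TK g -> f = g.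
Proof. by move=> ha /(bijH_eq ha (TK_proj P))/TK_inj. Qed.

Lemma pair_iso (Y Y' : Tcat C) Z (a : lhom (TK Y) Z) (a' : lhom (TK Y') Z) (t : lhom Y Y') :
  bijH W a -> bijH W a' -> a' \oL lmap TK t = a -> liso t.
Proof.
move=> ha ha' at_; have [c hc] := proj2 (ha _ (TK_proj Y')) a'.
have [s hs] := proj2 (TK_ff Y' Y) c; rewrite -hs -[fmap _ _]/(lmap TK s) in hc.
exists s; split; [apply: (pair_inj ha)|apply: (pair_inj ha')].
  by rewrite lmapM lcompA hc at_ lmap1 lcompm1.
by rewrite lmapM lcompA at_ hc lmap1 lcompm1.
Qed.

Lemma Sb_additive (X Y : Tbcat C) (f g : lhom X Y) :
  fmap Sb (f + g : lhom X Y) = (fmap Sb f : lhom (Sb X) (Sb Y)) + fmap Sb g :> lhom (Sb X) (Sb Y).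
Proof.
apply: (@pair_inj (inc (Sb Y)) (inc (Sb X)) _ (b Y)) => //.
rewrite b_nat (lmapD TK (fmap Sb f : lhom (inc (Sb X)) (inc (Sb Y))) (fmap Sb g)).
rewrite lcompDr !b_nat -lcompDl; congr (_ \oL _); exact: (lmapD KS (X := inc X) (Y := inc Y)).
Qed.

Lemma Sb_ff : fully_faithful Sb.
Proof.
move=> X Y; have [inj sur] := spair_ext (b_bij X) (inc_bounded Y).
split=> [f g fg|h].
  apply: (proj1 (KS_ff (inc X) (inc Y))); apply/eqP; rewrite -subr_eq0; apply/eqP.
  by apply: inj; rewrite lcompBl -!b_nat fg subrr.
have [a ha] := sur (b Y \oL lmap TK (h : lhom (inc (Sb X)) (inc (Sb Y)))).
have [f hf] := proj2 (KS_ff (inc X) (inc Y)) a.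
exists f; apply: (@pair_inj (inc (Sb Y)) (inc (Sb X)) _ (b Y)) => //.
by rewrite b_nat -ha -hf.
Qed.

Lemma Sb_surj (Y : Tbcat C) : exists X : Tbcat C, isomorphic (Sb X) Y.
Proof.
have [[X hX] bX sXY] := bounded_good (inc_bounded Y).
pose X' : Tbcat C := exist _ X (conj hX bX).
have sX : spair (inc X') (inc Y) by rewrite /= (Prop_irrelevance (inTbT _) hX).
have sX' : spair (inc X') (inc (Sb X')) by exists (b X').
by have [a [c [ca ac]]] := spair_unique sX' sX; exists X', a, c.
Qed.

Lemma Sb_equivalence : is_equivalence Sb.
Proof. exact: ff_equivalence Sb_ff Sb_surj. Qed.

Lemma shift_pair X : bijH W (sh (b X) \oL sgT (Sb X)).
Proof.
apply: bijH_comp; last exact: iso_bijH (Kb_shift_iso _ _).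
exact: bijH_shift W_unshift (b_bij X).
Qed.

Lemma pair_shift X : bijH W (sgS X \oL b (Tb_sh X)).
Proof. by apply: bijH_comp (b_bij _); exact: iso_bijH (Kb_shift_iso _ _). Qed.

(** [Sb (X[1])] and [(Sb X)[1]] both give resolutions of the shift of [KS X]; their comparison is
    the isomorphism that makes [Sb] commute with the shift. *)
Lemma theta_exists X : exists t : lhom (Sb (Tb_sh X)) (Tb_sh (Sb X)),
  sh (b X) \oL sgT (Sb X) \oL lmap TK (t : lhom (inc (Sb (Tb_sh X))) (inc (Tb_sh (Sb X)))) =
  sgS X \oL b (Tb_sh X).
Proof.
have [c hc] := proj2 (shift_pair X (TK_proj (inc (Sb (Tb_sh X))))) (sgS X \oL b (Tb_sh X)).
have [t ht] := proj2 (TK_ff (inc (Sb (Tb_sh X))) (inc (Tb_sh (Sb X)))) c.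
by exists t; rewrite -hc -ht.
Qed.

Lemma Tb_cone (X Y : Tbcat C) (u : lhom X Y) :
  exists (Z : Tbcat C) (v : lhom Y Z) (w : lhom Z (Tb_sh X)), @ctri k A (obj X) (obj Y) (obj Z) u v w.
Proof.
have [f ef] := kcP (u : lhom (obj X) (obj Y)).
have [CX [n1 b1]] := proj2_sig X; have [CY [n2 b2]] := proj2_sig Y.
have [Z [v [w [hc CZ]]]] := cone_exists Cadd f CX CY.
have bZ : inTb C Z.
  split=> //; exists (Num.min (n1 - 1) n2) => i; rewrite lt_min => /andP[i1 i2].
  case: hc => iX [pY [bi _]]; apply: (biprod_zero (bi i)); [apply: b1; lia|exact: b2].
by exists (exist _ Z bZ), (kc v), (kc w), f, v, w.
Qed.

(** The triangle of cones in the definition of [distinguished] may be unbounded. It is replaced by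
    the cone of a representative of [u], which is bounded, with identities on [X] and [Y]. *)
Lemma cone_in_Tb (X Y Z : Tbcat C) (u : lhom X Y) (v : lhom Y Z) (w : lhom Z (Tb_sh X)) :
  @distinguished k A (obj X) (obj Y) (obj Z) u v w ->
  exists (Z0 : Tbcat C) (v0 : lhom Y Z0) (w0 : lhom Z0 (Tb_sh X)) (c : lhom Z Z0),
    [/\ @ctri k A (obj X) (obj Y) (obj Z0) u v0 w0, liso c, c \oL v = v0 & w0 \oL c = w].
Proof.
move=> /ctri_distinguished[X' [Y' [Z' [u' [v' [w' [a [b' [c [t [ia ib [c' [c'c cc']]] [e1 e2 e3]]]]]]]]]]].
have [Z0 [v0 [w0 t0]]] := Tb_cone u.
have [d [[d' [d'd dd']] dv wd]] := tri_iso t0 t e1 ia ib.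
have {}d'd : (d' : lhom Z' (obj Z0)) \oL d = lid (obj Z0) := d'd.
have {}dd' : (d : lhom (obj Z0) Z') \oL d' = lid Z' := dd'.
have {}c'c : (c' : lhom Z' (obj Z)) \oL c = lid (obj Z) := c'c.
have {}cc' : (c : lhom (obj Z) Z') \oL c' = lid Z' := cc'.
exists Z0, v0, w0, ((d' : lhom Z' (obj Z0)) \oL c); split=> //.
- exists ((c' : lhom Z' (obj Z)) \oL d); split.
    apply: etrans (_ : c' \oL (d \oL d') \oL c = _); last by rewrite dd' lcompm1 c'c.
    by rewrite -[LHS]/((c' \oL d) \oL (d' \oL c)) !lcompA.
  apply: etrans (_ : d' \oL (c \oL c') \oL d = _); last by rewrite cc' lcompm1 d'd.
  by rewrite -[LHS]/((d' \oL c) \oL (c' \oL d)) !lcompA.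
- rewrite -[LHS]/((d' \oL c) \oL (v : lhom (obj Y) (obj Z))) -lcompA e2 -dv lcompA d'd; exact: lcomp1m.
have /lisoP[s [sa _]] : liso (lmap (shift A) a) := fmap_iso (shift A) ia.
have key : lmap (shift A) a \oL ((w0 : lhom (obj Z0) (shift A (obj X))) \oL (d' \oL c)) = lmap (shift A) a \oL w.
  by rewrite e3 !lcompA -wd -(lcompA w') dd' lcompm1.
rewrite -[LHS]/((w0 : lhom (obj Z0) (shift A (obj X))) \oL (d' \oL c)) -[LHS]lcomp1m -sa -lcompA key lcompA sa.
exact: lcomp1m.
Qed.

Lemma Sb_triangulated : is_triangulated Sb.
Proof.
split; first exact: Sb_additive.
pose th X : hom (Sb (Tb_sh X)) (Tb_sh (Sb X)) := projT1 (cid (theta_exists X)).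
pose t X : lhom (inc (Sb (Tb_sh X))) (inc (Tb_sh (Sb X))) := th X.
have thE X : sh (b X) \oL sgT (Sb X) \oL lmap TK (t X) = sgS X \oL b (Tb_sh X).
  by rewrite /t /th; case: cid.
have th_iso X : is_iso (th X).
  have [s [s1 s2]] := @pair_iso (inc (Sb (Tb_sh X))) (inc (Tb_sh (Sb X))) _ _ _ _ (pair_shift X) (shift_pair X) (thE X).
  by exists s; split; [exact: s1|exact: s2].
have th_nat X Y (f : lhom X Y) :
    comp (th Y) (fmap (fcomp Sb Tb_sh) f) = comp (fmap (fcomp Tb_sh Sb) f) (th X).
  apply: (@pair_inj (inc (Tb_sh (Sb Y))) (inc (Sb (Tb_sh X))) _ (sh (b Y) \oL sgT (Sb Y))); first exact: shift_pair.
  pose Sf : lhom (Sb X) (Sb Y) := fmap Sb f.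
  pose Sf1 : lhom (inc (Sb (Tb_sh X))) (inc (Sb (Tb_sh Y))) := fmap Sb (lmap Tb_sh f).
  apply: etrans (_ : sh (b Y) \oL sgT (Sb Y) \oL lmap TK (t Y \oL Sf1) = _); first by [].
  apply: etrans (_ : _ = sh (b Y) \oL sgT (Sb Y) \oL
    lmap TK ((lmap Tb_sh Sf : lhom (inc (Tb_sh (Sb X))) (inc (Tb_sh (Sb Y)))) \oL t X)); last by [].
  have h1 : sh (b Y) \oL sgT (Sb Y) \oL lmap TK (t Y \oL Sf1) =
      sh (lmap KS (f : lhom (inc X) (inc Y)) \oL b X) \oL sgT (Sb X) \oL lmap TK (t X).
    rewrite (lmapM TK (t Y) Sf1) lcompA thE -lcompA (b_nat (lmap Tb_sh f)) lcompA -Kb_shift_nat.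
    by rewrite -(lcompA _ (sgS X)) -thE lmapM !lcompA.
  apply: etrans h1 _; rewrite -b_nat lmapM.
  rewrite -(lcompA (sh (b Y))) (Kb_shift_nat stalkH Sf) lcompA -(lcompA _ (lmap TK _)) -(lmapM TK).
  by [].
exists (@NatIso _ _ (fcomp Sb Tb_sh) (fcomp Tb_sh Sb) th th_nat th_iso).
move=> X Y Z u v w /cone_in_Tb[Z0 [v0 [w0 [c [tri ic cv wc]]]]].
pose Su : lhom (inc (Sb X)) (inc (Sb Y)) := fmap Sb u.
pose Sv : lhom (inc (Sb Y)) (inc (Sb Z)) := fmap Sb v.
pose Sw : lhom (inc (Sb Z)) (inc (Sb (Tb_sh X))) := fmap Sb w.
(* [Q] completes [Sb u] to a triangle. The complex [KS Z0] is resolved by [Sb Z] and, by the five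
   lemma, also by [Q], whence an isomorphism [d : Sb Z -> Q]. Its compatibility with the triangles
   is checked after composing with the resolutions, which [pair_inj] cancels. *)
have [Q [q [r tQ]]] := Tb_cone (fmap Sb u : lhom (Sb X) (Sb Y)).
pose q' : lhom (inc (Sb Y)) (inc Q) := q.
pose r' : lhom (inc Q) (inc (Tb_sh (Sb X))) := r.
pose v' : lhom (inc Y) (inc Z0) := v0.
pose w' : lhom (inc Z0) (inc (Tb_sh X)) := w0.
pose c' : lhom (inc Z) (inc Z0) := c.
have T1 := Kb_ctri stalkH tQ; have T0 := Kb_ctri serreH tri.
have [c1 [c1q c1w]] := tri_map T1 T0 (b_nat u).
have hc1 : bijH W c1 := five W_unshift T1 T0 (b_nat u) c1q c1w (b_bij X) (b_bij Y).
have hbz : bijH W (lmap KS c' \oL b Z).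
  apply: bijH_comp (b_bij Z); apply: iso_bijH; apply: (fmap_iso KS).
  by case: ic => s [s1 s2]; exists s; split; [exact: s1|exact: s2].
have [d0 hd0] := proj2 (hc1 _ (TK_proj (inc (Sb Z)))) (lmap KS c' \oL b Z).
have [d hd] := proj2 (TK_ff (inc (Sb Z)) (inc Q)) d0.
have c1d : c1 \oL lmap TK d = lmap KS c' \oL b Z by rewrite -hd0 -hd.
have id : liso d := pair_iso hbz hc1 c1d.
have dv : d \oL Sv = q'.
  apply: (pair_inj hc1); rewrite lmapM lcompA c1d -lcompA (b_nat v) lcompA -(lmapM KS) c1q.
  by congr (lmap _ _ \oL _).
have rd : r' \oL d = t X \oL Sw.
  apply: (pair_inj (shift_pair X)); rewrite (lmapM TK (t X) Sw) [RHS]lcompA thE -[RHS]lcompA (b_nat w).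
  rewrite (lmapM TK r' d) -(lcompA (sh (b X))) (lcompA (sgT (Sb X))) (lcompA (sh (b X))) -c1w -lcompA c1d.
  rewrite -lcompA (lcompA (lmap KS w')) -(lmapM KS).
  by congr (_ \oL (lmap _ _ \oL _)).
apply/ctri_distinguished.
exists (obj (Sb X)), (obj (Sb Y)), (obj Q), Su, q', r', (lid _), (lid _), d; split; first exact: tQ.
  split; [exact: is_iso1|exact: is_iso1|].
  by case: id => s [s1 s2]; exists s; split; [exact: s1|exact: s2].
split; [exact: etrans (lcomp1m _) (esym (lcompm1 _))|exact: etrans dv (esym (lcompm1 _))|].
by rewrite lmap1; apply: etrans (lcomp1m _) _; exact: esym rd.
Qed.
End Restriction.
End Restrictions.
End SerreFunctor.

Theorem corollary4p4
  (k : comPzRingType) (R : pzRingType) (iota : {rmorphism k -> R})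
  (hR : is_artin_algebra iota)
  (E : lmodType k) (hE : injective_hull (quotmod (jacobson k)) E)
  (C : modR hR -> Prop)
  (Cadd : additive_sub C) (Cfull : strictly_full C)
  (Ckar : karoubi_closed C) (Cff : functorially_finite C)
  (piC : linfunctor (Kminus (modR hR)) (Tcat C))
  (hpiC : is_approximation_functor piC)
  (SA : linfunctor (fullsub (Proj (@heartA k (modR hR))))
                   (fullsub (Inj (@heartA k (modR hR)))))
  (hSA : is_serre E SA) :
  exists (hsub : heart_proj_sub C)
    (hinj : forall P, Inj (heart C) (proj1_sig (preSC piC SA hsub P)))
    (hstalk : forall M : fullsub C,
       Proj (heart C) (stalk (mod0_zero hR) (proj1_sig M))),
    is_equivalence (SC hinj) /\
    (finite_dim C ->
     forall
       (G1 : functor (Dminus (fullsub (heart C)))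
                     (Kminus (fullsub (Proj (heart C)))))
       (G2 : functor (Kminus (fullsub (Proj (heart C)))) (Tcat C)),
       quasi_inverse (KProj_to_D C) G1 ->
       quasi_inverse (T_to_KProj hstalk) G2 ->
       exists Sb : functor (Tbcat C) (Tbcat C),
         restricts_to (extension hstalk (SC hinj) G1 G2) Sb /\
         is_equivalence Sb /\ is_triangulated Sb).
Proof.
have [eta [eta_inj eta_surj eta_adj]] := serre_eta hSA.
have [e [eapp enat]] := hpiC.
have hk := center_artinian hR.
have CO := C_zero Cadd Cfull; have Csplit := C_split hE Ckar.
pose hsub : heart_proj_sub C := @hsub_exists k R iota hR E hE C Cadd Cfull Ckar.
pose hinj := SC_inj hE Cadd Cfull Ckar eapp eta_inj eta_surj hsub.
pose hstalk := hstalk_exists hE Cadd Cfull Ckar eapp eta_inj eta_surj.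
have lapp := left_approx Cadd Cfull Cff.2.
pose et P : {linear lhom (proj1_sig P) (proj1_sig (SC hinj P)) -> E} := etC e eta hsub P.
have et_perfect P : perfect (heart C) (et P) := etC_perfect_heart hE Cadd Cfull Ckar eapp eta_inj eta_surj hsub P.
have et_adj P P' (f : lhom (proj1_sig P) (proj1_sig P')) (v : lhom (proj1_sig P') (proj1_sig (SC hinj P))) :
  et P' ((@lmap k _ _ (SC hinj) P P' f : lhom (proj1_sig (SC hinj P)) (proj1_sig (SC hinj P'))) \oL v)
    = et P (v \oL f) := etC_adj enat eta_adj f v.
exists hsub, hinj, hstalk; split; first exact: (S_equivalence hE CO Csplit lapp hstalk et_perfect et_adj).
have Sff := S_ff hE CO Csplit et_perfect et_adj.
move=> [N hN] G1 G2 hG1 hG2.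
have hres M : exists2 n, has_resolution C M n & (n <= N)%N.
  by have [n [[hn _] nN]] := hN M; exists n.
have Cbi := proj2 Cadd.
have hker := modR_kernels (hR := hR) hE.
have Sinj X (hX : Inj (heart C) X) := S_inj hE CO Csplit lapp hstalk et_perfect et_adj hX.
have Semb X (hX : heart C X) := heart_embed hE CO Csplit lapp hstalk et_perfect hX.
have [eps [eps_bij eps_nat]] := extension_pairs hE hk CO Csplit Cbi et_perfect hG1 hG2.
have [Sb hSb] := restriction_exists CO Csplit hker hres eps_bij.
have [b [b_bij b_nat]] := restriction_pairs eps_bij eps_nat hSb.
exists Sb; split=> //; split.
  exact: (Sb_equivalence hE CO Csplit Cbi et_perfect Sff Sinj Semb hker hres b_bij b_nat).
exact: (Sb_triangulated Cbi b_bij b_nat).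
Qed.
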